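(* Let $a_1,b_1,c_1,d_1,a_2,b_2,c_2,d_2\in(-1,1)$ and $\alpha,\beta,\gamma,\delta\ge0$, and let $j,k,m,n$ be nonnegative integers. Put $$u_{j,k}^{(\gamma,\delta)}(x,y)=p_j(x;a_1,b_1,c_1,d_1q^{\gamma k+\delta}|q)\,p_k(y;a_2,b_2,c_2,d_2|q),\qquad v_{j,k}^{(\gamma,\delta)}(x,y)=\frac{u_{j,k}^{(\gamma,\delta)}(x,y)}{h(x,d_1q^{\gamma k+\delta})},$$ $$p_{j,k}^{(\alpha,\beta,\gamma,\delta)}(x,y)=\frac{p_j(x;a_1,b_1,c_1q^{\alpha k+\beta},d_1q^{\gamma k+\delta}|q)\,p_k(y;a_2,b_2,c_2,d_2|q)}{h(x,c_1q^{\alpha k+\beta})},$$ $$q_{j,k}^{(\alpha,\beta,\gamma,\delta)}(x,y)=\frac{p_j(x;a_1,b_1,c_1q^{\alpha k+\beta},d_1q^{\gamma k+\delta}|q)\,p_k(y;a_2,b_2,c_2,d_2|q)}{h(x,d_1q^{\gamma k+\delta})},$$ $$W_1(x,y)=\frac{h(x,1)h(x,\sqrt q)h(x,-1)h(x,-\sqrt q)}{h(x,a_1)h(x,b_1)h(x,c_1)\sqrt{1-x^2}}\cdot\frac{h(y,1)h(y,\sqrt q)h(y,-1)h(y,-\sqrt q)}{h(y,a_2)h(y,b_2)h(y,c_2)h(y,d_2)\sqrt{1-y^2}},$$ and $W_2(x,y)=h(x,c_1)W_1(x,y)$. Then $$\int_{-1}^1\int_{-1}^1u_{j,k}^{(\gamma,\delta)}(x,y)\,v_{m,n}^{(\gamma,\delta)}(x,y)\,W_1(x,y)\,dx\,dy=K_k\cdot\frac{2\pi\,(a_1b_1c_1d_1q^{2j+\gamma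 k+\delta};q)_\infty\,(a_1b_1c_1d_1q^{j+\gamma k+\delta-1};q)_j\;\delta_{j,m}\delta_{k,n}}{(q^{j+1},a_1b_1q^j,a_1c_1q^j,a_1d_1q^{j+\gamma k+\delta},b_1c_1q^j,b_1d_1q^{j+\gamma k+\delta},c_1d_1q^{j+\gamma k+\delta};q)_\infty}$$ and $$\int_{-1}^1\int_{-1}^1p_{j,k}^{(\alpha,\beta,\gamma,\delta)}(x,y)\,q_{m,n}^{(\alpha,\beta,\gamma,\delta)}(x,y)\,W_2(x,y)\,dx\,dy$$ $$=K_k\cdot\frac{2\pi\,(a_1b_1c_1d_1q^{2j+(\alpha+\gamma)k+\beta+\delta};q)_\infty\,(a_1b_1c_1d_1q^{j+(\alpha+\gamma)k+\beta+\delta-1};q)_j\;\delta_{j,m}\delta_{k,n}}{(q^{j+1},a_1b_1q^j,a_1c_1q^{j+\alpha k+\beta},a_1d_1q^{j+\gamma k+\delta},b_1c_1q^{j+\alpha k+\beta},b_1d_1q^{j+\gamma k+\delta},c_1d_1q^{j+(\alpha+\gamma)k+\beta+\delta};q)_\infty},$$ where $$K_k=\frac{2\pi\,(a_2b_2c_2d_2q^{2k};q)_\infty\,(a_2b_2c_2d_2q^{k-1};q)_k}{(q^{k+1},a_2b_2q^k,a_2c_2q^k,a_2d_2q^k,b_2c_2q^k,b_2d_2q^k,c_2d_2q^k;q)_\infty}.$$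
   Context: $0<q<1$; $(a;q)_n=\prod_{k=0}^{n-1}(1-aq^k)$ (also for $n=\infty$), $(a_1,\dots,a_r;q)_n=\prod_i(a_i;q)_n$. $h(x,a)=\prod_{k=0}^\infty(1-2axq^k+a^2q^{2k})$. The Askey–Wilson polynomials, for $a,b,c,d\in(-1,1)$ and $x=\cos\theta$, are $$p_n(\cos\theta;a,b,c,d|q)=\frac{(ab,ac,ad;q)_n}{a^n}\sum_{k=0}^n\frac{(q^{-n},abcdq^{n-1},ae^{i\theta},ae^{-i\theta};q)_k}{(ab,ac,ad,q;q)_k}\,q^k,$$ extended by continuity to $a=0$. *)

(* Defs.v *)
From HB Require Import structures.
From mathcomp Require Import all_boot all_order all_algebra.
From mathcomp Require Import all_classical all_reals all_analysis.
From mathcomp Require Import complex ring.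

Set Implicit Arguments.
Unset Strict Implicit.
Unset Printing Implicit Defensive.

Import Order.TTheory GRing.Theory Num.Theory.
Import numFieldNormedType.Exports.

Local Open Scope classical_set_scope.
Local Open Scope ring_scope.

Definition qpoch (F : fieldType) (q a : F) (n : nat) : F :=
  \prod_(k < n) (1 - a * q ^+ k).

Definition qpochs (F : fieldType) (q : F) (s : seq F) (n : nat) : F :=
  \prod_(a <- s) qpoch q a n.

Definition qpochinf (R : realType) (q a : R) : R :=
  lim (qpoch q a n @[n --> \oo]).

Definition qpochsinf (R : realType) (q : R) (s : seq R) : R :=
  \prod_(a <- s) qpochinf q a.

Definition h (R : realType) (q x a : R) : R :=
  lim (\prod_(k < n) (1 - 2 * a * x * q ^+ k + a ^+ 2 * q ^+ (2 * k))
        @[n --> \oo]).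

Definition expi (R : realType) (t : R) : R[i] := (cos t +i* sin t)%C.

(* The defining sum, with z standing for e^{i theta}. *)
Definition aw_sum (F : fieldType) (q : F) (n : nat) (a b c d z : F) : F :=
  qpochs q [:: a * b; a * c; a * d] n / a ^+ n *
  \sum_(k < n.+1)
     qpochs q [:: q ^- n; a * b * c * d * q ^ (n%:Z - 1); a * z; a * z^-1] k
     / qpochs q [:: a * b; a * c; a * d; q] k * q ^+ k.

(* For -1 <= x <= 1 the sum at theta = acos x is real and depends on theta
   only through x = cos theta; both facts are contained in [aw_cos] below. *)
Definition aw_nz (R : realType) (q : R) (n : nat) (a b c d x : R) : R :=
  complex.Re (aw_sum q%:C%C n a%:C%C b%:C%C c%:C%C d%:C%C (expi (acos x))).

Definition aw (R : realType) (q : R) (n : nat) (a b c d x : R) : R :=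
  if a == 0 then lim (aw_nz q n a' b c d x @[a' --> 0^']) else
  aw_nz q n a b c d x.

Section aw_real.
Variable R : realType.
Implicit Types q a b c d x t : R.

Lemma expiV t : (expi t)^-1 = (cos t -i* sin t)%C.
Proof.
apply: (@mulfI _ (expi t)).
  apply/eqP => -[] c0 s0; have := cos2Dsin2 t.
  by rewrite c0 s0 expr0n addr0 => /eqP; rewrite eq_sym oner_eq0.
rewrite mulfV; last first.
  apply/eqP => -[] c0 s0; have := cos2Dsin2 t.
  by rewrite c0 s0 expr0n addr0 => /eqP; rewrite eq_sym oner_eq0.
rewrite /expi; apply/eqP; rewrite eq_complex /=; apply/andP; split; apply/eqP.
  by rewrite mulrN opprK -!expr2 cos2Dsin2.
by ring.
Qed.

Let qpoch_rc q a n : qpoch q%:C%C a%:C%C n = (qpoch q a n)%:C%C.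
Proof.
by rewrite /qpoch rmorph_prod; apply: eq_bigr => k _; rewrite rmorphB rmorphM rmorphXn rmorph1.
Qed.

Lemma qpoch_expi q a t n :
  qpoch q%:C%C (a%:C%C * expi t) n * qpoch q%:C%C (a%:C%C * (expi t)^-1) n =
  (\prod_(k < n) (1 - 2 * a * cos t * q ^+ k + a ^+ 2 * q ^+ (2 * k)))%:C%C.
Proof.
rewrite /qpoch -big_split rmorph_prod; apply: eq_bigr => k _ /=.
rewrite expiV -rmorphXn /= mulnC exprM; set Q := q ^+ k.
apply/eqP; rewrite eq_complex /=; apply/andP; split; apply/eqP; last by ring.
have -> : a ^+ 2 = a ^+ 2 * (cos t ^+ 2 + sin t ^+ 2) by rewrite cos2Dsin2 mulr1.
by ring.
Qed.

Let aw_sum_real q n a b c d t :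
  aw_sum q%:C%C n a%:C%C b%:C%C c%:C%C d%:C%C (expi t) =
  (qpochs q [:: a * b; a * c; a * d] n / a ^+ n *
   \sum_(k < n.+1)
     (qpochs q [:: q ^- n; a * b * c * d * q ^ (n%:Z - 1)] k *
      \prod_(i < k) (1 - 2 * a * cos t * q ^+ i + a ^+ 2 * q ^+ (2 * i)))
     / qpochs q [:: a * b; a * c; a * d; q] k * q ^+ k)%:C%C.
Proof.
have qpochs_rc s l : qpochs q%:C%C [seq x%:C%C | x <- s] l = (qpochs q s l)%:C%C.
  by rewrite /qpochs big_map rmorph_prod; apply: eq_bigr => x _; exact: qpoch_rc.
rewrite /aw_sum rmorphM fmorph_div rmorphXn rmorph_sum /=.
rewrite -!qpochs_rc /= !rmorphM; congr (_ * _); apply: eq_bigr => k _.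
rewrite !rmorphM fmorphV rmorphXn /= -!qpochs_rc /= -qpoch_expi.
rewrite !rmorphM fmorphV rmorphXn fmorphXz /=; congr (_ / _ * _).
by rewrite /qpochs !big_cons !big_nil !mulr1 !mulrA.
Qed.

Lemma aw_cos q n a b c d t : a != 0 ->
  (aw q n a b c d (cos t))%:C%C =
  aw_sum q%:C%C n a%:C%C b%:C%C c%:C%C d%:C%C (expi t).
Proof.
move=> /negbTE a0; rewrite /aw a0 /aw_nz !aw_sum_real /= acosK //.
by rewrite in_itv /= cos_geN1 cos_le1.
Qed.

End aw_real.

Definition awu (R : realType) (q a1 b1 c1 d1 a2 b2 c2 d2 gamma delta : R)
    (j k : nat) (x y : R) : R :=
  aw q j a1 b1 c1 (d1 * q `^ (gamma * k%:R + delta)) x * aw q k a2 b2 c2 d2 y.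

Definition awv (R : realType) (q a1 b1 c1 d1 a2 b2 c2 d2 gamma delta : R)
    (j k : nat) (x y : R) : R :=
  awu q a1 b1 c1 d1 a2 b2 c2 d2 gamma delta j k x y /
  h q x (d1 * q `^ (gamma * k%:R + delta)).

Definition awp (R : realType)
    (q a1 b1 c1 d1 a2 b2 c2 d2 alpha beta gamma delta : R)
    (j k : nat) (x y : R) : R :=
  aw q j a1 b1 (c1 * q `^ (alpha * k%:R + beta))
               (d1 * q `^ (gamma * k%:R + delta)) x * aw q k a2 b2 c2 d2 y /
  h q x (c1 * q `^ (alpha * k%:R + beta)).

Definition awq (R : realType)
    (q a1 b1 c1 d1 a2 b2 c2 d2 alpha beta gamma delta : R)
    (j k : nat) (x y : R) : R :=
  aw q j a1 b1 (c1 * q `^ (alpha * k%:R + beta))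
               (d1 * q `^ (gamma * k%:R + delta)) x * aw q k a2 b2 c2 d2 y /
  h q x (d1 * q `^ (gamma * k%:R + delta)).

Definition W1 (R : realType) (q a1 b1 c1 a2 b2 c2 d2 : R) (x y : R) : R :=
  (h q x 1 * h q x (Num.sqrt q) * h q x (-1) * h q x (- Num.sqrt q)) /
  (h q x a1 * h q x b1 * h q x c1 * Num.sqrt (1 - x ^+ 2)) *
  ((h q y 1 * h q y (Num.sqrt q) * h q y (-1) * h q y (- Num.sqrt q)) /
   (h q y a2 * h q y b2 * h q y c2 * h q y d2 * Num.sqrt (1 - y ^+ 2))).

Definition W2 (R : realType) (q a1 b1 c1 a2 b2 c2 d2 : R) (x y : R) : R :=
  h q x c1 * W1 q a1 b1 c1 a2 b2 c2 d2 x y.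

Definition Knorm (R : realType) (q a2 b2 c2 d2 : R) (k : nat) : R :=
  2 * pi * qpochinf q (a2 * b2 * c2 * d2 * q ^+ (2 * k)) *
  qpoch q (a2 * b2 * c2 * d2 * q ^ (k%:Z - 1)) k /
  qpochsinf q [:: q ^+ k.+1; a2 * b2 * q ^+ k; a2 * c2 * q ^+ k;
                 a2 * d2 * q ^+ k; b2 * c2 * q ^+ k; b2 * d2 * q ^+ k;
                 c2 * d2 * q ^+ k].

(* The integral of f over the square [-1,1]^2 exists and equals v. *)
Definition is_square_integral (R : realType) (f : R -> R -> R) (v : R) : Prop :=
  let mu := @lebesgue_measure R in
  let I := `[(-1), 1]%classic : set R in
  (mu \x mu)%E.-integrable (I `*` I) (fun z => (f z.1 z.2)%:E) /\
  (\int[mu]_(y in I) \int[mu]_(x in I) (f x y)%:E = v%:E)%E.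

(* Main.v *)
Require Import Defs.
From HB Require Import structures.
From mathcomp Require Import all_boot all_order all_algebra.
From mathcomp Require Import all_classical all_reals all_analysis.
From mathcomp Require Import measurable_realfun complex ring lra.

Set Implicit Arguments.
Unset Strict Implicit.
Unset Printing Implicit Defensive.

Import Order.TTheory GRing.Theory Num.Theory.
Import numFieldNormedType.Exports.
Import Normc.

(** The integrand is a function of [x] times a function of [y]. If [k != n] the
    integral over [y] vanishes; if [k = n] the two polynomials in [x] have the
    same parameters. So both relations reduce to the orthogonality of the
    Askey-Wilson polynomials in one variable, for all parameters of modulus less than 1.
    With [x = cos t], integration against their weight is the functional
    [awL q a b c d p], the integral of [p (cos t) * 4 sin^2 t] against the
    density [gker q a b c d (cos t)] over [0 <= t <= pi].

    The value [awL q a b c d 1], the Askey-Wilson integral [awL_one], rests on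
    a contour shift. The function
    [F(z) = z (z^2, q z^-2; q)_oo / prod_e (e z, e q / z; q)_oo], where [e] runs
    over the four parameters, satisfies [F(q z) = - F(1 / z)], and its poles
    avoid the annulus [q <= |z| <= 1]. By Cauchy's theorem its means over the
    two boundary circles agree, by the functional equation they are opposite,
    so both are zero. On the unit circle the real part of [F] is
    [2 sin^2 t ((1 - abcd) 2 cos t - e1 + e3)] times the density, with [e1] and
    [e3] the elementary symmetric functions of the parameters: the first moment
    of the weight is determined by its mass ([moment_relation]). Multiplying
    the weight by [1 - 2 a x + a^2] replaces [a] by [a q], hence
    [(1 - abcd) L_(aq)(1) = (1 - ab)(1 - ac)(1 - ad) L_a(1)]. Iteration sends
    each parameter to zero in turn, and the one remaining constant is found from
    the parameters [q, -q, sqrt q, - sqrt q], where the density is 1, with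
    Euler's identity [(-q, sqrt q, - sqrt q; q)_oo = 1].
    Cauchy's theorem enters in an elementary form: the class [shift_inv] of
    functions for which all the Laurent moments over the two circles agree
    contains 1 and is stable under multiplication by [1 - c z^m] and, if
    [|c z^m| <= e < 1] on both circles, under division by it. This is applied to
    finite truncations of [F] that satisfy the functional equation exactly.

    For the orthogonality the polynomial is expanded in the products
    [Phi a k = prod_(i < k) (1 - 2 a q^i x + a^2 q^(2i))] and tested against
    [Phi b l]. Since [Phi a k * Phi b l] only shifts [a] and [b] in the weight,
    every term is an Askey-Wilson integral, and the pairing becomes a sum
    [\sum_k (q^-n; q)_k / (q; q)_k q^k G(q^k)]. For [l < n], [G] is a polynomial
    of degree less than [n] and the sum vanishes; for [l = n], [G] has one simple
    pole and the sum is still explicit. This requires [a] and [b] nonzero.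
    A zero parameter is a limit: both sides are polynomials in the parameter with
    coefficients in [R[x]], and the weight is continuous. For [a] this also
    requires the division by [a^n] in the definition to be exact, which holds
    because the coefficient of [a^m] in the numerator is again such a sum with
    [G] of degree at most [m] ([qreg], [num_a_low]). *)

Local Open Scope ring_scope.
Local Open Scope classical_set_scope.

(** * Finite q-sums *)

Lemma leq_sizeM (R : nzRingType) (p r : {poly R}) m n :
  (size p <= m.+1)%N -> (size r <= n.+1)%N -> (size (p * r)%R <= (m + n).+1)%N.
Proof.
move=> sp sr; apply: leq_trans (size_polyMleq _ _) _.
by rewrite -subn1 leq_subLR add1n -addnS -addSn leq_add.
Qed.

Lemma size_prod_linear (R : nzRingType) (u : nat -> R) n :
  (size (\prod_(i < n) (1 - u i *: 'X))%R <= n.+1)%N.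
Proof.
elim: n => [|n IHn]; first by rewrite big_ord0 size_polyC oner_eq0.
rewrite big_ord_recr /= -addn1; apply: leq_sizeM => //.
rewrite (leq_trans (size_polyD _ _)) // size_polyN geq_max size_polyC oner_eq0.
by rewrite (leq_trans (size_scale_leq _ _)) // size_polyX.
Qed.

Section finite_q.
Variables (F : fieldType) (q : F).
Implicit Types (a b c : F) (n k : nat).

Lemma qpoch0 a : qpoch q a 0 = 1.
Proof. by rewrite /qpoch big_ord0. Qed.

Lemma qpochSr a n : qpoch q a n.+1 = qpoch q a n * (1 - a * q ^+ n).
Proof. by rewrite /qpoch big_ord_recr. Qed.

Lemma qpochSl a n : qpoch q a n.+1 = (1 - a) * qpoch q (a * q) n.
Proof.
rewrite /qpoch big_ord_recl expr0 mulr1; congr (_ * _).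
by apply: eq_bigr => i _; rewrite /= /bump /= exprS mulrA.
Qed.

Lemma qpochD a m n : qpoch q a (m + n) = qpoch q a m * qpoch q (a * q ^+ m) n.
Proof.
elim: n => [|n IH]; first by rewrite addn0 qpoch0 mulr1.
by rewrite addnS !qpochSr IH -mulrA exprD (mulrA a).
Qed.

Lemma qpoch_neq0 a n :
  (forall k, (k < n)%N -> 1 - a * q ^+ k != 0) -> qpoch q a n != 0.
Proof. by move=> H; apply/prodf_neq0 => k _; exact: H. Qed.

Hypothesis q0 : q != 0.
Hypothesis q1 : forall k, 1 - q ^+ k.+1 != 0.

Lemma qq_neq0 n : qpoch q q n != 0.
Proof. by apply: qpoch_neq0 => k _; rewrite -exprS. Qed.

(** The signed Gaussian binomial [(-1)^k q^(k(k-1)/2) binom(n, k)_q], written as a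
    product that carries the sign and the power of [q]. *)
Definition qbinsign n k : F :=
  \prod_(i < k) (q ^+ n - q ^+ i) / qpoch q q k.

Lemma qbinsign0 n : qbinsign n 0 = 1.
Proof. by rewrite /qbinsign big_ord0 qpoch0 divr1. Qed.

Lemma qbinsign_gt n k : (n < k)%N -> qbinsign n k = 0.
Proof.
move=> nk; rewrite /qbinsign (bigD1 (Ordinal nk)) //= subrr !mul0r.
by [].
Qed.

Lemma qbinsign_pascal n k :
  qbinsign n.+1 k.+1 = qbinsign n k.+1 - q ^+ n * qbinsign n k.
Proof.
have E : \prod_(i < k.+1) (q ^+ n.+1 - q ^+ i) =
   (q ^+ n.+1 - 1) * (q ^+ k * \prod_(i < k) (q ^+ n - q ^+ i)).
  rewrite big_ord_recl expr0; congr (_ * _).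
  have -> : q ^+ k = \prod_(i < k) q by rewrite prodr_const card_ord.
  rewrite -big_split /=; apply: eq_bigr => i _.
  by rewrite /bump /= !exprS mulrBr.
have k0 := qq_neq0 k; have k1 : 1 - q * q ^+ k != 0 by rewrite -exprS.
rewrite /qbinsign E big_ord_recr /= !qpochSr !exprS.
field; rewrite k0 /=.
by rewrite k1.
Qed.

(** The finite q-binomial theorem, by Pascal's rule on [n]. *)
Lemma qbinomial n y : \sum_(k < n.+1) qbinsign n k * y ^+ k = qpoch q y n.
Proof.
elim: n => [|n IH]; first by rewrite big_ord1 qbinsign0 qpoch0 expr0 mulr1.
rewrite big_ord_recl qbinsign0 expr0 mulr1.
under eq_bigr => k _ do rewrite lift0 qbinsign_pascal mulrBl.
rewrite sumrB addrA qpochSr -IH mulrBr mulr1; congr (_ - _).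
  rewrite [in RHS]big_ord_recl qbinsign0 expr0 mulr1; congr (_ + _).
  rewrite big_ord_recr /= qbinsign_gt // mul0r addr0.
  by apply: eq_bigr.
rewrite mulr_suml; apply: eq_bigr => k _; rewrite exprS; ring.
Qed.

(** The factor common to the terminating basic hypergeometric sums of order [n].
    Pairing it with a function of [q^k] is, up to normalization, taking an n-th
    q-difference. *)
Definition qweight n k : F := qpoch q (q ^- n) k / qpoch q q k * q ^+ k.

Lemma qweightE n k : qweight n k = qbinsign n k * (q / q ^+ n) ^+ k.
Proof.
have n0 : q ^+ n != 0 by rewrite expf_neq0.
have E : qpoch q (q ^- n) k = \prod_(i < k) (q ^+ n - q ^+ i) * (q ^+ n)^-1 ^+ k.
  have -> : (q ^+ n)^-1 ^+ k = \prod_(i < k) (q ^+ n)^-1 by rewrite prodr_const card_ord.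
  rewrite -big_split /=.
  by apply: eq_bigr => i _; rewrite mulrBl mulfV // mulrC.
rewrite /qweight E /qbinsign expr_div_n exprVn; field.
by rewrite qq_neq0 expf_neq0.
Qed.

(** On the monomial [y^i] the q-binomial theorem gives [(q^(i + 1 - n); q)_n], and
    for [i < n] its factor of index [n - 1 - i] is zero. *)
Lemma sum_qweight_horner n (p : {poly F}) : (size p <= n)%N ->
  \sum_(k < n.+1) qweight n k * p.[q ^+ k] = 0.
Proof.
move=> sp; under eq_bigr => k _ do rewrite horner_coef mulr_sumr.
rewrite exchange_big /=; apply: big1 => i _.
have jn : (i < n)%N by apply: leq_trans sp.
transitivity (p`_i * \sum_(k < n.+1) qbinsign n k * (q * q ^+ i / q ^+ n) ^+ k).
  rewrite mulr_sumr; apply: eq_bigr => k _.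
  rewrite qweightE !exprMn !exprVn -!exprM (mulnC i k); ring.
rewrite qbinomial /qpoch.
have jn' : (n - i.+1 < n)%N by rewrite -subSn // leq_subLR addSn ltnS leq_addl.
rewrite (bigD1 (Ordinal jn')) //= -exprS mulrAC -exprD addnC subnK // mulfV ?expf_neq0 //.
by rewrite subrr mul0r mulr0.
Qed.

(** The partial fraction expansion in [c] of the right-hand side, by Pascal's
    rule. *)
Lemma sum_qbinsign_pole n c : (forall k, 1 - c * q ^+ k != 0) ->
  \sum_(k < n.+1) qbinsign n k * q ^+ k / (1 - c * q ^+ k) =
  qpoch q q n / qpoch q c n.+1.
Proof.
elim: n c => [|n IH] c hc.
  by rewrite big_ord1 qbinsign0 !expr0 mulr1 qpochSr !qpoch0 !mul1r expr0.
have hcq k : 1 - c * q * q ^+ k != 0 by rewrite -mulrA -exprS.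
have c0 : 1 - c != 0 by move: (hc 0%N); rewrite expr0 mulr1.
have D1 : qpoch q (c * q) n != 0 by apply: qpoch_neq0.
have D2 : qpoch q c n.+1 != 0 by apply: qpoch_neq0.
rewrite big_ord_recl qbinsign0 expr0 !mulr1.
under eq_bigr => k _ do rewrite lift0 qbinsign_pascal !mulrBl.
rewrite sumrB addrA.
transitivity (qpoch q q n / qpoch q c n.+1 - q ^+ n.+1 * (qpoch q q n / qpoch q (c * q) n.+1)).
  congr (_ - _).
    rewrite -IH // [in RHS]big_ord_recl qbinsign0 expr0 !mulr1; congr (_ + _).
    rewrite big_ord_recr /= qbinsign_gt // !mul0r addr0.
    by apply: eq_bigr.
  rewrite -(IH (c * q)) // mulr_sumr; apply: eq_bigr => k _.
  by rewrite -[c * q * _]mulrA -exprS [q ^+ n.+1]exprSr [q ^+ k.+1]exprS; ring.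
rewrite [qpoch q c n.+2]qpochSl qpochSl [qpoch q (c * q) n.+1]qpochSr [qpoch q q n.+1]qpochSr.
rewrite -[c * q * q ^+ n]mulrA -[q * q ^+ n]exprS.
field.
by rewrite hc D1 c0.
Qed.

(** A substitute for the q-Saalschuetz sum. In passing from [j] to [j + 1], write
    the new factor as [1 - b q^j y = (1 - c y) + (c - b q^j) y] at [y = q^k]: the
    first term cancels the pole and leaves a polynomial of degree less than [n],
    which the sum kills, and the second one multiplies the value for [j] by
    [c - b q^j]. *)
Lemma sum_qweight_pole n j b c : (j <= n)%N -> (forall k, 1 - c * q ^+ k != 0) ->
  \sum_(k < n.+1) qweight n k * (qpoch q (b * q ^+ k) j * (q ^+ k) ^+ (n - j))
     / (1 - c * q ^+ k) =
  qpoch q q n / qpoch q c n.+1 * \prod_(i < j) (c - b * q ^+ i).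
Proof.
move=> jn hc; elim: j jn => [|j IH] jn.
  rewrite big_ord0 mulr1 -sum_qbinsign_pole //; apply: eq_bigr => k _.
  have E : (q / q ^+ n) ^+ k * (q ^+ k) ^+ n = q ^+ k.
    by rewrite -exprM mulnC exprM -exprMn divfK ?expf_neq0.
  by rewrite qpoch0 mul1r subn0 qweightE -(mulrA (qbinsign n k)) E.
pose p : {poly F} := \prod_(i < j) (1 - (b * q ^+ i) *: 'X) * 'X^(n - j.+1).
have pE k : p.[q ^+ k] = qpoch q (b * q ^+ k) j * (q ^+ k) ^+ (n - j.+1).
  rewrite /p hornerM hornerXn horner_prod; congr (_ * _); apply: eq_bigr => i _.
  by rewrite !hornerE mulrAC.
have sp : (size p <= n)%N.
  rewrite [X in (_ <= X)%N](_ : n = (j + (n - j.+1)).+1); last by rewrite -addSn subnKC.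
  apply: leq_sizeM; last by rewrite size_polyXn.
  exact: (size_prod_linear (fun i => b * q ^+ i)).
rewrite [in RHS]big_ord_recr /= mulrA -IH ?(ltnW jn) // mulr_suml.
rewrite -[LHS]subr0 -[X in _ - X](sum_qweight_horner sp) -sumrB; apply: eq_bigr => k _.
rewrite pE qpochSr -(subnSK jn) [_ ^+ (n - j.+1).+1]exprS.
by field; rewrite hc.
Qed.

End finite_q.

(** * Convergence and bounds of the infinite products *)

Section products.
Variables (R : realType) (q : R).
Hypothesis hq : 0 < q < 1.
Implicit Types (a x y r C : R) (f : nat -> R).

Let q_gt0 : 0 < q. Proof. by case/andP: hq. Qed.
Let q_lt1 : q < 1. Proof. by case/andP: hq. Qed.
Let q_ge0 : 0 <= q. Proof. exact: ltW. Qed.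
Let q1_gt0 : 0 < 1 - q. Proof. by rewrite subr_gt0. Qed.

Lemma qX_ge0 k : 0 <= q ^+ k. Proof. exact: exprn_ge0. Qed.
Lemma qX_le1 k : q ^+ k <= 1. Proof. by rewrite exprn_ile1 // ltW. Qed.

Lemma one_sub_qX_neq0 k : 1 - q ^+ k.+1 != 0.
Proof. by rewrite subr_eq0 eq_sym lt_eqF // exprn_ilt1. Qed.

Lemma sum_geom_le N : \sum_(k < N) q ^+ k <= (1 - q)^-1.
Proof.
rewrite -[leRHS]mul1r ler_pdivlMr // mulrC -opprB mulNr -subrX1 opprB.
by rewrite gerBl qX_ge0.
Qed.

Lemma prod_near1_bounded f C N : 0 <= C -> (forall k, `|f k - 1| <= C * q ^+ k) ->
  `|\prod_(k < N) f k| <= expR (C / (1 - q)).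
Proof.
move=> C0 hf; apply: (@le_trans _ _ (expR (\sum_(k < N) C * q ^+ k))); last first.
  by rewrite ler_expR -mulr_sumr ler_wpM2l // sum_geom_le.
rewrite expR_sum normr_prod; apply: ler_prod => k _; rewrite normr_ge0 /=.
rewrite (le_trans _ (expR_ge1Dx _)) // -[f k](subrK 1) (le_trans (ler_normD _ _)) //.
by rewrite normr1 addrC lerD2l.
Qed.

(** The increments of the partial products are at most [B * C * q^n], where [B]
    bounds all the partial products, so their series converges absolutely. *)
Lemma prod_near1_cvg f C : 0 <= C -> (forall k, `|f k - 1| <= C * q ^+ k) ->
  cvgn (fun N => \prod_(k < N) f k).
Proof.
move=> C0 hf; pose u N := \prod_(k < N) f k; set B := expR (C / (1 - q)).
rewrite (_ : (fun N => _) = (fun N => u 0%N + series (telescope u) N)); last first.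
  by apply/funext => N; rewrite -eq_sum_telescope.
apply: is_cvgD; first exact: is_cvg_cst.
apply: normed_cvg; apply: (@series_le_cvg _ _ (geometric (B * C) q)) => [n|n|n|].
- exact: normr_ge0.
- by rewrite /= mulr_ge0 ?qX_ge0 // mulr_ge0 // expR_ge0.
- have E : u n.+1 - u n = u n * (f n - 1) by rewrite /u big_ord_recr /= mulrBr mulr1.
  change (`|u n.+1 - u n| <= B * C * q ^+ n); rewrite E.
  by rewrite normrM /= -mulrA ler_pM // prod_near1_bounded.
- by apply: is_cvg_geometric_series; rewrite ger0_norm.
Qed.

Lemma prod_expR_lower f C N : 0 <= C -> (forall k, expR (- (C * q ^+ k)) <= f k) ->
  expR (- (C / (1 - q))) <= \prod_(k < N) f k.
Proof.
move=> C0 hf; apply: (@le_trans _ _ (expR (\sum_(k < N) - (C * q ^+ k)))).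
  by rewrite ler_expR sumrN lerN2 -mulr_sumr ler_wpM2l // sum_geom_le.
by rewrite expR_sum; apply: ler_prod => k _; rewrite expR_ge0 hf.
Qed.

(** An exponential lower bound for each factor survives in the infinite product,
    which is thereby nonzero. The rate [r / (1 - r)] comes from
    [1 / (1 - r) <= exp (r / (1 - r))]. *)
Lemma expR_le_one_sub r y : 0 <= r < 1 -> 0 <= y <= 1 ->
  expR (- (r / (1 - r) * y)) <= 1 - r * y.
Proof.
move=> /andP[r0 r1] /andP[y0 y1]; set t := r / (1 - r) * y.
have r1' : 0 < 1 - r by rewrite subr_gt0.
have ry : 0 < 1 - r * y by rewrite subr_gt0 (le_lt_trans _ r1) // ler_piMr.
rewrite expRN -[leRHS]invrK lef_pV2 ?posrE ?expR_gt0 ?invr_gt0 //.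
apply: le_trans (expR_ge1Dx t); rewrite -[leLHS]mul1r ler_pdivrMr //.
have -> : (1 + t) * (1 - r * y) = 1 + r * y * (r * (1 - y) / (1 - r)).
  by rewrite /t; field; rewrite gt_eqF.
by rewrite lerDl !mulr_ge0 // ?subr_ge0 // invr_ge0 ltW.
Qed.

Definition hfin x a N : R :=
  \prod_(k < N) (1 - 2 * a * x * q ^+ k + a ^+ 2 * q ^+ (2 * k)).

Lemma hfinS x a N :
  hfin x a N.+1 = (1 - 2 * a * x + a ^+ 2) * hfin x (a * q) N.
Proof.
rewrite /hfin big_ord_recl /= muln0 !expr0 !mulr1; congr (_ * _).
by apply: eq_bigr => k _; rewrite /= /bump /= !exprM !exprS; ring.
Qed.

Lemma hfinSr x a N : hfin x a N.+1 =
  hfin x a N * (1 - 2 * a * x * q ^+ N + a ^+ 2 * q ^+ (2 * N)).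
Proof. by rewrite /hfin big_ord_recr. Qed.

Lemma hfinD x a m n : hfin x a (m + n) = hfin x a m * hfin x (a * q ^+ m) n.
Proof.
elim: n => [|n IH]; first by rewrite addn0 /hfin big_ord0 mulr1.
rewrite addnS !hfinSr IH -mulrA.
congr (_ * (_ * _)); rewrite !(mulnC 2) !exprM !exprD; ring.
Qed.

Lemma hfin_near1 x a k : `|x| <= 1 -> `|a| <= 1 ->
  `|1 - 2 * a * x * q ^+ k + a ^+ 2 * q ^+ (2 * k) - 1| <= 3 * q ^+ k.
Proof.
move=> x1 a1; rewrite mulnC exprM; move: (qX_ge0 k) (qX_le1 k); move: (q ^+ k) => y y0 y1.
have -> : 1 - 2 * a * x * y + a ^+ 2 * y ^+ 2 - 1 = (a ^+ 2 * y - 2 * (a * x)) * y by ring.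
rewrite normrM (ger0_norm y0) ler_wpM2r // (le_trans (ler_normB _ _)) //.
rewrite normrM normrX (ger0_norm y0) normrM (@ger0_norm _ 2) // normrM.
rewrite (_ : 3 = 1 * 1 + 2 * (1 * 1)); last by ring.
by rewrite lerD // ?ler_pM // ?mulr_ge0 ?exprn_ge0 ?exprn_ile1 // ler_pM.
Qed.

Lemma hfin_cvg x a : `|x| <= 1 -> `|a| <= 1 -> hfin x a N @[N --> \oo] --> h q x a.
Proof.
move=> x1 a1; apply: (@prod_near1_cvg
  (fun k => 1 - 2 * a * x * q ^+ k + a ^+ 2 * q ^+ (2 * k)) 3) => // k.
exact: hfin_near1.
Qed.

Lemma hfin_ub x a N : `|x| <= 1 -> `|a| <= 1 -> `|hfin x a N| <= expR (3 / (1 - q)).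
Proof.
move=> x1 a1; apply: (@prod_near1_bounded
  (fun k => 1 - 2 * a * x * q ^+ k + a ^+ 2 * q ^+ (2 * k)) 3) => // k.
exact: hfin_near1.
Qed.

(** A lower bound for all the truncations of [h q x a], uniform for [|x| <= 1] and
    [|a| <= r]. *)
Definition hlow r : R := expR (- (2 * (r / (1 - r)) / (1 - q))).

Lemma hfin_lb x a r N : `|x| <= 1 -> `|a| <= r -> r < 1 -> hlow r <= hfin x a N.
Proof.
move=> x1 ar r1; have r0 : 0 <= r := le_trans (normr_ge0 _) ar.
apply: (@prod_expR_lower (fun k => 1 - 2 * a * x * q ^+ k + a ^+ 2 * q ^+ (2 * k))).
  by rewrite mulr_ge0 // divr_ge0 // subr_ge0 ltW.
move=> k; rewrite mulnC [q ^+ (_ * _)]exprM.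
move: (qX_ge0 k) (qX_le1 k); move: (q ^+ k) => y y0 y1.
apply: (@le_trans _ _ ((1 - r * y) ^+ 2)).
  have -> : - (2 * (r / (1 - r)) * y) = - (r / (1 - r) * y) + - (r / (1 - r) * y) by ring.
  by rewrite expRD -expr2 lerXn2r // ?nnegrE ?expR_ge0 // ?expR_le_one_sub ?r0 ?y0 //
    subr_ge0 (le_trans _ (ltW r1)) // ler_piMr.
have ax : `|a * x| <= r by rewrite normrM (le_trans _ ar) // ler_piMr.
have x2 : x ^+ 2 <= 1 by rewrite -real_normK ?num_real // exprn_ile1.
(* For [x = cos t] the factor is [|1 - a y e^(it)|^2], at least [(1 - r y)^2]. *)
have -> : 1 - 2 * a * x * y + a ^+ 2 * y ^+ 2 =
  (1 - a * x * y) ^+ 2 + a ^+ 2 * (1 - x ^+ 2) * y ^+ 2 by ring.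
apply: ler_wpDr; first by apply: mulr_ge0; [apply: mulr_ge0|]; rewrite ?sqr_ge0 ?subr_ge0.
have ry : 0 <= 1 - r * y by rewrite subr_ge0 (le_trans _ (ltW r1)) // ler_piMr.
have : 1 - r * y <= 1 - a * x * y.
  by rewrite lerD2l lerN2 ler_wpM2r // (le_trans (ler_norm _)).
by move=> le; rewrite lerXn2r // nnegrE // (le_trans ry).
Qed.

Lemma hlow_gt0 r : 0 < hlow r. Proof. exact: expR_gt0. Qed.

Lemma h_lb x a r : `|x| <= 1 -> `|a| <= r -> r < 1 -> hlow r <= h q x a.
Proof.
move=> x1 ar r1; have a1 : `|a| <= 1 by rewrite (le_trans ar) // ltW.
have H := hfin_cvg x1 a1.
rewrite -(cvg_lim (@Rhausdorff R) H); apply: limr_ge; first by apply/cvg_ex; exists (h q x a).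
by apply: nearW => N; exact: hfin_lb.
Qed.

Lemma h_gt0 x a : `|x| <= 1 -> `|a| < 1 -> 0 < h q x a.
Proof. by move=> x1 a1; apply: lt_le_trans (hlow_gt0 _) (h_lb x1 (lexx _) a1). Qed.

Lemma normM_qX a k : `|a| <= 1 -> `|a * q ^+ k| <= 1.
Proof. by move=> a1; rewrite normrM (ger0_norm (qX_ge0 k)) mulr_ile1 ?qX_ge0 ?qX_le1. Qed.

Lemma h_split x a m : `|x| <= 1 -> `|a| <= 1 ->
  h q x a = hfin x a m * h q x (a * q ^+ m).
Proof.
move=> x1 a1.
have H : hfin x a (m + N) @[N --> \oo] --> h q x a.
  have := hfin_cvg x1 a1; rewrite -(cvg_shiftn m).
  by rewrite (_ : (fun N => _) = (fun N => hfin x a (m + N))) //; apply/funext => N; rewrite addnC.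
apply: (cvg_unique _ H) => //.
rewrite (_ : (fun N => _) = (fun N => hfin x a m * hfin x (a * q ^+ m) N)); last first.
  by apply/funext => N; rewrite hfinD.
apply: cvgM; first exact: cvg_cst.
by apply: hfin_cvg; rewrite ?normM_qX.
Qed.

Lemma h_shift x a : `|x| <= 1 -> `|a| <= 1 ->
  h q x a = (1 - 2 * a * x + a ^+ 2) * h q x (a * q).
Proof. by move=> x1 a1; rewrite (h_split 1 x1 a1) hfinS /hfin big_ord0 mulr1 expr1. Qed.

Lemma h0 x : h q x 0 = 1.
Proof.
rewrite /h (_ : (fun n => _) = fun=> 1) ?lim_cst //; apply/funext => n.
by rewrite big1 // => k _; rewrite mulr0 !mul0r expr0n mul0r subr0 addr0.
Qed.

Lemma h_small_cvg x a : `|x| <= 1 -> `|a| < 1 ->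
  h q x (a * q ^+ N) @[N --> \oo] --> (1 : R).
Proof.
move=> x1 a1; have ha := h_gt0 x1 a1.
have fN N : hfin x a N != 0 by rewrite gt_eqF // (lt_le_trans (hlow_gt0 `|a|)) // hfin_lb.
have -> : (fun N => h q x (a * q ^+ N)) = (fun N => h q x a * (hfin x a N)^-1).
  by apply/funext => N; rewrite (h_split N x1 (ltW a1)) mulrAC mulfV ?mul1r.
rewrite -(@mulfV _ (h q x a)) ?gt_eqF //.
apply: cvgM; first exact: cvg_cst.
by apply: cvgV; [rewrite gt_eqF|apply: hfin_cvg => //; exact: ltW].
Qed.

Lemma qpoch_near1 a k : `|a| <= 1 -> `|1 - a * q ^+ k - 1| <= 1 * q ^+ k.
Proof.
by move=> a1; rewrite addrC addKr normrN normrM (ger0_norm (qX_ge0 k)) ler_wpM2r ?qX_ge0.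
Qed.

Lemma qpoch_cvg a : `|a| <= 1 -> qpoch q a N @[N --> \oo] --> qpochinf q a.
Proof.
move=> a1; apply: (@prod_near1_cvg (fun k => 1 - a * q ^+ k) 1) => // k.
exact: qpoch_near1.
Qed.

Lemma qpochinf_neq0 a : `|a| < 1 -> qpochinf q a != 0.
Proof.
move=> a1; have := qpoch_cvg (ltW a1) => H.
suff : expR (- (`|a| / (1 - `|a|) / (1 - q))) <= qpochinf q a.
  by move=> ge; rewrite gt_eqF // (lt_le_trans (expR_gt0 _) ge).
rewrite -(cvg_lim (@Rhausdorff R) H); apply: limr_ge.
  by apply/cvg_ex; exists (qpochinf q a).
apply: nearW => N; apply: (@prod_expR_lower (fun k => 1 - a * q ^+ k)).
  by rewrite divr_ge0 // subr_ge0 ltW.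
move=> k; apply: le_trans (expR_le_one_sub _ _) _; rewrite ?normr_ge0 ?a1 ?qX_ge0 ?qX_le1 //.
by rewrite lerD2l lerN2 ler_wpM2r ?qX_ge0 // ler_norm.
Qed.

Lemma qpochinf_split a m : `|a| <= 1 ->
  qpochinf q a = qpoch q a m * qpochinf q (a * q ^+ m).
Proof.
move=> a1; have H : qpoch q a (m + N) @[N --> \oo] --> qpochinf q a.
  have := qpoch_cvg a1; rewrite -(cvg_shiftn m).
  by rewrite (_ : (fun N => _) = (fun N => qpoch q a (m + N))) //; apply/funext => N; rewrite addnC.
apply: (cvg_unique _ H) => //.
rewrite (_ : (fun N => _) = (fun N => qpoch q a m * qpoch q (a * q ^+ m) N)); last first.
  by apply/funext => N; rewrite qpochD.
apply: cvgM; first exact: cvg_cst.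
by apply: qpoch_cvg; rewrite normM_qX.
Qed.

Lemma qpochinf0 : qpochinf q 0 = 1.
Proof.
rewrite /qpochinf (_ : qpoch q 0 = fun=> 1) ?lim_cst //; apply/funext => n.
by rewrite /qpoch big1 // => k _; rewrite mul0r subr0.
Qed.

Lemma one_sub_neq0 a k : `|a| < 1 -> 1 - a * q ^+ k != 0.
Proof.
move=> a1; rewrite subr_eq0 eq_sym; apply/eqP => e.
have : `|a * q ^+ k| < 1.
  by rewrite normrM (ger0_norm (qX_ge0 k)) (le_lt_trans _ a1) // ler_piMr ?qX_le1.
by rewrite e normr1 ltxx.
Qed.

Lemma qpoch_small_neq0 a n : `|a| < 1 -> qpoch q a n != 0.
Proof. by move=> a1; apply: qpoch_neq0 => k _; exact: one_sub_neq0. Qed.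

End products.

(** * Bounded measurable functions on an interval *)

Section bounded_measurable.
Variables (R : realType) (l r : R).
Let I : set R := `[l, r].
Local Notation mu := (@lebesgue_measure R).
Implicit Types (f g : R -> R).

(** All the integrands of one variable lie in this class, where integrability is
    automatic. *)
Definition bmeas f :=
  measurable_fun I f /\ exists C, forall t, I t -> `|f t| <= C.

Let mI : measurable I. Proof. exact: measurable_itv. Qed.

Let muI : (mu I < +oo)%E.
Proof.
by rewrite /I lebesgue_measure_itv /=; case: ifP => _; rewrite -?EFinB ltry.
Qed.

Lemma bmeas_integrable f : bmeas f -> mu.-integrable I (EFin \o f).
Proof.
move=> [mf [C hC]]; apply: measurable_bounded_integrable => //.
exists C; split; first exact: num_real.
by move=> M CM t It; rewrite /= (le_trans (hC t It)) // ltW.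
Qed.

Lemma bmeas_cst c : bmeas (fun=> c).
Proof. by split; [exact: measurable_cst|exists `|c|]. Qed.

Lemma bmeasM f g : bmeas f -> bmeas g -> bmeas (fun t => f t * g t).
Proof.
move=> [mf [C hC]] [mg [D hD]]; split; first exact: measurable_funM.
by exists (C * D) => t It; rewrite normrM ler_pM ?hC ?hD.
Qed.

Lemma bmeas_continuous f : continuous f -> bmeas f.
Proof.
move=> cf; split.
  by apply: measurable_funTS; apply: continuous_measurable_fun.
have [lr|rl] := leP l r; last first.
  by exists 0 => t; rewrite /I /= in_itv /= => /andP[/le_trans h /h]; rewrite leNgt rl.
have [|c _ hc] := @EVT_max R (fun t => `|f t|) l r lr.
  apply: continuous_subspaceT => t; apply: continuous_comp; first exact: cf.
  exact: norm_continuous.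
by exists `|f c| => t It; apply: hc.
Qed.

Definition bint f : R := \int[mu]_(t in I) f t.

Lemma bintD f g : bmeas f -> bmeas g ->
  bint (fun t => f t + g t) = bint f + bint g.
Proof. by move=> hf hg; rewrite /bint RintegralD //; exact: bmeas_integrable. Qed.

Lemma bintZ c f : bmeas f -> bint (fun t => c * f t) = c * bint f.
Proof. by move=> hf; rewrite /bint RintegralZl //; exact: bmeas_integrable. Qed.

Lemma eq_bint f g : {in I, f =1 g} -> bint f = bint g.
Proof. by move=> fg; apply: eq_Rintegral. Qed.

Lemma bint_cst c : l <= r -> bint (fun=> c) = c * (r - l).
Proof.
move=> lr; have E : fine (mu I) = r - l.
  rewrite /I lebesgue_measure_itv /= lte_fin; case: ltP => [_ //|rl].
  by apply/esym/eqP; rewrite subr_eq0 eq_le rl lr.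
by rewrite /bint Rintegral_cst //; congr (_ * _); exact: E.
Qed.

Lemma bint_norm_le f B : l <= r -> bmeas f -> (forall t, I t -> `|f t| <= B) ->
  `|bint f| <= B * (r - l).
Proof.
move=> lr bf hB; have [mf [C hC]] := bf.
have bn : bmeas (fun t => `|f t|).
  split; first exact: measurableT_comp.
  by exists C => t It; rewrite normr_id hC.
rewrite -(bint_cst B lr) /bint.
apply: le_trans (le_normr_Rintegral _ (bmeas_integrable bf)) _; first exact: mI.
by apply: le_Rintegral => //; [exact: bmeas_integrable bn|exact: bmeas_integrable (bmeas_cst B)].
Qed.

(** Bounded convergence. The limit stays in the class, so that densities given by
    infinite products inherit measurability from their truncations. *)
Lemma bint_cvg (f_ : nat -> R -> R) f (C : R) :
  (forall n, measurable_fun I (f_ n)) ->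
  (forall n t, I t -> `|f_ n t| <= C) ->
  (forall t, I t -> f_ n t @[n --> \oo] --> f t) ->
  bmeas f /\ bint (f_ n) @[n --> \oo] --> bint f.
Proof.
move=> mf hC ff.
have bn n : bmeas (f_ n) by split => //; exists C; exact: hC.
have bf : bmeas f.
  split; first by apply: (@measurable_fun_cvg _ _ _ I f_).
  exists C => t It; have H : `|f_ n t| @[n --> \oo] --> `|f t|.
    by apply: cvg_norm; exact: ff.
  rewrite -(cvg_lim (@Rhausdorff R) H); apply: limr_le; first by apply/cvg_ex; exists `|f t|.
  by apply: nearW => N; exact: hC.
split => //.
have mE n : measurable_fun I (EFin \o f_ n) by apply/measurable_EFinP.
have mEf : measurable_fun I (EFin \o f) by apply/measurable_EFinP; case: bf.
have cE : {ae mu, forall t, I t -> (EFin \o f_ n) t @[n --> \oo] --> (EFin \o f) t}.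
  by apply: aeW => t It; apply: cvg_EFin; [exact: nearW|exact: ff].
have bE : {ae mu, forall t n, I t -> (`|(EFin \o f_ n) t| <= cst C%:E t)%E}.
  by apply: aeW => t n It; rewrite /= lee_fin hC.
have [_ _ H] := @dominated_convergence _ _ R mu I mI
  (fun n => EFin \o f_ n) (EFin \o f) (cst C%:E) mE mEf cE (bmeas_integrable (bmeas_cst C)) bE.
rewrite /bint /Rintegral.
have fin : (\int[mu]_(x in I) (EFin \o f) x)%E \is a fin_num.
  by apply: integrable_fin_num => //; exact: bmeas_integrable.
by apply: fine_cvg; rewrite fineK.
Qed.

End bounded_measurable.

(** * Complex functions on circles *)

Section complex_facts.
Variable R : realType.
Implicit Types (z w : R[i]) (c t : R).

Lemma cReM z w : complex.Re (z * w) = complex.Re z * complex.Re w - complex.Im z * complex.Im w.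
Proof. by case: z => a b; case: w => c d. Qed.

Lemma cImM z w : complex.Im (z * w) = complex.Re z * complex.Im w + complex.Im z * complex.Re w.
Proof. by case: z => a b; case: w => c d. Qed.

Lemma cReD z w : complex.Re (z + w) = complex.Re z + complex.Re w.
Proof. by case: z => a b; case: w => c d. Qed.

Lemma cImD z w : complex.Im (z + w) = complex.Im z + complex.Im w.
Proof. by case: z => a b; case: w => c d. Qed.

Lemma cReN z : complex.Re (- z) = - complex.Re z. Proof. by case: z. Qed.

Lemma cReMr c z : complex.Re (c%:C%C * z) = c * complex.Re z.
Proof. by rewrite cReM /= mul0r subr0. Qed.

Lemma cReV z : complex.Re z^-1 = complex.Re z / (complex.Re z ^+ 2 + complex.Im z ^+ 2).
Proof. by case: z. Qed.

Lemma cImV z : complex.Im z^-1 = - complex.Im z / (complex.Re z ^+ 2 + complex.Im z ^+ 2).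
Proof. by case: z => a b /=; rewrite mulNr. Qed.

Lemma Re2Im2_neq0 z : z != 0 -> complex.Re z ^+ 2 + complex.Im z ^+ 2 != 0.
Proof.
apply: contraNneq => /eqP; rewrite paddr_eq0 ?sqr_ge0 // !sqrf_eq0.
by rewrite eq_complex /=.
Qed.

Lemma normcX z n : normc (z ^+ n) = normc z ^+ n.
Proof. by elim: n => [|n IH]; rewrite ?expr0 ?normc1 // !exprS normcM IH. Qed.

Lemma normc_real c : normc c%:C%C = `|c|.
Proof. by rewrite /= expr0n addr0 sqrtr_sqr. Qed.

Lemma normRe_le z : `|complex.Re z| <= normc z.
Proof.
case: z => a b /=; rewrite -sqrtr_sqr ler_wsqrtr // lerDl.
exact: sqr_ge0.
Qed.

Lemma normIm_le z : `|complex.Im z| <= normc z.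
Proof.
case: z => a b /=; rewrite -sqrtr_sqr ler_wsqrtr // lerDr.
exact: sqr_ge0.
Qed.

Lemma normc_ge0 z : 0 <= normc z.
Proof. exact: le_trans (normr_ge0 _) (normRe_le z). Qed.

Lemma normc_expi t : normc (expi t) = 1.
Proof. by rewrite /expi /= cos2Dsin2 sqrtr1. Qed.

Lemma expi_neq0 t : expi t != 0.
Proof.
apply/eqP => e; have := normc_expi t; rewrite e normc0 => /eqP.
by rewrite eq_sym oner_eq0.
Qed.

Lemma expiD t s : expi (t + s) = expi t * expi s.
Proof. by rewrite /expi cosD sinD /=; apply/eqP; rewrite eq_complex /= eqxx addrC eqxx. Qed.

Lemma expiVN t : (expi t)^-1 = expi (- t).
Proof. by rewrite expiV /expi cosN sinN. Qed.

Lemma expiXz t (k : int) : expi t ^ k = expi (k%:~R * t).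
Proof.
have X n : expi t ^+ n = expi (n%:R * t).
  elim: n => [|n IH]; last by rewrite exprS IH -expiD -natr1 mulrDl mul1r addrC.
  by rewrite expr0 mul0r /expi cos0 sin0.
case: k => n; first exact: X.
by rewrite NegzE -exprnN X expiVN mulrNz mulNr.
Qed.

(** Continuity by components, since only real parts are integrated. *)
Definition ccont (G : R -> R[i]) :=
  continuous (fun t => complex.Re (G t)) /\ continuous (fun t => complex.Im (G t)).

Implicit Types (F G : R -> R[i]).

Lemma eq_ccont F G : F =1 G -> ccont F -> ccont G.
Proof. by move=> /funext ->. Qed.

Lemma ccont_cst z : ccont (fun=> z).
Proof. by split=> t; exact: cvg_cst. Qed.

Lemma ccontD F G : ccont F -> ccont G -> ccont (fun t => F t + G t).
Proof.
move=> [rF iF] [rG iG]; split=> t.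
  under eq_fun do rewrite cReD; exact: (cvgD (rF t) (rG t)).
under eq_fun do rewrite cImD; exact: (cvgD (iF t) (iG t)).
Qed.

Lemma ccontM F G : ccont F -> ccont G -> ccont (fun t => F t * G t).
Proof.
move=> [rF iF] [rG iG]; split=> t.
  under eq_fun do rewrite cReM.
  exact: (cvgB (cvgM (rF t) (rG t)) (cvgM (iF t) (iG t))).
under eq_fun do rewrite cImM.
exact: (cvgD (cvgM (rF t) (iG t)) (cvgM (iF t) (rG t))).
Qed.

Lemma ccontN F : ccont F -> ccont (fun t => - F t).
Proof.
move=> cF; apply: eq_ccont (ccontM (ccont_cst (-1)) cF) => t; exact: mulN1r.
Qed.

Lemma ccontV F : (forall t, F t != 0) -> ccont F -> ccont (fun t => (F t)^-1).
Proof.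
move=> F0 [rF iF].
have n2 t : complex.Re (F s) ^+ 2 + complex.Im (F s) ^+ 2 @[s --> t] -->
    complex.Re (F t) ^+ 2 + complex.Im (F t) ^+ 2.
  exact: (cvgD (cvgM (rF t) (rF t)) (cvgM (iF t) (iF t))).
have v t : (complex.Re (F s) ^+ 2 + complex.Im (F s) ^+ 2)^-1 @[s --> t] -->
    (complex.Re (F t) ^+ 2 + complex.Im (F t) ^+ 2)^-1.
  by apply: cvgV (n2 t); exact: Re2Im2_neq0.
split=> t.
  rewrite /continuous_at cReV; under eq_fun do rewrite cReV; exact: (cvgM (rF t) (v t)).
rewrite /continuous_at cImV; under eq_fun do rewrite cImV; exact: (cvgM (cvgN (iF t)) (v t)).
Qed.

Definition circ (r t : R) : R[i] := r%:C%C * expi t.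

Lemma circ_neq0 r t : r != 0 -> circ r t != 0.
Proof. by move=> r0; rewrite mulf_neq0 ?expi_neq0 // eq_complex /= negb_and r0. Qed.

Lemma normc_circ r t : 0 <= r -> normc (circ r t) = r.
Proof. by move=> r0; rewrite /circ normcM normc_expi mulr1 normc_real ger0_norm. Qed.

Lemma circXz r t (k : int) : circ r t ^ k = (r ^ k)%:C%C * expi (k%:~R * t).
Proof.
rewrite /circ expfzMl expiXz; congr (_ * _).
by case: k => n; rewrite ?rmorphXn //= NegzE -!exprnN fmorphV rmorphXn.
Qed.

Lemma ccont_circXz r (k : int) : ccont (fun t => circ r t ^ k).
Proof.
apply: eq_ccont (fun t => esym (circXz r t k)) _; apply: ccontM; first exact: ccont_cst.
split=> t /=; apply: continuous_comp; try exact: mulrl_continuous.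
  exact: continuous_cos.
exact: continuous_sin.
Qed.

End complex_facts.

(** * Means over the circles of radius 1 and q *)

Section primitives.
Variable R : realType.
Implicit Types (f F : R -> R).

Lemma is_derive_continuous F (t d : R) : is_derive t 1 F d -> {for t, continuous F}.
Proof. by move=> [dF _]; apply: differentiable_continuous; apply/derivable1_diffP. Qed.

Lemma is_derive_oo F f (a b : R) : (forall t : R, is_derive t 1 F (f t)) ->
  derivable_oo_LRcontinuous F a b.
Proof.
move=> dF; have cF t := is_derive_continuous (dF t).
split=> [t _||]; first by case: (dF t).
  by apply: cvg_at_right_filter; exact: cF.
by apply: cvg_at_left_filter; exact: cF.
Qed.

Lemma bint_primitive F f (a b : R) : a < b -> continuous f ->
  (forall t : R, is_derive t 1 F (f t)) -> bint a b f = F b - F a.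
Proof.
move=> ab cf dF; rewrite /bint /Rintegral.
rewrite (@continuous_FTC2 _ f F a b ab) //.
- exact: continuous_subspaceT.
- exact: is_derive_oo dF.
- by move=> t _; rewrite derive1E; exact: derive_val.
Qed.

Lemma sin_intr_pi (k : int) : sin (k%:~R * pi) = 0 :> R.
Proof.
have N n : sin (n%:R * pi) = 0 :> R.
  elim: n => [|n IH]; first by rewrite mul0r sin0.
  by rewrite -natr1 mulrDl mul1r sinDpi IH oppr0.
by case: k => n; [exact: N|rewrite NegzE mulrNz mulNr sinN N oppr0].
Qed.

Lemma bint_cosk (k : int) : bint 0 pi (fun t : R => cos (k%:~R * t)) = (k == 0)%:R * pi.
Proof.
have [->|k0] := eqVneq k 0.
  under [bint _ _ _]eq_bint do rewrite mul0r cos0.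
  have c1 : continuous (fun _ : R => 1 : R) by move=> t; exact: cvg_cst.
  by rewrite mul1r (bint_primitive (pi_gt0 R) c1 (fun t => is_derive_id t 1)) subr0.
have k0' : k%:~R != 0 :> R by rewrite intr_eq0.
pose F t : R := (k%:~R)^-1 * sin (k%:~R * t).
have cf : continuous (fun t : R => cos (k%:~R * t)).
  move=> t; apply: continuous_comp; first exact: mulrl_continuous.
  exact: continuous_cos.
have dF (t : R) : is_derive t 1 F (cos (k%:~R * t)).
  have := @is_derive1_comp R (fun x => (k%:~R)^-1 * sin x) (fun x => k%:~R * x) t
    ((k%:~R)^-1 * cos (k%:~R * t)) k%:~R.
  rewrite mulrAC mulVf // mul1r; apply.
  by rewrite -[X in is_derive _ _ _ X]mulr1; exact: (is_deriveZ k%:~R (is_derive_id t 1)).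
rewrite mul0r (bint_primitive (pi_gt0 R) cf dF) /F.
by rewrite sin_intr_pi !mulr0 sin0 mulr0 subrr.
Qed.

End primitives.

Section shift_invariance.
Variables (R : realType) (q : R).
Hypothesis hq : 0 < q < 1.
Implicit Types (F G : R[i] -> R[i]) (c : R).

Definition radius r := (r == 1) || (r == q).

Lemma radius1 : radius 1. Proof. by rewrite /radius eqxx. Qed.
Lemma radiusq : radius q. Proof. by rewrite /radius eqxx orbT. Qed.

Lemma radius_gt0 r : radius r -> 0 < r.
Proof. by case/orP => /eqP -> //; case/andP: hq. Qed.

Lemma radius_neq0 r : radius r -> r != 0.
Proof. by move/radius_gt0/lt0r_neq0. Qed.

(** For [F] with real Laurent coefficients this is half of the integral of [F]
    over the whole circle, as the real part is even in [t]. *)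
Definition circ_mean r F : R := bint 0 pi (fun t => complex.Re (F (circ r t))).

Definition circ_cont F := forall r, radius r -> ccont (fun t => F (circ r t)).

(** What Cauchy's theorem says about [F] holomorphic near the annulus
    [q <= |z| <= 1] with real Laurent coefficients. Asking it for every [z^k * F]
    makes the class stable under multiplication by Laurent polynomials. *)
Definition shift_inv F := circ_cont F /\ forall k : int,
  circ_mean 1 (fun z => z ^ k * F z) = circ_mean q (fun z => z ^ k * F z).

Lemma circ_contM F G : circ_cont F -> circ_cont G -> circ_cont (fun z => F z * G z).
Proof. by move=> cF cG r hr; apply: ccontM; [exact: cF|exact: cG]. Qed.

Lemma circ_contXz (k : int) : circ_cont (fun z => z ^ k).
Proof. by move=> r hr; exact: ccont_circXz. Qed.

Lemma circ_cont_lin c (k : int) : circ_cont (fun z => 1 - c%:C%C * z ^ k).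
Proof.
move=> r hr; apply: ccontD; first exact: ccont_cst.
by apply: ccontN; apply: ccontM; [exact: ccont_cst|exact: ccont_circXz].
Qed.

Lemma bmeas_Re r F : circ_cont F -> radius r ->
  bmeas 0 pi (fun t => complex.Re (F (circ r t))).
Proof. by move=> cF hr; apply: bmeas_continuous; case: (cF r hr). Qed.

Lemma eq_circ_mean r F G : (forall t, F (circ r t) = G (circ r t)) ->
  circ_mean r F = circ_mean r G.
Proof. by move=> FG; apply: eq_bint => t _; rewrite FG. Qed.

Lemma circ_meanB r c F G : radius r -> circ_cont F -> circ_cont G ->
  circ_mean r (fun z => F z - c%:C%C * G z) = circ_mean r F - c * circ_mean r G.
Proof.
move=> hr cF cG; have bF := bmeas_Re cF hr; have bG := bmeas_Re cG hr.
rewrite /circ_mean -mulNr -(bintZ _ bG) -bintD //; last exact: bmeasM (bmeas_cst _ _ _) bG.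
by apply: eq_bint => t _; rewrite cReD cReN; rewrite cReMr mulNr.
Qed.

Lemma shift_inv1 : shift_inv (fun=> 1).
Proof.
split=> [r hr|k]; first exact: ccont_cst.
have E r : radius r -> circ_mean r (fun z => z ^ k * 1) = r ^ k * ((k == 0)%:R * pi).
  move=> hr; rewrite -bint_cosk -bintZ; last first.
    apply: bmeas_continuous => t; apply: continuous_comp; first exact: mulrl_continuous.
    exact: continuous_cos.
  by apply: eq_bint => t _; rewrite mulr1 circXz cReMr.
rewrite !E ?radius1 ?radiusq //.
by have [->|_] := eqVneq k 0; rewrite ?expr0z // mul0r !mulr0.
Qed.

Lemma shift_invXz F (m : int) : shift_inv F -> shift_inv (fun z => z ^ m * F z).
Proof.
move=> [cF iF]; split=> [|k]; first by apply: circ_contM => //; exact: circ_contXz.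
have E r : radius r -> circ_mean r (fun z => z ^ k * (z ^ m * F z)) =
    circ_mean r (fun z => z ^ (k + m) * F z).
  by move=> hr; apply: eq_circ_mean => t; rewrite expfzDr ?circ_neq0 ?radius_neq0 // mulrA.
by rewrite !E ?radius1 ?radiusq.
Qed.

Lemma shift_inv_lin F c (m : int) : shift_inv F ->
  shift_inv (fun z => F z * (1 - c%:C%C * z ^ m)).
Proof.
move=> hF; have [cF iF] := hF; have [cG iG] := shift_invXz m hF.
split=> [|k]; first by apply: circ_contM => //; exact: circ_cont_lin.
have E r : radius r -> circ_mean r (fun z => z ^ k * (F z * (1 - c%:C%C * z ^ m))) =
    circ_mean r (fun z => z ^ k * F z) - c * circ_mean r (fun z => z ^ k * (z ^ m * F z)).
  move=> hr; rewrite -circ_meanB //; try by apply: circ_contM => //; exact: circ_contXz.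
  by apply: eq_circ_mean => t; ring.
by rewrite !E ?radius1 ?radiusq // iF iG.
Qed.

(** Let [G] be the quotient and [D k] the difference of the means of [z^k * G] over
    the two circles. As [F = G - c z^s G] is in the class, [D k = c * D (k + s)];
    after [J] steps the integrand carries [(c z^s)^J], of modulus at most [e^J] on
    both circles, so [D k = 0]. *)
Lemma shift_inv_div F c (s : int) (e : R) : 0 <= e < 1 ->
  (forall r t, radius r -> normc (c%:C%C * circ r t ^ s) <= e) ->
  shift_inv F -> shift_inv (fun z => F z / (1 - c%:C%C * z ^ s)).
Proof.
move=> /andP[e0 e1] small [cF iF].
have nz r t : radius r -> 1 - c%:C%C * circ r t ^ s != 0.
  move=> hr; apply/eqP => /eqP; rewrite subr_eq0 eq_sym => /eqP h.
  by have := small r t hr; rewrite h normc1 leNgt e1.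
pose G z := F z / (1 - c%:C%C * z ^ s).
have cG : circ_cont G.
  apply: circ_contM => // r hr; apply: ccontV; first by move=> t; exact: nz.
  exact: circ_cont_lin.
split=> [|k0]; first exact: cG.
have cGk k : circ_cont (fun z => z ^ k * G z).
  by apply: circ_contM => //; exact: circ_contXz.
pose D k := circ_mean 1 (fun z => z ^ k * G z) - circ_mean q (fun z => z ^ k * G z).
have rec r k : radius r -> circ_mean r (fun z => z ^ k * F z) =
    circ_mean r (fun z => z ^ k * G z) - c * circ_mean r (fun z => z ^ (k + s) * G z).
  move=> hr; rewrite -circ_meanB //; apply: eq_circ_mean => t.
  rewrite expfzDr ?circ_neq0 ?radius_neq0 // -[F _](@divfK _ (1 - c%:C%C * circ r t ^ s)) ?nz //.
  by rewrite -/(G _); ring.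
have Dstep k : D k = c * D (k + s).
  have := iF k; rewrite (rec 1 k radius1) (rec q k radiusq) /D.
  move: (circ_mean _ _) (circ_mean _ _) (circ_mean _ _) (circ_mean _ _) => x y z w.
  by move=> h; rewrite mulrBr -[w](subrK (c * z)) h; ring.
have DJ J : D k0 = c ^+ J * D (k0 + s * J%:Z).
  elim: J => [|J IH]; first by rewrite mulr0 addr0 mul1r.
  by rewrite IH Dstep exprSr mulrA intS (mulrDr s) mulr1 -addrA [s * _ + s]addrC.
have bound r : radius r -> exists B, forall J,
    `|c ^+ J * circ_mean r (fun z => z ^ (k0 + s * J%:Z) * G z)| <= e ^+ J * B.
  move=> hr; have [cr ci] := cGk k0 r hr.
  pose f t := complex.Re (circ r t ^ k0 * G (circ r t)).
  pose g t := complex.Im (circ r t ^ k0 * G (circ r t)).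
  have [_ [B1 hB1]] := @bmeas_continuous R 0 pi f cr.
  have [_ [B2 hB2]] := @bmeas_continuous R 0 pi g ci.
  exists ((B1 + B2) * pi) => J.
  pose u t := (c%:C%C * circ r t ^ s) ^+ J.
  have Eu t : (c ^+ J)%:C%C * (circ r t ^ (k0 + s * J%:Z) * G (circ r t)) =
      u t * (circ r t ^ k0 * G (circ r t)).
    have Es : circ r t ^ (s * J%:Z) = (circ r t ^ s) ^+ J by rewrite -exprz_exp.
    rewrite /u exprMn rmorphXn /= expfzDr ?circ_neq0 ?radius_neq0 // Es; ring.
  have bm := bmeas_Re (cGk (k0 + s * J%:Z)) hr.
  have bm' : bmeas 0 pi (fun t => c ^+ J * complex.Re (circ r t ^ (k0 + s * J%:Z) * G (circ r t))).
    by apply: bmeasM => //; exact: bmeas_cst.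
  rewrite /circ_mean -(bintZ _ bm) mulrA.
  have := @bint_norm_le R 0 pi _ (e ^+ J * (B1 + B2)) (pi_ge0 R) bm'; rewrite subr0; apply => t It.
  rewrite -cReMr Eu cReM (le_trans (ler_normB _ _)) // mulrDr.
  have ule : normc (u t) <= e ^+ J by rewrite /u normcX lerXn2r ?nnegrE ?normc_ge0 ?small.
  by rewrite !normrM lerD // ler_pM // ?hB1 ?hB2 // (le_trans _ ule) ?normRe_le ?normIm_le.
have [B1 hB1] := bound 1 radius1; have [B2 hB2] := bound q radiusq.
have lim0 : e ^+ J * (B1 + B2) @[J --> \oo] --> (0 : R).
  rewrite -[X in _ --> X](mul0r (B1 + B2)); apply: cvgMr_tmp.
  by apply: cvg_expr; rewrite ger0_norm.
suff : D k0 = 0 by move/eqP; rewrite subr_eq0 => /eqP.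
apply/normr0_eq0; apply/eqP; rewrite eq_le normr_ge0 andbT.
rewrite -(cvg_lim (@Rhausdorff R) lim0); apply: limr_ge; first by apply/cvg_ex; exists 0.
apply: nearW => J; rewrite (DJ J) /D mulrBr mulrDr.
apply: le_trans (ler_normB _ _) _; apply: lerD; [exact: hB1|exact: hB2].
Qed.

End shift_invariance.

(** * The Askey-Wilson kernel *)

Lemma rmorph_qpoch (F F' : fieldType) (f : {rmorphism F -> F'}) (q a : F) n :
  f (qpoch q a n) = qpoch (f q) (f a) n.
Proof.
by rewrite /qpoch rmorph_prod; apply: eq_bigr => k _; rewrite rmorphB rmorphM rmorphXn rmorph1.
Qed.

Section aw_kernel.
Variables (F : fieldType) (q : F).
Hypothesis q0 : q != 0.

Definition aw_ratio (e z : F) N : F :=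
  (qpoch q (e * z) N * qpoch q (e * q * z^-1) N)^-1.

(** A truncation of
    [z (z^2, q z^-2; q)_oo / prod_e (e z, e q / z; q)_oo]. The numerator is
    separated into even and odd powers of [q], with one factor less in the third
    product, so that [aw_kernel_shift] holds exactly for every [N]. *)
Definition aw_kernel (a b c d : F) N (z : F) : F :=
  z * (qpoch (q ^+ 2) (z ^+ 2) N.+1 * qpoch (q ^+ 2) (q ^+ 2 * z ^- 2) N.+1 *
       qpoch (q ^+ 2) (q * z ^+ 2) N * qpoch (q ^+ 2) (q * z ^- 2) N.+1) *
  (aw_ratio a z N * aw_ratio b z N * aw_ratio c z N * aw_ratio d z N).

Lemma aw_ratio_shift e z N : z != 0 -> aw_ratio e (q * z) N = aw_ratio e z^-1 N.
Proof.
move=> z0; rewrite /aw_ratio invrK [RHS]invfM mulrC -invfM; congr (_ * _)^-1.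
  by congr (qpoch q _ N); field; rewrite q0 z0.
by congr (qpoch q _ N); ring.
Qed.

(** The values at [q z] and at [1 / z] have the same factors: the first two
    products are exchanged, and so are the two parts of each [aw_ratio]. Only
    [1 - q^-1 z^-2] and [1 - q z^2] differ; their quotient is [- 1 / (q z^2)], and
    the prefactor contributes [q z^2]. *)
Lemma aw_kernel_shift a b c d N z : z != 0 ->
  aw_kernel a b c d N (q * z) = - aw_kernel a b c d N z^-1.
Proof.
move=> z0; rewrite /aw_kernel !aw_ratio_shift // -[RHS]mulNr; congr (_ * _).
have -> : q ^+ 2 * z^-1 ^- 2 = (q * z) ^+ 2 by (field; rewrite ?q0 ?z0 ?oner_eq0).
have -> : q ^+ 2 * (q * z) ^- 2 = z^-1 ^+ 2 by (field; rewrite ?q0 ?z0 ?oner_eq0).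
rewrite [qpoch _ (q * (q * z) ^- 2) _]qpochSl [qpoch _ (q * z^-1 ^- 2) _]qpochSl.
have -> : q * z^-1 ^- 2 * q ^+ 2 = q * (q * z) ^+ 2 by (field; rewrite ?q0 ?z0 ?oner_eq0).
have -> : q * (q * z) ^- 2 * q ^+ 2 = q * z^-1 ^+ 2 by (field; rewrite ?q0 ?z0 ?oner_eq0).
by (field; rewrite ?q0 ?z0 ?oner_eq0).
Qed.

Lemma qpoch_sqr y N : qpoch (q ^+ 2) (y ^+ 2) N = qpoch q y N * qpoch q (- y) N.
Proof.
rewrite /qpoch -big_split /=; apply: eq_bigr => k _.
by rewrite -!exprM mulnC exprM; ring.
Qed.

(** For [|z| = 1] the product [P e] is the truncation of [h q x e] at [x = Re z], so
    that the kernel is a truncation of the weight times a Laurent polynomial,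
    times a last factor that tends to 1 with [N]. The parameters [q, - q, s, - s]
    of the numerator come from [(y^2; q^2)_N = (y; q)_N (- y; q)_N]. *)
Lemma aw_kernelE a b c d s N z : z != 0 -> s ^+ 2 = q ->
  (forall e, e \in [:: a; b; c; d] -> [/\ qpoch q (e * z) N != 0,
     qpoch q (e * z^-1) N != 0, 1 - e * z^-1 != 0 & 1 - e * q ^+ N * z^-1 != 0]) ->
  let P e := qpoch q (e * z) N * qpoch q (e * z^-1) N in
  aw_kernel a b c d N z =
  P q * P (- q) * P s * P (- s) / (P a * P b * P c * P d) *
  (z * (1 - z ^+ 2) *
   ((1 - a * z^-1) * (1 - b * z^-1) * (1 - c * z^-1) * (1 - d * z^-1)) *
   ((1 - q ^+ N ^+ 2 * q ^+ 2 * z ^- 2) * (1 - q ^+ N ^+ 2 * q * z ^- 2) /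
    ((1 - a * q ^+ N * z^-1) * (1 - b * q ^+ N * z^-1) *
     (1 - c * q ^+ N * z^-1) * (1 - d * q ^+ N * z^-1)))).
Proof.
move=> z0 sq H P.
have R e : e \in [:: a; b; c; d] ->
    aw_ratio e z N = (P e)^-1 * ((1 - e * z^-1) / (1 - e * q ^+ N * z^-1)).
  case/H => e1 e2 e3 e4; rewrite /aw_ratio /P.
  have <- : qpoch q (e * z^-1) N * (1 - e * q ^+ N * z^-1) / (1 - e * z^-1) =
            qpoch q (e * q * z^-1) N.
    rewrite [e * q ^+ N * _]mulrAC -qpochSr qpochSl [e * z^-1 * q]mulrAC.
    by rewrite [X in X / _]mulrC mulfK.
  move: (1 - e * z^-1) (1 - e * q ^+ N * z^-1) e3 e4 => X Y e3 e4.
  by field; rewrite e1 e2 e3 e4.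
rewrite /aw_kernel !R ?inE ?eqxx ?orbT // -!/(P _).
have -> : q ^+ 2 * z ^- 2 = (q * z^-1) ^+ 2 by rewrite exprMn exprVn.
have -> : q * z ^+ 2 = (s * z) ^+ 2 by rewrite exprMn sq.
have -> : q * z ^- 2 = (s * z^-1) ^+ 2 by rewrite exprMn exprVn sq.
rewrite [qpoch _ (z ^+ 2) _]qpochSl [qpoch _ ((q * z^-1) ^+ 2) _]qpochSr.
rewrite [qpoch _ ((s * z^-1) ^+ 2) _]qpochSr.
have -> : z ^+ 2 * q ^+ 2 = (q * z) ^+ 2 by rewrite exprMn mulrC.
have -> : q ^+ 2 ^+ N = q ^+ N ^+ 2 by rewrite -!exprM mulnC.
rewrite !qpoch_sqr.
have -> : (q * z^-1) ^+ 2 * q ^+ N ^+ 2 = q ^+ N ^+ 2 * q ^+ 2 * z ^- 2.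
  by rewrite exprMn exprVn; ring.
have -> : (s * z^-1) ^+ 2 * q ^+ N ^+ 2 = q ^+ N ^+ 2 * q * z ^- 2.
  by rewrite exprMn exprVn sq; ring.
rewrite /P.
have [a1 a2 a3 a4] := H a (mem_head _ _).
have [|b1 b2 b3 b4] := H b; first by rewrite !inE eqxx ?orbT.
have [|c1 c2 c3 c4] := H c; first by rewrite !inE eqxx ?orbT.
have [|d1 d2 d3 d4] := H d; first by rewrite !inE eqxx ?orbT.
move: (1 - _ * q ^+ 2 * z ^- 2) (1 - _ * q * z ^- 2) => X1 X2.
move: (1 - a * z^-1) (1 - b * z^-1) (1 - c * z^-1) (1 - d * z^-1) a3 b3 c3 d3.
move: (1 - a * q ^+ N * z^-1) (1 - b * q ^+ N * z^-1) (1 - c * q ^+ N * z^-1) a4 b4 c4.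
move: (1 - d * q ^+ N * z^-1) d4 => Y1 d4 Y2 Y3 Y4 a4 b4 c4 Y5 Y6 Y7 Y8 a3 b3 c3 d3.
rewrite !mulNr; field.
by rewrite ?z0 ?a1 ?a2 ?a3 ?a4 ?b1 ?b2 ?b3 ?b4 ?c1 ?c2 ?c3 ?c4 ?d1 ?d2 ?d3 ?d4.
Qed.

End aw_kernel.

Lemma rmorph_aw_kernel (F F' : fieldType) (f : {rmorphism F -> F'}) (q a b c d z : F) N :
  f (aw_kernel q a b c d N z) = aw_kernel (f q) (f a) (f b) (f c) (f d) N (f z).
Proof.
rewrite /aw_kernel /aw_ratio.
by rewrite !(rmorphM, fmorphV, rmorph_qpoch, rmorphXn).
Qed.

(** * Vanishing of the mean of the kernel *)

Section kernel_mean.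
Variables (R : realType) (q : R).
Hypothesis hq : 0 < q < 1.
Implicit Types (F G : R[i] -> R[i]) (a b c d e p : R).

Let q_gt0 : 0 < q. Proof. by case/andP: hq. Qed.
Let q_lt1 : q < 1. Proof. by case/andP: hq. Qed.
Let Q : R[i] := q%:C%C.
Let Q0 : Q != 0. Proof. by rewrite /Q eq_complex /= negb_and gt_eqF. Qed.

Lemma shift_inv_qpoch F c p (m : int) n : shift_inv q F ->
  shift_inv q (fun z => F z * qpoch p%:C%C (c%:C%C * z ^ m) n).
Proof.
move=> hF; elim: n => [|n IH].
  by rewrite (_ : (fun z => _) = F) //; apply/funext => z; rewrite qpoch0 mulr1.
have := shift_inv_lin hq (c * p ^+ n) m IH; congr shift_inv; apply/funext => z.
by rewrite qpochSr rmorphM rmorphXn /= mulrA [c%:C%C * _ * _]mulrAC.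
Qed.

Lemma shift_inv_qpochV F c (s : int) n e : 0 <= e < 1 ->
  (forall r t, radius q r -> normc (c%:C%C * circ r t ^ s) <= e) ->
  shift_inv q F -> shift_inv q (fun z => F z / qpoch Q (c%:C%C * z ^ s) n).
Proof.
move=> he small hF; elim: n => [|n IH].
  by rewrite (_ : (fun z => _) = F) //; apply/funext => z; rewrite qpoch0 divr1.
have small' r t : radius q r -> normc ((c * q ^+ n)%:C%C * circ r t ^ s) <= e.
  move=> hr; have /andP[e0 _] := he.
  rewrite rmorphM /= mulrAC normcM normc_real ger0_norm ?qX_ge0 //.
  by rewrite -[leRHS]mulr1 ler_pM ?normc_ge0 ?qX_ge0 ?qX_le1 ?small.
have := shift_inv_div hq he small' IH; congr shift_inv; apply/funext => z.
by rewrite qpochSr invfM mulrA rmorphM rmorphXn /= [c%:C%C * _ * _]mulrAC.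
Qed.

(** The poles [1 / (e q^k)] have modulus greater than 1 and the poles
    [e q^(k + 1)] modulus less than [q], so [shift_inv_div] applies to each. *)
Lemma shift_inv_ratio F e N : `|e| < 1 -> shift_inv q F ->
  shift_inv q (fun z => F z * aw_ratio Q e%:C%C z N).
Proof.
move=> e1 hF; have he : 0 <= `|e| < 1 by rewrite normr_ge0.
have H : shift_inv q (fun z => F z / qpoch Q (e%:C%C * z ^ 1) N
                                 / qpoch Q ((e * q)%:C%C * z ^ (-1)) N).
  apply: (shift_inv_qpochV _ he) => [r t hr|].
    have r0 := radius_gt0 hq hr.
    rewrite normcM normc_real normcV normc_circ ?(ltW r0) // normrM (gtr0_norm q_gt0) -mulrA.
    by rewrite ler_piMr // ler_pdivrMr // mul1r; case/orP: hr => /eqP -> //; exact: ltW.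
  apply: (shift_inv_qpochV _ he) => // r t hr.
  have r0 := radius_gt0 hq hr; rewrite normcM normc_real expr1z normc_circ ?(ltW r0) //.
  by rewrite ler_piMr //; case/orP: hr => /eqP -> //; exact: ltW.
move: H; congr shift_inv; apply/funext => z.
by rewrite /aw_ratio invfM expr1z exprN1 rmorphM mulrA.
Qed.

Lemma shift_inv_kernel a b c d N : `|a| < 1 -> `|b| < 1 -> `|c| < 1 -> `|d| < 1 ->
  shift_inv q (aw_kernel Q a%:C%C b%:C%C c%:C%C d%:C%C N).
Proof.
move=> ha hb hc hd.
have H := shift_inv_ratio N hd (shift_inv_ratio N hc (shift_inv_ratio N hb
  (shift_inv_ratio N ha (shift_inv_qpoch q (q ^+ 2) (-2) N.+1 (shift_inv_qpoch q (q ^+ 2) 2 N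
  (shift_inv_qpoch (q ^+ 2) (q ^+ 2) (-2) N.+1 (shift_inv_qpoch 1 (q ^+ 2) 2 N.+1
  (shift_invXz hq 1 (shift_inv1 q))))))))).
move: H; congr shift_inv; apply/funext => z.
rewrite /aw_kernel /= expr1z mulr1 rmorph1 mul1r rmorphXn /= -/Q.
have -> : z ^ (-2) = z ^- 2 by [].
have -> : z ^ 2 = z ^+ 2 by [].
by rewrite !mulrA.
Qed.

Let conjc_realE p : (@conjc R : {rmorphism R[i] -> R[i]}) p%:C%C = p%:C%C.
Proof. exact: conjc_real. Qed.

Lemma conjc_kernel a b c d N z :
  conjc (aw_kernel Q a%:C%C b%:C%C c%:C%C d%:C%C N z) =
  aw_kernel Q a%:C%C b%:C%C c%:C%C d%:C%C N (conjc z).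
Proof.
have := rmorph_aw_kernel (@conjc R : {rmorphism R[i] -> R[i]}) Q a%:C%C b%:C%C c%:C%C d%:C%C z N.
by rewrite !conjc_realE.
Qed.

Let eq_opp0 (x y : R) : x = y -> y = - x -> x = 0.
Proof. by move=> -> h; lra. Qed.

(** At [z] on the unit circle [1 / z] is the conjugate of [z], so the functional
    equation reads [F(q z) = - conj (F z)]: the means over the two circles are
    opposite, and they are equal by shift invariance. *)
Lemma kernel_mean0 a b c d N : `|a| < 1 -> `|b| < 1 -> `|c| < 1 -> `|d| < 1 ->
  circ_mean 1 (aw_kernel Q a%:C%C b%:C%C c%:C%C d%:C%C N) = 0.
Proof.
move=> ha hb hc hd; set K := aw_kernel _ _ _ _ _ _.
have sK : shift_inv q K by exact: shift_inv_kernel.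
have [cK /(_ 0)] := sK.
have E r : circ_mean r (fun z => z ^ 0 * K z) = circ_mean r K.
  by apply: eq_circ_mean => t; rewrite expr0z mul1r.
rewrite !E => M; suff : circ_mean q K = - circ_mean 1 K.
  exact: eq_opp0 M.
have b1 := bmeas_Re cK (radius1 q).
rewrite /circ_mean -mulN1r -(bintZ _ b1); apply: eq_bint => t _.
have -> : circ q t = Q * circ 1 t by rewrite /circ mul1r.
have c0 : circ 1 t != 0 by rewrite circ_neq0 ?oner_eq0.
have S : K (Q * circ 1 t) = - conjc (K (circ 1 t)).
  rewrite /K (aw_kernel_shift Q0 _ _ _ _ _ c0) conjc_kernel; congr (- aw_kernel _ _ _ _ _ _ _).
  by rewrite /circ mul1r expiV.
by rewrite S cReN mulN1r; case: (K _).
Qed.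

End kernel_mean.

(** * The relation between mass and first moment *)

Section complex_sequences.
Variable R : realType.
Implicit Types (f g : nat -> R[i]) (z w l m : R[i]).

Definition ccvg f l :=
  (complex.Re (f n) @[n --> \oo] --> complex.Re l) /\
  (complex.Im (f n) @[n --> \oo] --> complex.Im l).

Lemma ccvg_cst z : ccvg (fun=> z) z.
Proof. by split; exact: cvg_cst. Qed.

Lemma ccvgD f g l m : ccvg f l -> ccvg g m -> ccvg (fun n => f n + g n) (l + m).
Proof.
move=> [rf jf] [rg jg]; split.
  by rewrite cReD; under eq_fun do rewrite cReD; exact: (cvgD rf rg).
by rewrite cImD; under eq_fun do rewrite cImD; exact: (cvgD jf jg).
Qed.

Lemma ccvgM f g l m : ccvg f l -> ccvg g m -> ccvg (fun n => f n * g n) (l * m).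
Proof.
move=> [rf jf] [rg jg]; split.
  rewrite cReM; under eq_fun do rewrite cReM.
  exact: (cvgB (cvgM rf rg) (cvgM jf jg)).
rewrite cImM; under eq_fun do rewrite cImM.
exact: (cvgD (cvgM rf jg) (cvgM jf rg)).
Qed.

Lemma ccvgV f l : l != 0 -> ccvg f l -> ccvg (fun n => (f n)^-1) l^-1.
Proof.
move=> l0 [rf jf].
have v : (complex.Re (f n) ^+ 2 + complex.Im (f n) ^+ 2)^-1 @[n --> \oo] -->
    (complex.Re l ^+ 2 + complex.Im l ^+ 2)^-1.
  apply: cvgV; first exact: Re2Im2_neq0.
  exact: (cvgD (cvgM rf rf) (cvgM jf jf)).
split.
  by rewrite cReV; under eq_fun do rewrite cReV; exact: (cvgM rf v).
by rewrite cImV; under eq_fun do rewrite cImV; exact: (cvgM (cvgN jf) v).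
Qed.

Lemma normc_one_sub_le w : normc w <= 1 -> normc (1 - w) <= 2.
Proof.
move=> w1; apply: le_trans (le_normcD 1 (- w)) _; rewrite normcN normc1.
by rewrite -[2]/(1 + 1) lerD2l.
Qed.

Lemma normc_one_sub_ge w : 1 - normc w <= normc (1 - w).
Proof.
have := le_normcD (1 - w) w; rewrite subrK normc1 => h.
by rewrite lerBlDr.
Qed.

End complex_sequences.

Section weight.
Variables (R : realType) (q : R).
Hypothesis hq : 0 < q < 1.
Implicit Types (a b c d x t : R).

Let q_gt0 : 0 < q. Proof. by case/andP: hq. Qed.
Let q_lt1 : q < 1. Proof. by case/andP: hq. Qed.
Let s := Num.sqrt q.
Let s2 : s ^+ 2 = q. Proof. by rewrite sqr_sqrtr // ltW. Qed.
Let nq : `|q| <= 1. Proof. by rewrite gtr0_norm // ltW. Qed.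
Let ns : `|s| <= 1.
Proof. by rewrite ger0_norm ?sqrtr_ge0 // -sqrtr1 ler_wsqrtr // ltW. Qed.

Definition gfin a b c d x N : R :=
  hfin q x q N * hfin q x (- q) N * hfin q x s N * hfin q x (- s) N /
  (hfin q x a N * hfin q x b N * hfin q x c N * hfin q x d N).

(** The density of the weight with respect to [4 sin^2 t dt]. The parameters
    [q, - q] stand where the weight has [1, -1]: the first factors of [h q x 1] and
    [h q x (-1)] have product [4 sin^2 t]. *)
Definition gker a b c d x : R :=
  h q x q * h q x (- q) * h q x s * h q x (- s) /
  (h q x a * h q x b * h q x c * h q x d).

Lemma hfin_gt0 x a N : `|x| <= 1 -> `|a| < 1 -> 0 < hfin q x a N.
Proof. by move=> x1 a1; apply: lt_le_trans (hlow_gt0 _ _) (hfin_lb hq N x1 (lexx _) a1). Qed.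

Lemma gfin_cvg a b c d x : `|x| <= 1 ->
  `|a| < 1 -> `|b| < 1 -> `|c| < 1 -> `|d| < 1 ->
  gfin a b c d x N @[N --> \oo] --> gker a b c d x.
Proof.
move=> x1 a1 b1 c1 d1; apply: cvgM.
  by apply: cvgM; [apply: cvgM; [apply: cvgM|]|]; apply: hfin_cvg; rewrite ?normrN.
apply: cvgV; first by rewrite !mulf_neq0 // gt_eqF // h_gt0.
by apply: cvgM; [apply: cvgM; [apply: cvgM|]|]; apply: hfin_cvg => //; exact: ltW.
Qed.

Lemma gfin_bounded (r : R) : r < 1 -> exists C, forall a b c d x N, `|x| <= 1 ->
  `|a| <= r -> `|b| <= r -> `|c| <= r -> `|d| <= r -> `|gfin a b c d x N| <= C.
Proof.
move=> r1; pose B := expR (3 / (1 - q)).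
exists (B * B * B * B / (hlow q r * hlow q r * hlow q r * hlow q r)) => a b c d x N x1 a1 b1 c1 d1.
have L e : `|e| <= r -> hlow q r <= `|hfin q x e N|.
  by move=> er; rewrite (le_trans _ (ler_norm _)) // hfin_lb.
have l0 := hlow_gt0 q r.
have lp := ltW l0.
rewrite /gfin normrM normfV !normrM ler_pM ?invr_ge0 ?mulr_ge0 //.
  by rewrite !ler_pM ?mulr_ge0 // hfin_ub // normrN.
rewrite lef_pV2 ?posrE ?mulr_gt0 ?(lt_le_trans l0) ?L //.
by rewrite !ler_pM ?mulr_ge0 ?L.
Qed.

Lemma continuous_hfin a N : continuous (fun x => hfin q x a N).
Proof.
elim: N => [|N IH].
  by rewrite (_ : (fun x => _) = fun=> 1) => [x|]; [exact: cvg_cst|apply/funext => x; rewrite /hfin big_ord0].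
under eq_fun do rewrite hfinSr.
move=> x; apply: cvgM; first exact: IH.
apply: cvgD; last exact: cvg_cst.
apply: cvgB; first exact: cvg_cst.
by apply: cvgMr_tmp; apply: cvgMl_tmp; exact: cvg_id.
Qed.

Lemma continuous_gfin a b c d N x : `|x| <= 1 ->
  `|a| < 1 -> `|b| < 1 -> `|c| < 1 -> `|d| < 1 ->
  {for x, continuous (fun x => gfin a b c d x N)}.
Proof.
move=> x1 a1 b1 c1 d1; apply: cvgM.
  by apply: cvgM; [apply: cvgM; [apply: cvgM|]|]; exact: continuous_hfin.
apply: cvgV; first by rewrite !mulf_neq0 // gt_eqF // hfin_gt0.
by apply: cvgM; [apply: cvgM; [apply: cvgM|]|]; exact: continuous_hfin.
Qed.

Lemma norm_cos_le1 t : `|cos t| <= 1. Proof. exact: cos_max. Qed.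

Lemma continuous_gfin_cos a b c d N : `|a| < 1 -> `|b| < 1 -> `|c| < 1 -> `|d| < 1 ->
  continuous (fun t => gfin a b c d (cos t) N).
Proof.
move=> a1 b1 c1 d1 t; apply: (@continuous_comp _ _ _ (@cos R) (fun x => gfin a b c d x N)).
  exact: continuous_cos.
by apply: continuous_gfin; rewrite ?norm_cos_le1.
Qed.

Lemma bmeas_gker a b c d : `|a| < 1 -> `|b| < 1 -> `|c| < 1 -> `|d| < 1 ->
  bmeas 0 pi (fun t => gker a b c d (cos t)).
Proof.
move=> a1 b1 c1 d1; pose r := Num.max (Num.max `|a| `|b|) (Num.max `|c| `|d|).
have r1 : r < 1 by rewrite !gt_max a1 b1 c1 d1.
have [C hC] := gfin_bounded r1.
have [] := @bint_cvg R 0 pi (fun N t => gfin a b c d (cos t) N) (fun t => gker a b c d (cos t)) C.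
- move=> N; apply: measurable_funTS; apply: continuous_measurable_fun.
  exact: continuous_gfin_cos.
- move=> N t _; apply: hC; rewrite ?norm_cos_le1 //;
    by rewrite /r !le_max lexx ?orbT.
- by move=> t _; apply: gfin_cvg; rewrite ?norm_cos_le1.
by [].
Qed.

Let Q : R[i] := q%:C%C.
Let Q0 : Q != 0. Proof. by rewrite /Q eq_complex /= negb_and gt_eqF. Qed.

Lemma normc_small_neq0 (w : R[i]) : normc w < 1 -> 1 - w != 0.
Proof.
move=> w1; apply/eqP => e; have := normc_one_sub_ge w; rewrite e normc0.
by rewrite leNgt subr_gt0 w1.
Qed.

Lemma kernel_circle a b c d N t : `|a| < 1 -> `|b| < 1 -> `|c| < 1 -> `|d| < 1 ->
  let z := expi t in let u := z^-1 in let y := (q ^+ N)%:C%C in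
  aw_kernel Q a%:C%C b%:C%C c%:C%C d%:C%C N z =
  (gfin a b c d (cos t) N)%:C%C *
  (z * (1 - z ^+ 2) *
   ((1 - a%:C%C * u) * (1 - b%:C%C * u) * (1 - c%:C%C * u) * (1 - d%:C%C * u)) *
   ((1 - y ^+ 2 * Q ^+ 2 * z ^- 2) * (1 - y ^+ 2 * Q * z ^- 2) /
    ((1 - a%:C%C * y * u) * (1 - b%:C%C * y * u) *
     (1 - c%:C%C * y * u) * (1 - d%:C%C * y * u)))).
Proof.
move=> a1 b1 c1 d1 z u y.
have z1 : normc z = 1 := normc_expi t.
have u1 : normc u = 1 by rewrite normcV z1 invr1.
have P e : qpoch Q (e%:C%C * z) N * qpoch Q (e%:C%C * u) N = (hfin q (cos t) e N)%:C%C.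
  exact: qpoch_expi.
have hn0 e : `|e| < 1 -> (hfin q (cos t) e N)%:C%C != 0.
  by move=> e1; rewrite eq_complex /= negb_and gt_eqF // hfin_gt0 ?norm_cos_le1.
have yE : y = Q ^+ N by rewrite /y rmorphXn.
have yn : normc y <= 1 by rewrite normc_real ger0_norm ?qX_ge0 ?qX_le1.
rewrite (@aw_kernelE _ Q _ _ _ _ s%:C%C) ?expi_neq0 //; first last.
- move=> e; rewrite -[[:: _; _; _; _]]/(map (fun e : R => e%:C%C) [:: a; b; c; d]).
  case/mapP => e' he' ->; have e1 : `|e'| < 1.
    by move: he'; rewrite !inE => /or4P[] /eqP ->.
  have := hn0 e' e1; rewrite -P mulf_eq0 negb_or => /andP[h1 h2].
  rewrite h1 h2; split=> //; apply: normc_small_neq0.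
    by rewrite normcM u1 mulr1 normc_real.
  rewrite -yE !normcM u1 mulr1 normc_real (le_lt_trans _ e1) //.
  by rewrite -[leRHS]mulr1 ler_pM ?normc_ge0.
- by rewrite -rmorphXn /= s2.
rewrite -/z -/u -yE !P /gfin -/s.
rewrite -[- Q](rmorphN (real_complex R)) -[- s%:C%C](rmorphN (real_complex R)) !P.
by rewrite rmorphM fmorphV !rmorphM.
Qed.

(** In the expanded product the second symmetric function occurs as
    [e2 (z^-1 - z)], which is imaginary on the unit circle; the other terms are
    those of [1 - abcd] and [e1 - e3]. *)
Lemma kernel_real_part a b c d t :
  let z := expi t in let u := z^-1 in
  complex.Re (z * (1 - z ^+ 2) *
   ((1 - a%:C%C * u) * (1 - b%:C%C * u) * (1 - c%:C%C * u) * (1 - d%:C%C * u))) =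
  2 * sin t ^+ 2 * ((1 - a * b * c * d) * (2 * cos t) -
     (a + b + c + d - (a * b * c + a * b * d + a * c * d + b * c * d))).
Proof.
move=> z u; have z0 : z != 0 by exact: expi_neq0.
pose e1 := a + b + c + d.
pose e2 := a * b + a * c + a * d + b * c + b * d + c * d.
pose e3 := a * b * c + a * b * d + a * c * d + b * c * d.
pose e4 := a * b * c * d.
have -> : z * (1 - z ^+ 2) *
   ((1 - a%:C%C * u) * (1 - b%:C%C * u) * (1 - c%:C%C * u) * (1 - d%:C%C * u)) =
   z - e1%:C%C + e2%:C%C * u - e3%:C%C * u ^+ 2 + e4%:C%C * u ^+ 3
   - z ^+ 3 + e1%:C%C * z ^+ 2 - e2%:C%C * z + e3%:C%C - e4%:C%C * u.
  rewrite /e1 /e2 /e3 /e4 !(rmorphD, rmorphM) /= /u; field.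
  by rewrite z0.
have -> : u = (cos t -i* sin t)%C by rewrite /u expiV.
have -> : z = (cos t +i* sin t)%C by [].
rewrite !(cReD, cReN, cReMr) !exprS !expr0 !mulr1 !(cReM, cImM) /=.
have D : 1 - cos t ^+ 2 - sin t ^+ 2 = 0 by rewrite -addrA -opprD cos2Dsin2 subrr.
apply/eqP; rewrite -subr_eq0; apply/eqP.
rewrite -[RHS](mul0r ((1 - e4) * cos t - (e1 - e3))) -D /e1 /e2 /e3 /e4; ring.
Qed.

Definition awL a b c d (p : {poly R}) : R :=
  bint 0 pi (fun t => p.[cos t] * (4 * sin t ^+ 2) * gker a b c d (cos t)).

(** The limit of [kernel_mean0] along the truncations, by bounded convergence. *)
Lemma moment_relation a b c d : `|a| < 1 -> `|b| < 1 -> `|c| < 1 -> `|d| < 1 ->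
  bint 0 pi (fun t => 2 * sin t ^+ 2 * ((1 - a * b * c * d) * (2 * cos t) -
     (a + b + c + d - (a * b * c + a * b * d + a * c * d + b * c * d))) *
     gker a b c d (cos t)) = 0.
Proof.
move=> a1 b1 c1 d1.
pose f N t := complex.Re (aw_kernel Q a%:C%C b%:C%C c%:C%C d%:C%C N (circ 1 t)).
pose r := Num.max (Num.max `|a| `|b|) (Num.max `|c| `|d|).
have r1 : r < 1 by rewrite !gt_max a1 b1 c1 d1.
have [C hC] := gfin_bounded r1.
(* In [kernel_circle] the numerators are of the form [1 - w] with [|w| <= 1], and
   each denominator has modulus at least [1 - |e|]. *)
pose B := 2 * (2 * 2 * 2 * 2) * (2 * 2 / ((1 - `|a|) * (1 - `|b|) * (1 - `|c|) * (1 - `|d|))).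
have c1t t : circ 1 t = expi t by rewrite /circ mul1r.
have z1 t : normc (expi t) = 1 := normc_expi t.
have u1 t : normc (expi t)^-1 = 1 by rewrite normcV z1 invr1.
have zX t : normc (expi t ^- 2) = 1 by rewrite normcV normcX z1 expr1n invr1.
have yn N : normc (q ^+ N)%:C%C <= 1 by rewrite normc_real ger0_norm ?qX_ge0 ?qX_le1.
have Qn : normc Q <= 1 by rewrite normc_real.
have [] := @bint_cvg R 0 pi f (fun t => 2 * sin t ^+ 2 * ((1 - a * b * c * d) * (2 * cos t) -
     (a + b + c + d - (a * b * c + a * b * d + a * c * d + b * c * d))) *
     gker a b c d (cos t)) (C * B).
- move=> N; have [cK _] := shift_inv_kernel hq N a1 b1 c1 d1.
  by case: (bmeas_Re cK (radius1 q)).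
- move=> N t _; rewrite /f c1t kernel_circle // cReMr normrM ler_pM //.
    by apply: hC; rewrite ?norm_cos_le1 //; rewrite /r !le_max lexx ?orbT.
  apply: le_trans (normRe_le _) _; rewrite !normcM normcV !normcM.
  have E e : `|e| < 1 -> normc (1 - e%:C%C * (expi t)^-1) <= 2.
    by move=> e1; apply: normc_one_sub_le; rewrite normcM u1 mulr1 normc_real ltW.
  have D e : `|e| < 1 -> 1 - `|e| <= normc (1 - e%:C%C * (q ^+ N)%:C%C * (expi t)^-1).
    move=> e1; apply: le_trans (normc_one_sub_ge _); rewrite lerD2l lerN2 !normcM u1 mulr1.
    by rewrite [normc e%:C%C]normc_real -[leRHS]mulr1 ler_pM ?normc_ge0 ?yn.
  have [a0 b0 c0 d0] : [/\ 0 < 1 - `|a|, 0 < 1 - `|b|, 0 < 1 - `|c| & 0 < 1 - `|d|].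
    by rewrite !subr_gt0.
  rewrite /B ler_pM ?mulr_ge0 ?invr_ge0 ?mulr_ge0 ?normc_ge0 //.
    rewrite ler_pM ?mulr_ge0 ?normc_ge0 //.
      by rewrite z1 mul1r normc_one_sub_le // normcX z1 expr1n.
    by rewrite !ler_pM ?mulr_ge0 ?normc_ge0 ?E.
  rewrite ler_pM ?mulr_ge0 ?invr_ge0 ?mulr_ge0 ?normc_ge0 //.
    by rewrite ler_pM ?normc_ge0 // normc_one_sub_le // normcM zX mulr1 normcM !normcX
      mulr_ile1 ?exprn_ge0 ?exprn_ile1 ?normc_ge0.
  rewrite lef_pV2 ?posrE ?mulr_gt0 ?(lt_le_trans a0 (D _ _)) ?(lt_le_trans b0 (D _ _))
    ?(lt_le_trans c0 (D _ _)) ?(lt_le_trans d0 (D _ _)) //.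
  by rewrite !ler_pM ?mulr_ge0 ?D // ltW.
- move=> t _; rewrite /f c1t mulrC.
  under eq_fun do rewrite kernel_circle // cReMr.
  apply: cvgM; first by apply: gfin_cvg; rewrite ?norm_cos_le1.
  rewrite -kernel_real_part.
  have y0 : ccvg (fun N => (q ^+ N)%:C%C) (0 : R[i]).
    split=> /=; last exact: cvg_cst.
    by apply: cvg_expr; rewrite gtr0_norm.
  have L (w : R[i]) (g : nat -> R[i]) : ccvg g 0 -> ccvg (fun N => 1 - w * g N) 1.
    move=> g0; have := ccvgD (ccvg_cst 1) (ccvgM (ccvg_cst (- w)) g0).
    rewrite mulr0 addr0; congr ccvg; apply/funext => N; by rewrite mulNr.
  have [] // : ccvg (fun N => expi t * (1 - expi t ^+ 2) *
   ((1 - a%:C%C * (expi t)^-1) * (1 - b%:C%C * (expi t)^-1) *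
    (1 - c%:C%C * (expi t)^-1) * (1 - d%:C%C * (expi t)^-1)) *
   ((1 - (q ^+ N)%:C%C ^+ 2 * Q ^+ 2 * expi t ^- 2) *
    (1 - (q ^+ N)%:C%C ^+ 2 * Q * expi t ^- 2) /
    ((1 - a%:C%C * (q ^+ N)%:C%C * (expi t)^-1) * (1 - b%:C%C * (q ^+ N)%:C%C * (expi t)^-1) *
     (1 - c%:C%C * (q ^+ N)%:C%C * (expi t)^-1) * (1 - d%:C%C * (q ^+ N)%:C%C * (expi t)^-1))))
   (expi t * (1 - expi t ^+ 2) *
   ((1 - a%:C%C * (expi t)^-1) * (1 - b%:C%C * (expi t)^-1) *
    (1 - c%:C%C * (expi t)^-1) * (1 - d%:C%C * (expi t)^-1))).
  rewrite -[X in ccvg _ X]mulr1; apply: ccvgM; first exact: ccvg_cst.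
  have y2 : ccvg (fun N => (q ^+ N)%:C%C ^+ 2) (0 : R[i]).
    by have := ccvgM y0 y0; rewrite mulr0.
  have L1 e : ccvg (fun N => 1 - e%:C%C * (q ^+ N)%:C%C * (expi t)^-1) 1.
    have := L (e%:C%C * (expi t)^-1) _ y0; congr ccvg; apply/funext => N; ring.
  have L2 w : ccvg (fun N => 1 - (q ^+ N)%:C%C ^+ 2 * w * expi t ^- 2) 1.
    have := L (w * expi t ^- 2) _ y2; congr ccvg; apply/funext => N; ring.
  rewrite -[X in ccvg _ X](mulr1 1); apply: ccvgM.
    by rewrite -[X in ccvg _ X](mulr1 1); apply: ccvgM; exact: L2.
  rewrite -[X in ccvg _ X]invr1; apply: ccvgV; first exact: oner_neq0.
  rewrite -[X in ccvg _ X](mulr1 1); apply: ccvgM; last exact: L1.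
  rewrite -[X in ccvg _ X](mulr1 1); apply: ccvgM; last exact: L1.
  by rewrite -[X in ccvg _ X](mulr1 1); apply: ccvgM; exact: L1.
move=> _; rewrite (_ : (fun n => bint 0 pi (f n)) = fun=> 0); last first.
  by apply/funext => N; exact: kernel_mean0.
by move=> H; apply: (cvg_unique _ H); [exact: Rhausdorff|exact: cvg_cst].
Qed.

End weight.

(** * The Askey-Wilson integral *)

Section functional.
Variables (R : realType) (q : R).
Hypothesis hq : 0 < q < 1.
Implicit Types (a b c d x t : R) (p r : {poly R}).

Let q_gt0 : 0 < q. Proof. by case/andP: hq. Qed.
Let q_lt1 : q < 1. Proof. by case/andP: hq. Qed.
Let s := Num.sqrt q.
Let s2 : s ^+ 2 = q. Proof. by rewrite sqr_sqrtr // ltW. Qed.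
Let nq : `|q| < 1. Proof. by rewrite gtr0_norm. Qed.
Let s_gt0 : 0 < s. Proof. by rewrite sqrtr_gt0. Qed.
Let ns : `|s| < 1.
Proof. by rewrite ger0_norm ?sqrtr_ge0 // -sqrtr1 ltr_sqrt. Qed.

Local Notation gk := (gker q).
Local Notation L := (awL q).

Lemma normM_lt1 a b : `|a| < 1 -> `|b| < 1 -> `|a * b| < 1.
Proof. by move=> a1 b1; rewrite normrM mulr_ilt1. Qed.

Lemma normMX_lt1 a k : `|a| < 1 -> `|a * q ^+ k| < 1.
Proof.
by move=> a1; rewrite normrM (le_lt_trans _ a1) // ler_piMr // ger0_norm ?qX_ge0 ?qX_le1.
Qed.

Lemma continuous_horner_cos p : continuous (fun t => p.[cos t]).
Proof. by move=> t; apply: continuous_comp; [exact: continuous_cos|exact: continuous_horner]. Qed.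

Lemma bmeas_poly_sin2 p : bmeas 0 pi (fun t => p.[cos t] * (4 * sin t ^+ 2)).
Proof.
apply: bmeas_continuous => t; apply: cvgM; first exact: continuous_horner_cos.
apply: cvgMl_tmp; apply: (@continuous_comp _ _ _ (@sin R) (fun y => y ^+ 2)).
  exact: continuous_sin.
exact: exprn_continuous.
Qed.

Lemma bmeas_awL a b c d p : `|a| < 1 -> `|b| < 1 -> `|c| < 1 -> `|d| < 1 ->
  bmeas 0 pi (fun t => p.[cos t] * (4 * sin t ^+ 2) * gk a b c d (cos t)).
Proof.
by move=> a1 b1 c1 d1; apply: bmeasM; [exact: bmeas_poly_sin2|exact: bmeas_gker].
Qed.

Lemma awLD a b c d p r : `|a| < 1 -> `|b| < 1 -> `|c| < 1 -> `|d| < 1 ->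
  L a b c d (p + r) = L a b c d p + L a b c d r.
Proof.
move=> a1 b1 c1 d1; rewrite /awL -bintD; [|exact: bmeas_awL|exact: bmeas_awL].
by apply: eq_bint => t _; rewrite hornerD; ring.
Qed.

Lemma awLZ a b c d (k : R) p : `|a| < 1 -> `|b| < 1 -> `|c| < 1 -> `|d| < 1 ->
  L a b c d (k *: p) = k * L a b c d p.
Proof.
move=> a1 b1 c1 d1; rewrite /awL -bintZ; last exact: bmeas_awL.
by apply: eq_bint => t _; rewrite hornerZ; ring.
Qed.

Lemma awL0 a b c d : `|a| < 1 -> `|b| < 1 -> `|c| < 1 -> `|d| < 1 -> L a b c d 0 = 0.
Proof. by move=> a1 b1 c1 d1; rewrite -(scale0r (0 : {poly R})) awLZ // mul0r. Qed.

Lemma awLB a b c d p r : `|a| < 1 -> `|b| < 1 -> `|c| < 1 -> `|d| < 1 ->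
  L a b c d (p - r) = L a b c d p - L a b c d r.
Proof. by move=> a1 b1 c1 d1; rewrite awLD // -scaleN1r awLZ // mulN1r. Qed.

Lemma awL_sum a b c d n (F : nat -> {poly R}) :
  `|a| < 1 -> `|b| < 1 -> `|c| < 1 -> `|d| < 1 ->
  L a b c d (\sum_(k < n) F k) = \sum_(k < n) L a b c d (F k).
Proof.
move=> a1 b1 c1 d1; elim: n => [|n IH]; first by rewrite !big_ord0 awL0.
by rewrite !big_ord_recr /= awLD // IH.
Qed.

Lemma awL_swap12 a b c d p : L a b c d p = L b a c d p.
Proof. by apply: eq_bint => t _; rewrite /gker [h q _ a * _]mulrC. Qed.

Lemma awL_swap23 a b c d p : L a b c d p = L a c b d p.
Proof. by apply: eq_bint => t _; rewrite /gker [h q _ a * _ * _]mulrAC. Qed.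

Lemma awL_swap34 a b c d p : L a b c d p = L a b d c p.
Proof. by apply: eq_bint => t _; rewrite /gker [_ * h q _ c * _]mulrAC. Qed.

Definition quad a : {poly R} := 1 - (2 * a) *: 'X + (a ^+ 2)%:P.

Lemma hornerquad a x : (quad a).[x] = 1 - 2 * a * x + a ^+ 2.
Proof. by rewrite /quad !hornerE. Qed.

Lemma awL_shift a b c d p : `|a| < 1 -> `|b| < 1 -> `|c| < 1 -> `|d| < 1 ->
  L (a * q) b c d p = L a b c d (quad a * p).
Proof.
move=> a1 b1 c1 d1; apply: eq_bint => t _; rewrite hornerM hornerquad /gker.
have x1 := norm_cos_le1 t; have aq1 : `|a * q| < 1 by have := normMX_lt1 1 a1; rewrite expr1.
have := h_gt0 hq x1 a1; rewrite (h_shift hq x1 (ltW a1)).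
move: (h_gt0 hq x1 aq1) (h_gt0 hq x1 b1) (h_gt0 hq x1 c1) (h_gt0 hq x1 d1).
move=> /lt0r_neq0 h1 /lt0r_neq0 h2 /lt0r_neq0 h3 /lt0r_neq0 h4 /lt0r_neq0.
rewrite mulf_eq0 negb_or => /andP[h5 _]; field.
by rewrite h1 h2 h3 h4 h5.
Qed.

(** The weight for [a * q] is the weight for [a] times a polynomial of degree one
    in [x], whose integral the moment relation expresses by the total mass. *)
Lemma awL_one_shift a b c d : `|a| < 1 -> `|b| < 1 -> `|c| < 1 -> `|d| < 1 ->
  (1 - a * b * c * d) * L (a * q) b c d 1 =
  (1 - a * b) * (1 - a * c) * (1 - a * d) * L a b c d 1.
Proof.
move=> a1 b1 c1 d1; rewrite awL_shift // mulr1.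
have M := moment_relation hq a1 b1 c1 d1.
pose e1 := a + b + c + d.
pose e3 := a * b * c + a * b * d + a * c * d + b * c * d.
pose p : {poly R} := (1 - a * b * c * d) *: (2 *: 'X) - (e1 - e3) *: 1.
have hp : L a b c d (2^-1 *: p) = 0.
  rewrite -M; apply: eq_bint => t _; congr (_ * _).
  by rewrite hornerZ /p hornerD hornerN !hornerZ hornerX hornerC /e1 /e3; field.
have Lp : L a b c d p = 0.
  by apply: (@mulfI _ (2^-1)); [rewrite invr_neq0|rewrite -awLZ // hp mulr0].
rewrite -!awLZ //; apply/eqP; rewrite -subr_eq0 -awLB //; apply/eqP.
(* The difference of the two polynomials is [- a] times that of the relation. *)
rewrite -[RHS](mulr0 (- a)) -Lp -awLZ //; congr (L a b c d _).
rewrite /p /quad /e1 /e3 -!mul_polyC !rmorphB !rmorphM !rmorphD !rmorphM rmorph1 ?rmorphXn /=.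
by rewrite !rmorphN; ring.
Qed.

Lemma awL_one_shiftn a b c d n : `|a| < 1 -> `|b| < 1 -> `|c| < 1 -> `|d| < 1 ->
  qpoch q (a * b * c * d) n * L (a * q ^+ n) b c d 1 =
  qpoch q (a * b) n * qpoch q (a * c) n * qpoch q (a * d) n * L a b c d 1.
Proof.
move=> a1 b1 c1 d1; elim: n => [|n IH]; first by rewrite !qpoch0 expr0 !mulr1 !mul1r.
rewrite exprSr mulrA !qpochSr.
have aqn := normMX_lt1 n a1.
have := awL_one_shift aqn b1 c1 d1.
rewrite [a * q ^+ n * b]mulrAC [a * q ^+ n * c]mulrAC [a * q ^+ n * d]mulrAC.
rewrite [a * b * q ^+ n * c]mulrAC [a * b * c * q ^+ n * d]mulrAC => E.
rewrite -mulrA E.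
transitivity ((1 - a * b * q ^+ n) * (1 - a * c * q ^+ n) * (1 - a * d * q ^+ n) *
  (qpoch q (a * b * c * d) n * L (a * q ^+ n) b c d 1)); first by ring.
rewrite IH; ring.
Qed.

Lemma gker_bounded (r : R) : r < 1 -> exists C, forall a b c d x, `|x| <= 1 ->
  `|a| <= r -> `|b| <= r -> `|c| <= r -> `|d| <= r -> `|gk a b c d x| <= C.
Proof.
move=> r1; have [C hC] := gfin_bounded hq r1; exists C => a b c d x x1 a1 b1 c1 d1.
have H : `|gfin q a b c d x N| @[N --> \oo] --> `|gk a b c d x|.
  by apply: cvg_norm; apply: gfin_cvg => //; apply: le_lt_trans r1.
rewrite -(cvg_lim (@Rhausdorff R) H); apply: limr_le; first by apply/cvg_ex; exists `|gk a b c d x|.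
by apply: nearW => N; exact: hC.
Qed.

Lemma awL_cvg0 a b c d p : `|a| < 1 -> `|b| < 1 -> `|c| < 1 -> `|d| < 1 ->
  L (a * q ^+ N) b c d p @[N --> \oo] --> L 0 b c d p.
Proof.
move=> a1 b1 c1 d1; pose r := Num.max (Num.max `|a| `|b|) (Num.max `|c| `|d|).
have r1 : r < 1 by rewrite !gt_max a1 b1 c1 d1.
have [C hC] := gker_bounded r1.
have [mp [B hB]] := bmeas_poly_sin2 p.
have [] // := @bint_cvg R 0 pi
  (fun N t => p.[cos t] * (4 * sin t ^+ 2) * gk (a * q ^+ N) b c d (cos t))
  (fun t => p.[cos t] * (4 * sin t ^+ 2) * gk 0 b c d (cos t)) (B * C).
- by move=> N; case: (bmeas_awL p (normMX_lt1 N a1) b1 c1 d1).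
- move=> N t It; rewrite normrM ler_pM ?hB //.
  apply: hC; rewrite ?norm_cos_le1 //; last 3 first.
  + by rewrite /r !le_max lexx ?orbT.
  + by rewrite /r !le_max lexx ?orbT.
  + by rewrite /r !le_max lexx ?orbT.
  rewrite (@le_trans _ _ `|a|) //; last by rewrite /r !le_max lexx ?orbT.
  by rewrite normrM ler_piMr // ger0_norm ?qX_ge0 ?qX_le1.
- move=> t _; apply: cvgMl_tmp; apply: cvgMl_tmp.
  have x1 := norm_cos_le1 t.
  apply: cvgV.
    by rewrite !mulf_neq0 ?h0 ?oner_eq0 // gt_eqF // h_gt0.
  by do 3! apply: cvgMr_tmp; rewrite h0; exact: h_small_cvg.
Qed.

Lemma awL_one_to0 a b c d : `|a| < 1 -> `|b| < 1 -> `|c| < 1 -> `|d| < 1 ->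
  qpochinf q (a * b * c * d) * L 0 b c d 1 =
  qpochinf q (a * b) * qpochinf q (a * c) * qpochinf q (a * d) * L a b c d 1.
Proof.
move=> a1 b1 c1 d1.
have H : qpoch q (a * b * c * d) N * L (a * q ^+ N) b c d 1 @[N --> \oo] -->
    qpochinf q (a * b * c * d) * L 0 b c d 1.
  apply: cvgM; last exact: awL_cvg0.
  by apply: qpoch_cvg => //; rewrite ltW // !normM_lt1.
apply: (cvg_unique (@Rhausdorff R) H).
rewrite (_ : (fun N => _) = fun N =>
  qpoch q (a * b) N * qpoch q (a * c) N * qpoch q (a * d) N * L a b c d 1); last first.
  by apply/funext => N; rewrite awL_one_shiftn.
by apply: cvgMr_tmp; apply: cvgM; [apply: cvgM|]; apply: qpoch_cvg => //; rewrite ltW // normM_lt1.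
Qed.

(** The parameters go to zero one after the other; each step produces the products
    with the partners that are still nonzero. *)
Lemma awL_one_reduce a b c d : `|a| < 1 -> `|b| < 1 -> `|c| < 1 -> `|d| < 1 ->
  L a b c d 1 * (qpochinf q (a * b) * qpochinf q (a * c) * qpochinf q (a * d) *
    qpochinf q (b * c) * qpochinf q (b * d) * qpochinf q (c * d)) =
  qpochinf q (a * b * c * d) * L 0 0 0 0 1.
Proof.
move=> a1 b1 c1 d1; have n0 : `|0 : R| < 1 by rewrite normr0.
have E1 := awL_one_to0 a1 b1 c1 d1.
have E2 := awL_one_to0 b1 n0 c1 d1.
have E3 := awL_one_to0 c1 n0 n0 d1.
have E4 := awL_one_to0 d1 n0 n0 n0.
move: E2 E3 E4; rewrite !mulr0 !mul0r !qpochinf0 !mul1r.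
rewrite (awL_swap12 b 0) => E2.
rewrite (awL_swap12 c 0) (awL_swap23 0 c) => E3.
rewrite (awL_swap12 d 0) (awL_swap23 0 d) (awL_swap34 0 0 d) => E4.
transitivity (qpochinf q (a * b * c * d) * L 0 b c d 1 *
  (qpochinf q (b * c) * qpochinf q (b * d) * qpochinf q (c * d))).
  by rewrite E1; ring.
rewrite -mulrA; congr (_ * _).
transitivity (qpochinf q (b * c) * qpochinf q (b * d) * L 0 b c d 1 * qpochinf q (c * d)).
  by ring.
by rewrite -E2 mulrC -E3 E4.
Qed.

(** The exponents up to [2 N] separate by parity, and both halves are differences
    of squares, because [s^2 = q]. *)
Lemma qpoch_double N : qpoch q q (N + N) =
  qpoch q q N * qpoch q (- q) N * qpoch q s N * qpoch q (- s) N.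
Proof.
elim: N => [|N IH]; first by rewrite !qpoch0 !mulr1.
rewrite addSn addnS !qpochSr IH.
have -> : 1 - q * q ^+ (N + N) = (1 - s * q ^+ N) * (1 - - s * q ^+ N).
  by rewrite exprD -{1}s2; ring.
have -> : 1 - q * q ^+ (N + N).+1 = (1 - q * q ^+ N) * (1 - - q * q ^+ N).
  by rewrite exprS exprD; ring.
ring.
Qed.

(** Euler's identity: [(q; q)_oo] cancels in the limit of [qpoch_double]. *)
Lemma euler_qpochinf : qpochinf q (- q) * qpochinf q s * qpochinf q (- s) = 1.
Proof.
have nN a : `|a| < 1 -> `|- a| <= 1 by move=> a1; rewrite normrN ltW.
have q0 : qpochinf q q != 0 by apply: qpochinf_neq0.
apply: (mulfI q0); rewrite mulr1 !mulrA.
have H : qpoch q q (N + N) @[N --> \oo] --> qpochinf q q.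
  apply: cvg_comp; last exact: (qpoch_cvg hq (ltW nq)).
  move=> A [N _ hN]; exists N => // n /= Nn; apply: hN.
  by rewrite /= (leq_trans Nn) // leq_addr.
apply/esym; apply: (cvg_unique (@Rhausdorff R) H).
rewrite (_ : (fun N => _) = fun N =>
  qpoch q q N * qpoch q (- q) N * qpoch q s N * qpoch q (- s) N); last first.
  by apply/funext => N; rewrite qpoch_double.
by apply: cvgM; [apply: cvgM; [apply: cvgM|]|]; apply: qpoch_cvg; rewrite ?nN // ltW.
Qed.

Lemma bint_sin2 : bint 0 pi (fun t : R => 4 * sin t ^+ 2) = 2 * pi.
Proof.
have B k : bmeas 0 pi (fun t : R => cos (k%:~R * t)).
  apply: bmeas_continuous => t; apply: continuous_comp; first exact: mulrl_continuous.
  exact: continuous_cos.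
transitivity (bint 0 pi (fun t : R => 2 * cos (0%:~R * t) + (-2) * cos (2%:~R * t))).
  apply: eq_bint => t _; rewrite mul0r cos0 sin2cos2.
  have -> : 2%:~R * t = t *+ 2 by rewrite mulr_natl.
  by rewrite cos_mulr2n; ring.
rewrite bintD; try by apply: bmeasM; [exact: bmeas_cst|exact: B].
by rewrite !bintZ // !bint_cosk eqxx mul1r mul0r mulr0 addr0.
Qed.

(** For these parameters numerator and denominator of the density coincide. *)
Lemma awL_trivial : L q (- q) s (- s) 1 = 2 * pi.
Proof.
rewrite -bint_sin2; apply: eq_bint => t _; rewrite /gker -/s hornerC mul1r mulfV ?mulr1 //.
have x1 := norm_cos_le1 t.
by rewrite !mulf_neq0 // gt_eqF // h_gt0 ?normrN.
Qed.

(** The constant left by [awL_one_reduce], read off from [awL_trivial]. The pairwise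
    products of [q, - q, s, - s] are [- q^2, q s, - q s, - q s, q s, - q], and
    Euler's identity, used twice, eliminates their infinite products. *)
Lemma awL_hermite : L 0 0 0 0 1 * qpochinf q q = 2 * pi.
Proof.
have nN a : `|a| < 1 -> `|- a| < 1 by rewrite normrN.
have := awL_one_reduce nq (nN _ nq) ns (nN _ ns); rewrite awL_trivial.
have S a : `|a| < 1 -> qpochinf q a = (1 - a) * qpochinf q (a * q).
  by move=> a1; rewrite (qpochinf_split hq 1 (ltW a1)) qpochSr qpoch0 mul1r expr0 expr1 mulr1.
have Eu := euler_qpochinf.
have q1 := S _ nq.
have q2 : qpochinf q (q * q) = _ := S _ (normM_lt1 nq nq).
have Nq := S _ (nN _ nq); have s1 := S _ ns; have Ns := S _ (nN _ ns).
have e1 : q * - q = - q * q by ring.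
have e2 : q * - s = - s * q by ring.
have e3 : - q * s = - s * q by ring.
have e4 : - q * - s = s * q by ring.
have e5 : s * - s = - q by rewrite mulrN -expr2 s2.
have e6 : q * - q * s * - s = q * q * q by rewrite -{3}s2; ring.
rewrite e6 [q * s]mulrC e1 e2 e3 e4 e5.
have z1 : 1 - q != 0 by rewrite subr_eq0 eq_sym lt_eqF.
have z2 : 1 + q != 0 by rewrite gt_eqF // addr_gt0.
have z3 : 1 - s != 0 by rewrite subr_eq0 eq_sym lt_eqF // (le_lt_trans (ler_norm _) ns).
have z4 : 1 + s != 0 by rewrite gt_eqF // addr_gt0.
move: Eu; rewrite q1 q2 s1 Ns Nq.
move: (qpochinf q (- q * q)) (qpochinf q (s * q)) (qpochinf q (- s * q)) (qpochinf q (q * q * q)).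
move: (L 0 0 0 0 1) => L0 X Y Z W Eu H.
have H1 : (1 - q) * (1 - q * q) * (2 * pi) * (X * Y ^+ 2 * Z ^+ 2 * ((1 + q) * X)) =
   (1 - q) * (1 - q * q) * (W * L0).
  by rewrite -H; ring.
have E2 : (1 - q) * (1 - q * q) * (X * Y ^+ 2 * Z ^+ 2 * ((1 + q) * X)) = 1.
  transitivity (((1 - - q) * X * ((1 - s) * Y) * ((1 - - s) * Z)) ^+ 2); last first.
    by rewrite Eu expr1n.
  have -> : 1 - q * q = (1 - q) * (1 + q) by ring.
  have -> : (1 - q) * ((1 - q) * (1 + q)) = ((1 - s ^+ 2) ^+ 2) * (1 + q) by rewrite s2; ring.
  ring.
have -> : L0 * ((1 - q) * ((1 - q * q) * W)) = (1 - q) * (1 - q * q) * (W * L0) by ring.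
rewrite -H1; transitivity (2 * pi * ((1 - q) * (1 - q * q) * (X * Y ^+ 2 * Z ^+ 2 * ((1 + q) * X)))).
  by ring.
by rewrite E2 mulr1.
Qed.

(** The Askey-Wilson integral: [awL_one_reduce] expresses it by a single constant,
    which is [awL_hermite]. *)
Lemma awL_one a b c d : `|a| < 1 -> `|b| < 1 -> `|c| < 1 -> `|d| < 1 ->
  L a b c d 1 = 2 * pi * qpochinf q (a * b * c * d) /
    (qpochinf q q * qpochinf q (a * b) * qpochinf q (a * c) * qpochinf q (a * d) *
     qpochinf q (b * c) * qpochinf q (b * d) * qpochinf q (c * d)).
Proof.
move=> a1 b1 c1 d1; have := awL_one_reduce a1 b1 c1 d1.
have nz x y : `|x| < 1 -> `|y| < 1 -> qpochinf q (x * y) != 0.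
  by move=> x1 y1; apply: qpochinf_neq0 => //; exact: normM_lt1.
have q0 : qpochinf q q != 0 by exact: qpochinf_neq0.
move: (nz _ _ a1 b1) (nz _ _ a1 c1) (nz _ _ a1 d1) (nz _ _ b1 c1) (nz _ _ b1 d1) (nz _ _ c1 d1).
rewrite -awL_hermite; move: (qpochinf q (a * b)) (qpochinf q (a * c)) (qpochinf q (a * d)).
move: (qpochinf q (b * c)) (qpochinf q (b * d)) (qpochinf q (c * d)) (qpochinf q q) q0.
move=> x1 x2 x3 x0 n0 x4 x5 x6 n4 n5 n6 n1 n2 n3 E.
have P0 : x4 * x5 * x6 * x1 * x2 * x3 != 0 by rewrite !mulf_neq0.
apply: (mulIf P0); rewrite E; field.
by rewrite n0 n1 n2 n3 n4 n5 n6.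
Qed.

End functional.

(** * Orthogonality for nonzero parameters *)

Section orthogonality.
Variables (R : realType) (q : R).
Hypothesis hq : 0 < q < 1.
Implicit Types (a b c d e x t : R) (p r : {poly R}).

Let q_gt0 : 0 < q. Proof. by case/andP: hq. Qed.
Let q_lt1 : q < 1. Proof. by case/andP: hq. Qed.
Let q0 : q != 0. Proof. exact: lt0r_neq0. Qed.
Let q1 := one_sub_qX_neq0 hq.

Local Notation L := (awL q).

(** The basis adapted to the weight: a factor [Phi a k] amounts to replacing [a] by
    [a * q^k]. *)
Definition Phi a k : {poly R} := \prod_(i < k) quad (a * q ^+ i).

Lemma PhiSr a k : Phi a k.+1 = Phi a k * quad (a * q ^+ k).
Proof. by rewrite /Phi big_ord_recr. Qed.

Lemma horner_Phi a k x : (Phi a k).[x] = hfin q x a k.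
Proof.
rewrite /Phi horner_prod; apply: eq_bigr => i _.
by rewrite hornerquad exprMn -!exprM mulnC; ring.
Qed.

Lemma coef_mul_quad p e k : (p * quad e)`_k.+1 = p`_k.+1 * (1 + e ^+ 2) - p`_k * (2 * e).
Proof.
have -> : p * quad e = (1 + e ^+ 2) *: p - (2 * e) *: (p * 'X).
  rewrite /quad -!mul_polyC rmorphD rmorph1; ring.
by rewrite coefB !coefZ coefMX /=; ring.
Qed.

Lemma size_quad e : (size (quad e) <= 2)%N.
Proof.
have -> : quad e = (1 + e ^+ 2)%:P - (2 * e) *: 'X by rewrite /quad rmorphD rmorph1; ring.
rewrite (leq_trans (size_polyD _ _)) // geq_max size_polyN.
rewrite (leq_trans (size_polyC_leq1 _)) //.
by rewrite (leq_trans (size_scale_leq _ _)) // size_polyX.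
Qed.

Lemma size_Phi a k : (size (Phi a k) <= k.+1)%N.
Proof.
elim: k => [|k IH]; first by rewrite /Phi big_ord0 size_polyC oner_eq0.
rewrite PhiSr -(addn1 k); apply: leq_sizeM => //; exact: size_quad.
Qed.

Lemma coef_Phi a k : (Phi a k)`_k = 2 ^+ k * \prod_(i < k) (- (a * q ^+ i)).
Proof.
elim: k => [|k IH]; first by rewrite /Phi !big_ord0 coefC mulr1.
rewrite PhiSr coef_mul_quad IH nth_default ?size_Phi // big_ord_recr /= (exprS 2); ring.
Qed.

Lemma awL_Phi a b c d k p : `|a| < 1 -> `|b| < 1 -> `|c| < 1 -> `|d| < 1 ->
  L a b c d (Phi a k * p) = L (a * q ^+ k) b c d p.
Proof.
move=> a1 b1 c1 d1; elim: k p => [|k IH] p; first by rewrite /Phi big_ord0 mul1r mulr1.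
rewrite PhiSr -mulrA IH exprSr mulrA.
exact: esym (awL_shift hq p (normMX_lt1 hq k a1) b1 c1 d1).
Qed.

(** The product [Phi a k * Phi b l] shifts both [a] and [b], and each shift has the
    effect computed in [awL_one_shiftn]. *)
Lemma awL_Phi2 a b c d k l : `|a| < 1 -> `|b| < 1 -> `|c| < 1 -> `|d| < 1 ->
  qpoch q (a * b * c * d) (k + l) * L a b c d (Phi a k * Phi b l) =
  qpoch q (a * b) (k + l) * qpoch q (a * c) k * qpoch q (a * d) k *
  qpoch q (b * c) l * qpoch q (b * d) l * L a b c d 1.
Proof.
move=> a1 b1 c1 d1; have aqk := normMX_lt1 hq k a1.
rewrite (awL_Phi k _ a1 b1 c1 d1) awL_swap12 -[Phi b l]mulr1 (awL_Phi l 1 b1 aqk c1 d1).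
have E1 := awL_one_shiftn hq l b1 aqk c1 d1.
have E2 := awL_one_shiftn hq k a1 b1 c1 d1.
have e1 : b * (a * q ^+ k) * c * d = a * b * c * d * q ^+ k by ring.
have e2 : b * (a * q ^+ k) = a * b * q ^+ k by ring.
rewrite e1 e2 in E1; rewrite !qpochD -mulrA E1 (awL_swap12 _ b).
transitivity (qpoch q (a * b * q ^+ k) l * qpoch q (b * c) l * qpoch q (b * d) l *
  (qpoch q (a * b * c * d) k * L (a * q ^+ k) b c d 1)); first by ring.
rewrite E2; ring.
Qed.

(** The Askey-Wilson sum as a polynomial in [x = cos t]: the two factors in
    [a e^(it)] and [a e^(- it)] have product [Phi a k]. *)
Definition AWP n a b c d : {poly R} :=
  (qpochs q [:: a * b; a * c; a * d] n / a ^+ n) *: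
  \sum_(k < n.+1) (qpochs q [:: q ^- n; a * b * c * d * q ^ (n%:Z - 1)] k /
     qpochs q [:: a * b; a * c; a * d; q] k * q ^+ k) *: Phi a k.

Lemma AWP0 a b c d : AWP 0 a b c d = 1.
Proof.
rewrite /AWP big_ord1 /Phi big_ord0 /qpochs !big_cons !big_nil !qpoch0 !mulr1.
by rewrite expr0 divr1 !scale1r.
Qed.

Lemma size_AWP n a b c d : (size (AWP n a b c d) <= n.+1)%N.
Proof.
rewrite /AWP (leq_trans (size_scale_leq _ _)) // (leq_trans (size_sum _ _ _)) //.
apply/bigmax_leqP => k _; rewrite (leq_trans (size_scale_leq _ _)) //.
by rewrite (leq_trans (size_Phi _ _)).
Qed.

Let pow_pred n : q ^ (n.+1%:Z - 1) = q ^+ n.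
Proof. by rewrite -addn1 PoszD addrK. Qed.

Lemma qpoch_qVn n :
  qpoch q (q ^- n) n = qpoch q q n * \prod_(i < n) (- (q ^+ i.+1)^-1).
Proof.
rewrite /qpoch (reindex_inj rev_ord_inj) -big_split /=; apply: eq_bigr => i _.
have qi : q ^+ i.+1 != 0 by rewrite expf_neq0.
have -> : q ^- n * q ^+ (n - i.+1) = (q ^+ i.+1)^-1.
  rewrite -{1}(subnKC (ltn_ord i)) exprD invfM -mulrA mulVf ?mulr1 //.
  by rewrite expf_neq0.
by rewrite -exprS; field.
Qed.

Lemma coef_AWP n a b c d : a != 0 -> `|a| < 1 -> `|b| < 1 -> `|c| < 1 -> `|d| < 1 ->
  (AWP n a b c d)`_n = 2 ^+ n * qpoch q (a * b * c * d * q ^ (n%:Z - 1)) n.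
Proof.
move=> a0 a1 b1 c1 d1; rewrite /AWP coefZ coef_sum big_ord_recr /= big1 ?add0r; last first.
  by move=> k _; rewrite coefZ nth_default ?mulr0 // (leq_trans (size_Phi _ _)).
rewrite coefZ coef_Phi /qpochs !big_cons !big_nil !mulr1.
have ab0 := qpoch_small_neq0 hq n (normM_lt1 a1 b1).
have ac0 := qpoch_small_neq0 hq n (normM_lt1 a1 c1).
have ad0 := qpoch_small_neq0 hq n (normM_lt1 a1 d1).
have qq0 := qq_neq0 q1 n.
have W : qpoch q (q ^- n) n / qpoch q q n * q ^+ n * \prod_(i < n) (- (a * q ^+ i)) = a ^+ n.
  rewrite qpoch_qVn [qpoch q q n * _]mulrC mulfK //.
  have -> : q ^+ n = \prod_(i < n) q by rewrite prodr_const card_ord.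
  have -> : a ^+ n = \prod_(i < n) a by rewrite prodr_const card_ord.
  rewrite -!big_split /=; apply: eq_bigr => i _.
  have qi : q ^+ i != 0 by rewrite expf_neq0.
  by rewrite exprS; field; rewrite qi.
have an0 : a ^+ n != 0 by rewrite expf_neq0.
transitivity (2 ^+ n * qpoch q (a * b * c * d * q ^ (n%:Z - 1)) n *
  (qpoch q (q ^- n) n / qpoch q q n * q ^+ n * \prod_(i < n) (- (a * q ^+ i)) / a ^+ n)).
  move: (\prod_(i < n) _) (qpoch q (q ^- n) n) => X Y.
  by field; rewrite ?ab0 ?ac0 ?ad0 ?qq0 ?an0.
by rewrite W mulfV // mulr1.
Qed.

Definition awC n a b c d : R := a * b * c * d * q ^ (n%:Z - 1).

Lemma awL_AWP_Phi n l a b c d : a != 0 -> `|a| < 1 -> `|b| < 1 -> `|c| < 1 -> `|d| < 1 ->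
  L a b c d (AWP n a b c d * Phi b l) =
  qpoch q (a * b) n * qpoch q (a * c) n * qpoch q (a * d) n / a ^+ n *
  qpoch q (b * c) l * qpoch q (b * d) l * L a b c d 1 *
  \sum_(k < n.+1) qweight q n k * (qpoch q (a * b * q ^+ k) l *
    (qpoch q (awC n a b c d) k / qpoch q (a * b * c * d) (k + l))).
Proof.
move=> a0 a1 b1 c1 d1.
rewrite /AWP -scalerAl awLZ // mulr_suml.
rewrite (@awL_sum _ _ hq _ _ _ _ n.+1 (fun k => (qpochs q [:: q ^- n; a * b * c * d * q ^ (n%:Z - 1)] k /
     qpochs q [:: a * b; a * c; a * d; q] k * q ^+ k) *: Phi a k * Phi b l)) //.
rewrite !mulr_sumr; apply: eq_bigr => k _.
rewrite /= -[_ *: Phi a k * _]scalerAl awLZ //.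
have A0 : qpoch q (a * b * c * d) (k + l) != 0.
  by rewrite qpoch_small_neq0 // !normM_lt1.
have -> : L a b c d (Phi a k * Phi b l) = (qpoch q (a * b * c * d) (k + l))^-1 *
  (qpoch q (a * b) (k + l) * qpoch q (a * c) k * qpoch q (a * d) k *
  qpoch q (b * c) l * qpoch q (b * d) l * L a b c d 1).
  by rewrite -awL_Phi2 // mulKf.
rewrite /qweight /qpochs !big_cons !big_nil !mulr1 -/(awC n a b c d) [qpoch q (a * b) (k + l)]qpochD.
have ab0 := qpoch_small_neq0 hq k (normM_lt1 a1 b1).
have ac0 := qpoch_small_neq0 hq k (normM_lt1 a1 c1).
have ad0 := qpoch_small_neq0 hq k (normM_lt1 a1 d1).
have qq0 := qq_neq0 q1 k.
have an0 : a ^+ n != 0 by rewrite expf_neq0.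
move: (qpoch q (a * b * c * d) (k + l)) A0 ab0 ac0 ad0 qq0 an0.
move: (qpoch q (a * b) k) (qpoch q (a * c) k) (qpoch q (a * d) k) (qpoch q q k) (a ^+ n).
move: (qpoch q (q ^- n) k) (qpoch q (awC n a b c d) k) (L a b c d 1) => x1 x2 x3 x4 x5 x6 x7 x8 x9.
move=> n9 n4 n5 n6 n7 n8; field.
by rewrite n4 n5 n6 n7 n8 n9.
Qed.

(** As [awC n = A q^(n - 1)] with [A = abcd], the quotient
    [(awC n)_k / (A)_(k + l)] is [(A q^(k + l))_(n - 1 - l)] up to a constant.
    Together with [(a b q^k)_l] this is a polynomial of degree [n - 1] in [q^k]. *)
Lemma awL_AWP_Phi_lt n l a b c d : (l < n)%N ->
  a != 0 -> `|a| < 1 -> `|b| < 1 -> `|c| < 1 -> `|d| < 1 ->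
  L a b c d (AWP n a b c d * Phi b l) = 0.
Proof.
move=> ln a0 a1 b1 c1 d1; rewrite awL_AWP_Phi //.
case: n ln => // n ln; set S := \sum_(k < _) _; suff -> : S = 0 by rewrite mulr0.
pose A := a * b * c * d.
have A1 : `|A| < 1 by rewrite !normM_lt1.
pose g : {poly R} := \prod_(i < l) (1 - (a * b * q ^+ i) *: 'X) *
  \prod_(i < n - l) (1 - (A * q ^+ l * q ^+ i) *: 'X).
have sg : (size g <= n.+1)%N.
  rewrite -[X in (_ <= X.+1)%N](subnKC (ln : (l <= n)%N)); apply: leq_sizeM.
    exact: (size_prod_linear (fun i => a * b * q ^+ i)).
  exact: (size_prod_linear (fun i => A * q ^+ l * q ^+ i)).
have gE y : g.[y] = qpoch q (a * b * y) l * qpoch q (A * q ^+ l * y) (n - l).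
  rewrite /g hornerM !horner_prod /qpoch; congr (_ * _); apply: eq_bigr => i _.
    by rewrite !hornerE; ring.
  by rewrite !hornerE; ring.
have := sum_qweight_horner q0 q1 sg => H.
transitivity ((qpoch q A n)^-1 * \sum_(k < n.+2) qweight q n.+1 k * g.[q ^+ k]); last first.
  by rewrite H mulr0.
rewrite mulr_sumr; apply: eq_bigr => k _; rewrite gE /awC pow_pred -/A.
have A0 m : qpoch q A m != 0 by rewrite qpoch_small_neq0.
have E : qpoch q (A * q ^+ n) k = qpoch q A (k + l) * qpoch q (A * q ^+ l * q ^+ k) (n - l) / qpoch q A n.
  apply: (mulIf (A0 n)); rewrite divfK // mulrC -qpochD.
  have -> : A * q ^+ l * q ^+ k = A * q ^+ (k + l) by rewrite exprD; ring.
  rewrite -qpochD; congr (qpoch q A _).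
  by rewrite -addnA subnKC // addnC.
rewrite E; field.
by rewrite !A0.
Qed.

Lemma size_sub_lead n p r : (size p <= n.+1)%N -> (size r <= n.+1)%N -> r`_n != 0 ->
  (size (p - (p`_n / r`_n) *: r)%R <= n)%N.
Proof.
move=> sp sr r0; apply/leq_sizeP => j; rewrite leq_eqVlt => /orP[/eqP <-|nj].
  by rewrite coefB coefZ divfK // subrr.
by rewrite coefB coefZ (nth_default _ (leq_trans sp nj)) (nth_default _ (leq_trans sr nj)) mulr0 subrr.
Qed.

(** As [b != 0], the polynomials [Phi b m] with [m < n] span those of degree less
    than [n]. *)
Lemma awL_AWP_size_le n a b c d p : (size p <= n)%N -> b != 0 ->
  a != 0 -> `|a| < 1 -> `|b| < 1 -> `|c| < 1 -> `|d| < 1 ->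
  L a b c d (AWP n a b c d * p) = 0.
Proof.
move=> + b0 a0 a1 b1 c1 d1.
have : (n <= n)%N by []; move: {1 3}n => m; elim: m p => [|m IH] p mn sp.
  by move: sp; rewrite leqn0 size_poly_eq0 => /eqP ->; rewrite mulr0 awL0.
pose e := p`_m / (Phi b m)`_m.
have f0 : (Phi b m)`_m != 0.
  rewrite coef_Phi mulf_neq0 ?expf_neq0 //; apply/prodf_neq0 => i _.
  by rewrite oppr_eq0 mulf_neq0 // expf_neq0.
have sr : (size (p - e *: Phi b m)%R <= m)%N by apply: size_sub_lead => //; exact: size_Phi.
rewrite -[p](subrK (e *: Phi b m)) mulrDr awLD // IH ?(ltnW mn) // -scalerAr awLZ //.
by rewrite awL_AWP_Phi_lt // mulr0 addr0.
Qed.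

Lemma awL_AWP_ortho m n a b c d : m != n -> b != 0 ->
  a != 0 -> `|a| < 1 -> `|b| < 1 -> `|c| < 1 -> `|d| < 1 ->
  L a b c d (AWP m a b c d * AWP n a b c d) = 0.
Proof.
rewrite neq_ltn => /orP[mn|nm] b0 a0 a1 b1 c1 d1.
  by rewrite mulrC awL_AWP_size_le // (leq_trans (size_AWP _ _ _ _ _)).
by rewrite awL_AWP_size_le // (leq_trans (size_AWP _ _ _ _ _)).
Qed.

(** For [l = n] the quotient of [awL_AWP_Phi_lt] has exactly one factor in the
    denominator, [1 - A q^(n - 1) q^k], so that [sum_qweight_pole] applies with
    [j = n]. *)
Lemma awL_AWP_Phi_diag n a b c d : a != 0 -> `|a| < 1 -> `|b| < 1 -> `|c| < 1 -> `|d| < 1 ->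
  qpoch q (a * b * c * d) (n + n) * L a b c d (AWP n a b c d * Phi b n) =
  \prod_(i < n) (- (b * q ^+ i)) *
  (qpoch q q n * qpoch q (a * b) n * qpoch q (a * c) n * qpoch q (a * d) n *
   qpoch q (b * c) n * qpoch q (b * d) n * qpoch q (c * d) n) * L a b c d 1.
Proof.
move=> a0 a1 b1 c1 d1.
case: n => [|n].
  by rewrite AWP0 /Phi !big_ord0 !qpoch0 !mulr1 !mul1r.
rewrite awL_AWP_Phi //; set N := n.+1.
pose A := a * b * c * d; have A1 : `|A| < 1 by rewrite !normM_lt1.
have CE : awC N a b c d = A * q ^+ n by rewrite /awC pow_pred.
have C1 : `|A * q ^+ n| < 1 by rewrite normMX_lt1.
have S : \sum_(k < N.+1) qweight q N k * (qpoch q (a * b * q ^+ k) N *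
    (qpoch q (awC N a b c d) k / qpoch q A (k + N))) =
    (1 - A * q ^+ n) / qpoch q A N * (qpoch q q N / qpoch q (A * q ^+ n) N.+1 *
    \prod_(i < N) (A * q ^+ n - a * b * q ^+ i)).
  rewrite -(@sum_qweight_pole _ _ q0 q1 N N (a * b) (A * q ^+ n) (leqnn N)); last by move=> k; apply: one_sub_neq0.
  rewrite mulr_sumr; apply: eq_bigr => k _; rewrite subnn expr0 mulr1 CE.
  have A0 m : qpoch q A m != 0 by rewrite qpoch_small_neq0.
  have Ck := one_sub_neq0 hq k C1.
  have E : qpoch q (A * q ^+ n) k = (1 - A * q ^+ n) * qpoch q (A * q ^+ N) k / (1 - A * q ^+ n * q ^+ k).
    by rewrite /N exprSr mulrA -qpochSl qpochSr mulfK.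
  rewrite E addnC qpochD.
  have ANk : qpoch q (A * q ^+ N) k != 0 by rewrite qpoch_small_neq0 // normMX_lt1.
  field; by rewrite !A0 ANk Ck.
have P : \prod_(i < N) (A * q ^+ n - a * b * q ^+ i) =
    a ^+ N * \prod_(i < N) (- (b * q ^+ i)) * qpoch q (c * d) N.
  have -> : a ^+ N = \prod_(i < N) a by rewrite prodr_const card_ord.
  rewrite /qpoch (reindex_inj rev_ord_inj (P := predT) (F := fun i : 'I_N => 1 - c * d * q ^+ i)).
  rewrite -!big_split /=; apply: eq_bigr => i _.
  rewrite subSS -{1}(subnKC (ltnSE (ltn_ord i))) exprD /A; ring.
rewrite -/A S P qpochD.
have A0 := qpoch_small_neq0 hq N A1.
have E : qpoch q (A * q ^+ n) N.+1 = (1 - A * q ^+ n) * qpoch q (A * q ^+ N) N.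
  by rewrite qpochSl /N exprSr mulrA.
have ANk : qpoch q (A * q ^+ N) N != 0 by rewrite qpoch_small_neq0 // normMX_lt1.
have c0 : 1 - A * q ^+ n != 0 by have := one_sub_neq0 hq 0 C1; rewrite expr0 mulr1.
rewrite E; have aN0 : a ^+ N != 0 by rewrite expf_neq0.
field; by rewrite ?A0 ?ANk ?c0 ?aN0.
Qed.

(** One factor may be replaced by the multiple of [Phi b n] with the same leading
    coefficient. *)
Lemma awL_AWP_norm n a b c d : b != 0 ->
  a != 0 -> `|a| < 1 -> `|b| < 1 -> `|c| < 1 -> `|d| < 1 ->
  qpoch q (a * b * c * d) (n + n) * L a b c d (AWP n a b c d * AWP n a b c d) =
  qpoch q (awC n a b c d) n *
  (qpoch q q n * qpoch q (a * b) n * qpoch q (a * c) n * qpoch q (a * d) n *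
   qpoch q (b * c) n * qpoch q (b * d) n * qpoch q (c * d) n) * L a b c d 1.
Proof.
move=> b0 a0 a1 b1 c1 d1; set P := AWP n a b c d.
have B0 : \prod_(i < n) (- (b * q ^+ i)) != 0.
  by apply/prodf_neq0 => i _; rewrite oppr_eq0 mulf_neq0 // expf_neq0.
have f0 : (Phi b n)`_n != 0 by rewrite coef_Phi mulf_neq0 ?expf_neq0.
pose e := P`_n / (Phi b n)`_n.
have sr : (size (P - e *: Phi b n)%R <= n)%N.
  by apply: size_sub_lead => //; [exact: size_AWP|exact: size_Phi].
have -> : L a b c d (P * P) = e * L a b c d (P * Phi b n).
  rewrite -{2}[P](subrK (e *: Phi b n)) mulrDr awLD // awL_AWP_size_le // add0r.
  by rewrite -scalerAr awLZ.
rewrite mulrCA awL_AWP_Phi_diag // /e coef_Phi coef_AWP // -/(awC n a b c d).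
have two : 2 ^+ n != 0 :> R by rewrite expf_neq0.
by move: (\prod_(i < n) _) B0 (2 ^+ n) two => x x0 y y0; field; rewrite x0 y0.
Qed.

End orthogonality.

(** * Numerators with an indeterminate parameter *)

Section generic_numerator.
Implicit Types K : comNzRingType.

(** The symbol [qpoch] over a commutative ring, where a parameter may be an
    indeterminate. *)
Definition qp K (q x : K) n : K := \prod_(i < n) (1 - x * q ^+ i).

(** The terms of the Askey-Wilson sum multiplied by [(ab, ac, ad; q)_n], which
    clears their denominators since [(ab)_n / (ab)_k = (ab q^k)_(n - k)]. The
    argument [C] stands for [q^(n - 1)], which for [n = 0] is a negative power. *)
Definition aw_term K (q C a b c d x : K) n k : K :=
  qp q (a * b * q ^+ k) (n - k) * qp q (a * c * q ^+ k) (n - k) *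
  qp q (a * d * q ^+ k) (n - k) * qp q (a * b * c * d * C) k *
  \prod_(i < k) (1 - 2 * (a * q ^+ i) * x + (a * q ^+ i) ^+ 2).

Definition aw_num K (q C : K) (w : nat -> K) (a b c d x : K) n : K :=
  \sum_(k < n.+1) w k * aw_term q C a b c d x n k.

Variables (K K' : comNzRingType) (f : {rmorphism K -> K'}).

Lemma rmorph_qp q x n : f (qp q x n) = qp (f q) (f x) n.
Proof.
rewrite rmorph_prod; apply: eq_bigr => i _.
by rewrite rmorphB rmorph1 rmorphM rmorphXn.
Qed.

Lemma rmorph_aw_term q C a b c d x n k : f (aw_term q C a b c d x n k) =
  aw_term (f q) (f C) (f a) (f b) (f c) (f d) (f x) n k.
Proof.
rewrite /aw_term !rmorphM !rmorph_qp !rmorphM !rmorphXn rmorph_prod; congr (_ * _).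
apply: eq_bigr => i _.
by rewrite rmorphD rmorphB rmorph1 !rmorphXn !rmorphM rmorph_nat !rmorphXn.
Qed.

Lemma rmorph_aw_num q C w a b c d x n : f (aw_num q C w a b c d x n) =
  aw_num (f q) (f C) (f \o w) (f a) (f b) (f c) (f d) (f x) n.
Proof.
rewrite rmorph_sum; apply: eq_bigr => k _.
by rewrite rmorphM rmorph_aw_term.
Qed.

End generic_numerator.

Section regularity.
Variables (R : realType) (q : R).
Hypothesis hq : 0 < q < 1.
Local Notation K := {poly R}.

Let q_gt0 : 0 < q. Proof. by case/andP: hq. Qed.
Let q_lt1 : q < 1. Proof. by case/andP: hq. Qed.
Let q0 : q != 0. Proof. exact: lt0r_neq0. Qed.
Let q1 := one_sub_qX_neq0 hq.
Let Q : K := q%:P.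

Variable n : nat.

Definition qreg_coef (e : nat -> K) m :=
  exists G : {poly K}, (size G <= m.+1)%N /\ forall k, (k <= n)%N -> e k = G.[Q ^+ k].

(** The condition on [f] under which [sum_qweight_qreg] removes the coefficients of
    order less than [n]. The bound on the degree by the order of the coefficient
    makes it multiplicative. *)
Definition qreg (f : nat -> {poly K}) := forall m, qreg_coef (fun k => (f k)`_m) m.

(** The operator [G(y) -> G(q y) - G(y)] multiplies [y^i] by [q^i - 1], so it is
    invertible on polynomials without constant term: regularity of the increments
    in [k] implies that of the function. *)
Lemma qreg_antidiff (e : nat -> K) (H : {poly K}) m : (size H <= m.+1)%N -> H`_0 = 0 ->
  (forall k, (k < n)%N -> e k.+1 - e k = H.[Q ^+ k]) -> qreg_coef e m.
Proof.
move=> sH H0 he; pose G : {poly K} := \poly_(i < m.+1) ((q ^+ i - 1)^-1 *: H`_i).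
have GE y : G.[Q * y] - G.[y] = H.[y].
  rewrite (horner_coef_wide _ sH) !(horner_coef_wide _ (size_poly _ _)) -sumrB.
  apply: eq_bigr => i _; rewrite coef_poly ltn_ord exprMn.
  case: i => [[|i] im] /=; first by rewrite H0 scaler0 !mul0r subrr.
  have i0 : q ^+ i.+1 - 1 != 0 by rewrite -opprB oppr_eq0.
  have E : ((q ^+ i.+1 - 1)^-1)%:P * (Q ^+ i.+1 - 1) = 1.
    by rewrite -rmorphXn -polyC1 -polyCB -polyCM mulVf.
  rewrite -[RHS]mul1r -E -mul_polyC; ring.
exists (G + (e 0%N - G.[1])%:P); split.
  rewrite (leq_trans (size_polyD _ _)) // geq_max size_poly /=.
  by rewrite (leq_trans (size_polyC_leq1 _)).
elim=> [|k IH] kn; first by rewrite hornerD hornerC expr0; ring.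
rewrite -[e k.+1](subrK (e k)) he // IH ?(ltnW kn) // -GE !hornerD !hornerC exprS; ring.
Qed.

Lemma qregM f g : qreg f -> qreg g -> qreg (fun k => f k * g k).
Proof.
move=> /choice[F hF] /choice[G hG] m.
exists (\sum_(i < m.+1) F i * G (m - i)%N); split.
  rewrite (leq_trans (size_sum _ _ _)) //; apply/bigmax_leqP => i _.
  rewrite -[X in (_ <= X.+1)%N](subnKC (ltnSE (ltn_ord i))).
  by apply: leq_sizeM; [case: (hF i)|case: (hG (m - i)%N)].
move=> k kn; rewrite coefM horner_sum; apply: eq_bigr => i _.
by rewrite hornerM; case: (hF i) => _ <- //; case: (hG (m - i)%N) => _ <-.
Qed.

Let coef_mul_quadY (p : {poly K}) (u v : K) m :
  (p * (1 - u%:P * 'X + v%:P * 'X^2))`_m =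
  p`_m - (if m is m'.+1 then u * p`_m' else 0) + (if m is m'.+2 then v * p`_m' else 0).
Proof.
have -> : p * (1 - u%:P * 'X + v%:P * 'X^2) = p - u%:P * p * 'X + v%:P * p * 'X^2 by ring.
by rewrite coefD coefB coefMX coefMXn !coefCM; case: m => [|[|m]] //=; rewrite subn2.
Qed.

(** Passing from [k] to [k + 1] multiplies the product by a quadratic factor in
    [Y], so the increment of the coefficient of order [m + 2] involves those of
    order [m + 1] and [m]; hence the induction on pairs of consecutive orders. *)
Lemma qreg_prod_lt (u v : K) :
  qreg (fun k => \prod_(i < k) (1 - (u * Q ^+ i)%:P * 'X + (v * Q ^+ i ^+ 2)%:P * 'X^2)).
Proof.
set f := fun k => _.
have step k m : (f k.+1)`_m = (f k)`_m - (if m is m'.+1 then u * Q ^+ k * (f k)`_m' else 0)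
   + (if m is m'.+2 then v * Q ^+ k ^+ 2 * (f k)`_m' else 0).
  by rewrite /f big_ord_recr /= coef_mul_quadY.
suff H m : qreg_coef (fun k => (f k)`_m) m /\ qreg_coef (fun k => (f k)`_m.+1) m.+1.
  by move=> m; case: (H m).
elim: m => [|m [IH0 IH1]].
  have B0 : qreg_coef (fun k => (f k)`_0) 0.
    apply: (@qreg_antidiff _ 0) => [||k kn]; rewrite ?size_poly0 ?coef0 //.
    by rewrite step subr0 addr0 subrr horner0.
  split=> //; have [G [sG hG]] := B0.
  apply: (@qreg_antidiff _ (- u%:P * 'X * G)).
  - rewrite -mulrA -polyCN mul_polyC (leq_trans (size_scale_leq _ _)) //.
    by rewrite -[X in (_ <= X)%N]/((1 + 0).+1); apply: leq_sizeM; rewrite ?size_polyX.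
  - by rewrite -mulrA -polyCN mul_polyC coefZ coefXM mulr0.
  - move=> k kn; rewrite step addr0 hG ?(ltnW kn) // !(hornerN, hornerM, hornerC, hornerX); ring.
split=> //; have [G0 [sG0 hG0]] := IH0; have [G1 [sG1 hG1]] := IH1.
apply: (@qreg_antidiff _ (- u%:P * ('X * G1) + v%:P * ('X^2 * G0))).
- rewrite (leq_trans (size_polyD _ _)) // geq_max -polyCN !mul_polyC.
  rewrite !(leq_trans (size_scale_leq _ _)) //.
    by rewrite -[X in (_ <= X)%N]/((2 + m).+1); apply: leq_sizeM; rewrite ?size_polyXn.
  by rewrite -[X in (_ <= X)%N]/((1 + m.+1).+1); apply: leq_sizeM; rewrite ?size_polyX.
- by rewrite coefD -polyCN !mul_polyC !coefZ coefXM coefXnM !mulr0 addr0.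
- move=> k kn; rewrite step hG0 ?(ltnW kn) // hG1 ?(ltnW kn) // !(hornerD, hornerN, hornerM, hornerC, hornerX, hornerXn); ring.
Qed.

(** Here passing from [k + 1] to [k] multiplies by a linear factor in [Y]. *)
Lemma qreg_prod_ge (u : K) :
  qreg (fun k => \prod_(i < n - k) (1 - (u * Q ^+ (k + i))%:P * 'X)).
Proof.
set f := fun k => _.
have step k m : (k < n)%N -> (f k)`_m =
    (f k.+1)`_m - (if m is m'.+1 then u * Q ^+ k * (f k.+1)`_m' else 0).
  move=> kn; have -> : f k = f k.+1 * (1 - (u * Q ^+ k)%:P * 'X).
    rewrite /f -(subnSK kn) big_ord_recl addn0 mulrC; congr (_ * _).
    by apply: eq_bigr => i _; rewrite /= /bump /= addnS -addSn.
  have := coef_mul_quadY (f k.+1) (u * Q ^+ k) 0 m.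
  rewrite polyC0 mul0r addr0 => ->.
  by case: m => [|[|m]]; rewrite ?mul0r addr0.
elim=> [|m [G [sG hG]]].
  apply: (@qreg_antidiff _ 0) => [||k kn]; rewrite ?size_poly0 ?coef0 //.
  by rewrite (step k) // subr0 subrr horner0.
pose G' : {poly K} := \poly_(i < m.+1) (G`_i * Q ^+ i).
have GE y : G'.[y] = G.[Q * y].
  rewrite horner_poly (horner_coef_wide _ sG); apply: eq_bigr => i _.
  by rewrite exprMn mulrA.
apply: (@qreg_antidiff _ (u%:P * ('X * G'))).
- rewrite mul_polyC (leq_trans (size_scale_leq _ _)) //.
  by rewrite -[X in (_ <= X)%N]/((1 + m).+1); apply: leq_sizeM; rewrite ?size_polyX ?size_poly.
- by rewrite mul_polyC coefZ coefXM mulr0.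
- move=> k kn; rewrite (step k m.+1) // hG // !(hornerM, hornerC, hornerX) GE exprS; ring.
Qed.

Lemma sum_qweight_qreg (f : nat -> {poly K}) m : qreg f -> (m < n)%N ->
  (\sum_(k < n.+1) (qweight q n k)%:P%:P * f k)`_m = 0.
Proof.
move=> hf mn; have [G [sG hG]] := hf m.
rewrite coef_sum; under eq_bigr => k _ do rewrite coefCM hG ?(ltnSE (ltn_ord k)) //
  (horner_coef_wide _ sG) mulr_sumr.
rewrite exchange_big /=; apply: big1 => i _.
have si : (size ('X^i : {poly R}) <= n)%N by rewrite size_polyXn (leq_ltn_trans _ mn) // ltnSE.
have := sum_qweight_horner q0 q1 si => E.
transitivity (G`_i * (\sum_(k < n.+1) qweight q n k * ('X^i).[q ^+ k])%:P); last first.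
  by rewrite E mulr0.
rewrite rmorph_sum mulr_sumr; apply: eq_bigr => k _.
have E2 : (q ^+ k ^+ i)%:P = Q ^+ k ^+ i by rewrite !rmorphXn.
by rewrite hornerXn /= (polyCM (qweight q n k)) E2; ring.
Qed.

End regularity.

(** * Parameters equal to zero *)

Section parameters.
Variables (R : realType) (q : R).
Hypothesis hq : 0 < q < 1.
Implicit Types (a b c d e x t : R).
Local Notation K := {poly R}.
Local Notation L := (awL q).
Local Notation Y := ('X : {poly K}).

Let q_gt0 : 0 < q. Proof. by case/andP: hq. Qed.
Let q_lt1 : q < 1. Proof. by case/andP: hq. Qed.
Let q0 : q != 0. Proof. exact: lt0r_neq0. Qed.
Let q1 := one_sub_qX_neq0 hq.
Let cC (n : nat) : R := q ^ (n%:Z - 1).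

Lemma qp_polyC x n : qp q%:P x%:P n = (qpoch q x n)%:P :> K.
Proof. exact: esym (rmorph_qp (@polyC R : {rmorphism R -> K}) q x n). Qed.

Definition num_at n a b c d : K :=
  aw_num q%:P (cC n)%:P (fun k => (qweight q n k)%:P) a%:P b%:P c%:P d%:P 'X n.

Lemma AWP_num n a b c d : `|a| < 1 -> `|b| < 1 -> `|c| < 1 -> `|d| < 1 ->
  AWP q n a b c d = a ^- n *: num_at n a b c d.
Proof.
move=> a1 b1 c1 d1; rewrite /AWP /num_at /aw_num [_ / _]mulrC -scalerA; congr (_ *: _).
rewrite scaler_sumr; apply: eq_bigr => k _; rewrite scalerA.
have kn : (k <= n)%N by rewrite ltnSE.
have -> : aw_term q%:P (cC n)%:P a%:P b%:P c%:P d%:P 'X n k =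
  (qpoch q (a * b * q ^+ k) (n - k) * qpoch q (a * c * q ^+ k) (n - k) *
   qpoch q (a * d * q ^+ k) (n - k) * qpoch q (a * b * c * d * cC n) k)%:P * Phi q a k.
  rewrite /aw_term !polyCM -!qp_polyC !(polyCM, polyC_exp); congr (_ * _).
  rewrite /Phi; apply: eq_bigr => i _; rewrite /quad -mul_polyC.
  by rewrite !(polyCM, polyC_exp) -[2%:P]/(2%:R%:P) polyC_natr.
rewrite -mul_polyC !mulrA -!polyCM; congr (_%:P * _).
rewrite /qweight /qpochs !big_cons !big_nil !mulr1.
have ab0 := qpoch_small_neq0 hq k (normM_lt1 a1 b1).
have ac0 := qpoch_small_neq0 hq k (normM_lt1 a1 c1).
have ad0 := qpoch_small_neq0 hq k (normM_lt1 a1 d1).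
have qq0 := qq_neq0 q1 k.
have S e : qpoch q e n = qpoch q e k * qpoch q (e * q ^+ k) (n - k).
  by rewrite -qpochD subnKC.
rewrite !S /cC.
by field; rewrite ab0 ac0 ad0 qq0.
Qed.

Lemma horner_AWP n a b c d x : (AWP q n a b c d).[x] =
  qpochs q [:: a * b; a * c; a * d] n / a ^+ n *
  \sum_(k < n.+1) (qpochs q [:: q ^- n; a * b * c * d * q ^ (n%:Z - 1)] k /
     qpochs q [:: a * b; a * c; a * d; q] k * q ^+ k) * hfin q x a k.
Proof.
rewrite /AWP hornerZ horner_sum; congr (_ * _); apply: eq_bigr => k _.
by rewrite hornerZ horner_Phi.
Qed.

Lemma aw_sum_AWP n a b c d t :
  aw_sum q%:C%C n a%:C%C b%:C%C c%:C%C d%:C%C (expi t) = ((AWP q n a b c d).[cos t])%:C%C.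
Proof.
have qpoch_rc x k : qpoch q%:C%C x%:C%C k = (qpoch q x k)%:C%C.
  exact: esym (rmorph_qpoch (real_complex R) q x k).
have qpochs_rc s l : qpochs q%:C%C [seq x%:C%C | x <- s] l = (qpochs q s l)%:C%C.
  by rewrite /qpochs big_map rmorph_prod; apply: eq_bigr => x _; exact: qpoch_rc.
rewrite horner_AWP /aw_sum rmorphM fmorph_div rmorphXn rmorph_sum /=.
rewrite -!qpochs_rc /= !rmorphM; congr (_ * _); apply: eq_bigr => k _.
rewrite !rmorphM fmorphV rmorphXn /= -!qpochs_rc /= /hfin -qpoch_expi.
rewrite !rmorphM fmorphV rmorphXn fmorphXz /= /qpochs !big_cons !big_nil !mulr1.
by rewrite -!mulrA; ring.
Qed.

Lemma aw_nz_AWP n a b c d x : `|x| <= 1 -> aw_nz q n a b c d x = (AWP q n a b c d).[x].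
Proof.
by rewrite ler_norml => x1; rewrite /aw_nz aw_sum_AWP /= acosK // in_itv.
Qed.

Lemma awL_polyC a b c d e p : `|a| < 1 -> `|b| < 1 -> `|c| < 1 -> `|d| < 1 ->
  L a b c d (e%:P * p) = e * L a b c d p.
Proof. by move=> a1 b1 c1 d1; rewrite mul_polyC awLZ. Qed.

Let nq : `|q| < 1. Proof. by rewrite gtr0_norm. Qed.

(** Along [a = q * q^N] both the weight and the polynomial [T.[a]] converge, the
    latter coefficient by coefficient in [a]. *)
Lemma awL_param0 (T : {poly K}) b c d : `|b| < 1 -> `|c| < 1 -> `|d| < 1 ->
  (forall a, a != 0 -> `|a| < 1 -> L a b c d T.[a%:P] = 0) -> L 0 b c d T.[0] = 0.
Proof.
move=> b1 c1 d1 hT; have n0 : `|0 : R| < 1 by rewrite normr0.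
have E a : `|a| < 1 -> L a b c d T.[a%:P] =
    \sum_(i < size T) a ^+ i * L a b c d T`_i.
  move=> a1; rewrite horner_coef (@awL_sum _ _ hq _ _ _ _ _ (fun i => T`_i * a%:P ^+ i)) //.
  by apply: eq_bigr => i _; rewrite -rmorphXn mulrC awL_polyC.
have C : \sum_(i < size T) (q * q ^+ N) ^+ i * L (q * q ^+ N) b c d T`_i @[N --> \oo] -->
    \sum_(i < size T) 0 ^+ i * L 0 b c d T`_i.
  elim: (size T) => [|n IH].
    by rewrite big_ord0; under eq_fun do rewrite big_ord0; exact: cvg_cst.
  rewrite big_ord_recr /=; under eq_fun do rewrite big_ord_recr /=.
  apply: cvgD => //; apply: cvgM; last exact: awL_cvg0.
  have z : q * q ^+ N @[N --> \oo] --> (0 : R).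
    by rewrite -(mulr0 q); apply: cvgMl_tmp; exact: cvg_expr.
  elim: n {IH} => [|n IH]; first by under eq_fun do rewrite expr0; exact: cvg_cst.
  by rewrite exprS; under eq_fun do rewrite exprS; exact: cvgM.
rewrite -[X in T.[X]]polyC0 E //; apply/esym; apply: (cvg_unique _ _ C) => //.
rewrite (_ : (fun N => _) = fun=> 0); first exact: cvg_cst.
apply/funext => N; rewrite -E ?normMX_lt1 // hT ?normMX_lt1 //.
by rewrite mulf_neq0 // expf_neq0.
Qed.

(** Orthogonality as the vanishing of one polynomial expression in the parameters,
    over any ring, so that [awL_param0] applies with one of them indeterminate. *)
Definition ortho_defect (A : comNzRingType) (Q C a b c d P P' : A) n (z : bool) : A :=
  qp Q (a * b * c * d) (n + n) * (P * P') -
  z%:R * (qp Q (a * b * c * d * C) n * (qp Q Q n * qp Q (a * b) n * qp Q (a * c) n *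
    qp Q (a * d) n * qp Q (b * c) n * qp Q (b * d) n * qp Q (c * d) n)).

Lemma rmorph_ortho_defect (A B : comNzRingType) (f : {rmorphism A -> B}) (Q C a b c d P P' : A) n z :
  f (ortho_defect Q C a b c d P P' n z) =
  ortho_defect (f Q) (f C) (f a) (f b) (f c) (f d) (f P) (f P') n z.
Proof.
by rewrite /ortho_defect rmorphB !rmorphM !rmorph_qp !rmorphM rmorph_nat.
Qed.

Definition defect a b c d P P' n z : K :=
  ortho_defect q%:P (cC n)%:P a%:P b%:P c%:P d%:P P P' n z.

Lemma awL_defect a b c d P P' n z : `|a| < 1 -> `|b| < 1 -> `|c| < 1 -> `|d| < 1 ->
  L a b c d (defect a b c d P P' n z) =
  qpoch q (a * b * c * d) (n + n) * L a b c d (P * P') -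
  z%:R * (qpoch q (awC q n a b c d) n * (qpoch q q n * qpoch q (a * b) n * qpoch q (a * c) n *
    qpoch q (a * d) n * qpoch q (b * c) n * qpoch q (b * d) n * qpoch q (c * d) n)) * L a b c d 1.
Proof.
move=> a1 b1 c1 d1; rewrite /defect /ortho_defect -!polyCM !qp_polyC -!polyCM awLB //.
rewrite awL_polyC // -polyC_natr -!polyCM; congr (_ - _).
by rewrite -[X in L _ _ _ _ X]mulr1 awL_polyC.
Qed.

Lemma awL_defect_nz m n a b c d : a != 0 -> b != 0 ->
  `|a| < 1 -> `|b| < 1 -> `|c| < 1 -> `|d| < 1 ->
  L a b c d (defect a b c d (AWP q m a b c d) (AWP q n a b c d) n (m == n)) = 0.
Proof.
move=> a0 b0 a1 b1 c1 d1; rewrite awL_defect //.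
have [->|mn] := eqVneq m n; last by rewrite awL_AWP_ortho // mulr0 !mul0r subr0.
by rewrite awL_AWP_norm // mul1r subrr.
Qed.

Let num_b n a c d : {poly K} := (a ^- n)%:P%:P *
  aw_num q%:P%:P (cC n)%:P%:P (fun k => (qweight q n k)%:P%:P)
    a%:P%:P Y c%:P%:P d%:P%:P ('X : K)%:P n.

Let horner_num_b n a b c d : `|a| < 1 -> `|b| < 1 -> `|c| < 1 -> `|d| < 1 ->
  (num_b n a c d).[b%:P] = AWP q n a b c d.
Proof.
move=> a1 b1 c1 d1; rewrite AWP_num // -mul_polyC /num_b -horner_evalE rmorphM.
rewrite rmorph_aw_num /= !horner_evalE !hornerC hornerX; congr (_ * _).
by rewrite /num_at; apply: eq_bigr => k _; rewrite /= horner_evalE hornerC.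
Qed.

(** For fixed [a != 0] the polynomial depends polynomially on [b], so the case
    [b = 0] is a limit. *)
Lemma awL_defect_a m n a b c d : a != 0 ->
  `|a| < 1 -> `|b| < 1 -> `|c| < 1 -> `|d| < 1 ->
  L a b c d (defect a b c d (AWP q m a b c d) (AWP q n a b c d) n (m == n)) = 0.
Proof.
move=> a0 a1 b1 c1 d1; have [b0|b0] := eqVneq b 0; last exact: awL_defect_nz.
pose T : {poly K} := ortho_defect q%:P%:P (cC n)%:P%:P a%:P%:P Y c%:P%:P d%:P%:P
  (num_b m a c d) (num_b n a c d) n (m == n).
have TE e : `|e| < 1 ->
    T.[e%:P] = defect a e c d (AWP q m a e c d) (AWP q n a e c d) n (m == n).
  move=> e1; rewrite /T -horner_evalE rmorph_ortho_defect /= !horner_evalE !hornerC hornerX.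
  by rewrite !horner_num_b.
have n0 : `|0 : R| < 1 by rewrite normr0.
rewrite b0 -TE // awL_swap12 polyC0; apply: awL_param0 => // e e0 e1.
by rewrite TE // awL_swap12; exact: awL_defect_nz.
Qed.

Let num_a n b c d : {poly K} :=
  aw_num q%:P%:P (cC n)%:P%:P (fun k => (qweight q n k)%:P%:P)
    Y b%:P%:P c%:P%:P d%:P%:P ('X : K)%:P n.

Let horner_num_a n a b c d : (num_a n b c d).[a%:P] = num_at n a b c d.
Proof.
rewrite /num_a -horner_evalE rmorph_aw_num /= !horner_evalE !hornerC hornerX.
by rewrite /num_at; apply: eq_bigr => k _; rewrite /= horner_evalE hornerC.
Qed.

Let qp_ge n e k : qp q%:P%:P (Y * e%:P%:P * q%:P%:P ^+ k) (n - k) =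
  \prod_(i < n - k) (1 - (e%:P * q%:P ^+ (k + i))%:P * Y).
Proof.
by apply: eq_bigr => i _; rewrite polyCM polyC_exp exprD; ring.
Qed.

(** Divisibility of the numerator by [a^n]: each factor of its terms, as a function
    of [k], is one of the two kinds of regular products. *)
Let num_a_low n b c d m : (m < n)%N -> (num_a n b c d)`_m = 0.
Proof.
apply: (@sum_qweight_qreg _ _ hq n
  (fun k => aw_term q%:P%:P (cC n)%:P%:P Y b%:P%:P c%:P%:P d%:P%:P ('X : K)%:P n k)).
rewrite /aw_term; apply: qregM; first apply: qregM; first apply: qregM; first apply: qregM.
- rewrite (_ : (fun k => _) = fun k => \prod_(i < n - k) (1 - (b%:P * q%:P ^+ (k + i))%:P * Y)).
    exact: qreg_prod_ge.
  by apply/funext => k; exact: qp_ge.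
- rewrite (_ : (fun k => _) = fun k => \prod_(i < n - k) (1 - (c%:P * q%:P ^+ (k + i))%:P * Y)).
    exact: qreg_prod_ge.
  by apply/funext => k; exact: qp_ge.
- rewrite (_ : (fun k => _) = fun k => \prod_(i < n - k) (1 - (d%:P * q%:P ^+ (k + i))%:P * Y)).
    exact: qreg_prod_ge.
  by apply/funext => k; exact: qp_ge.
- have := qreg_prod_lt hq n (b%:P * c%:P * d%:P * (cC n)%:P) 0.
  congr qreg; apply/funext => k; apply: eq_bigr => i _.
  by rewrite !polyCM polyC_exp polyC0; ring.
- have := qreg_prod_lt hq n (2 * 'X) 1.
  congr qreg; apply/funext => k; apply: eq_bigr => i _.
  by rewrite !polyCM !polyC_exp polyC_natr; ring.
Qed.

(** The Askey-Wilson polynomial for every value of [a], zero included: the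
    numerator is divided by [a^n] as a polynomial in [a]. *)
Definition awpol n a b c d : K := (drop_poly n (num_a n b c d)).[a%:P].

Lemma awpol_AWP n a b c d : a != 0 -> `|a| < 1 -> `|b| < 1 -> `|c| < 1 -> `|d| < 1 ->
  awpol n a b c d = AWP q n a b c d.
Proof.
move=> a0 a1 b1 c1 d1; rewrite AWP_num // -horner_num_a -(poly_take_drop n (num_a n b c d)).
have -> : take_poly n (num_a n b c d) = 0.
  apply/polyP => i; rewrite coef_take_poly coef0; case: ltnP => // im; exact: num_a_low.
rewrite add0r hornerM hornerXn -rmorphXn -mul_polyC mulrC -mulrA -polyCM mulfV ?mulr1 //.
by rewrite expf_neq0.
Qed.

Lemma awL_awpol m n a b c d : `|a| < 1 -> `|b| < 1 -> `|c| < 1 -> `|d| < 1 ->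
  L a b c d (defect a b c d (awpol m a b c d) (awpol n a b c d) n (m == n)) = 0.
Proof.
move=> a1 b1 c1 d1.
pose T : {poly K} := ortho_defect q%:P%:P (cC n)%:P%:P Y b%:P%:P c%:P%:P d%:P%:P
  (drop_poly m (num_a m b c d)) (drop_poly n (num_a n b c d)) n (m == n).
have TE e : T.[e%:P] = defect e b c d (awpol m e b c d) (awpol n e b c d) n (m == n).
  by rewrite /T -horner_evalE rmorph_ortho_defect /= !horner_evalE !hornerC hornerX.
rewrite -TE; have [->|a0] := eqVneq a 0; last first.
  by rewrite TE !awpol_AWP //; exact: awL_defect_a.
rewrite polyC0; apply: awL_param0 => // e e0 e1.
by rewrite TE !awpol_AWP //; exact: awL_defect_a.
Qed.

(** The limit in the definition at [a = 0] is that of a polynomial in [a]. *)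
Lemma aw_awpol n a b c d x : `|a| < 1 -> `|b| < 1 -> `|c| < 1 -> `|d| < 1 -> `|x| <= 1 ->
  aw q n a b c d x = (awpol n a b c d).[x].
Proof.
move=> a1 b1 c1 d1 x1; rewrite /aw; case: eqVneq => [a0|a0]; last first.
  by rewrite aw_nz_AWP // awpol_AWP.
pose S := drop_poly n (num_a n b c d).
have E e : (S.[e%:P]).[x] = (map_poly (horner_eval x) S).[e].
  by rewrite -[e in RHS](hornerC e x) -horner_evalE horner_map.
apply: cvg_lim => //; rewrite a0 /awpol E.
have H : (map_poly (horner_eval x) S).[e] @[e --> 0^'] --> (map_poly (horner_eval x) S).[0].
  by apply: cvg_within_filter; exact: continuous_horner.
apply: cvg_trans H; apply: near_eq_cvg; near=> e.
have e0 : e != 0 by near: e; exact: nbhs_dnbhs_neq.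
have e1 : `|e| < 1 by near: e; exact: dnbhs0_lt.
by rewrite aw_nz_AWP // -awpol_AWP // /awpol E.
Unshelve. all: by end_near. Qed.

Lemma awpol_ortho m n a b c d : `|a| < 1 -> `|b| < 1 -> `|c| < 1 -> `|d| < 1 ->
  qpoch q (a * b * c * d) (n + n) * L a b c d (awpol m a b c d * awpol n a b c d) =
  (m == n)%:R * (qpoch q (awC q n a b c d) n * (qpoch q q n * qpoch q (a * b) n *
    qpoch q (a * c) n * qpoch q (a * d) n * qpoch q (b * c) n * qpoch q (b * d) n *
    qpoch q (c * d) n)) * L a b c d 1.
Proof.
move=> a1 b1 c1 d1; apply/eqP; rewrite -subr_eq0 -awL_defect //.
by rewrite awL_awpol.
Qed.

End parameters.

(** * From the angle to the interval *)

Section cosine_substitution.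
Variable R : realType.
Implicit Types G : R -> R.

Lemma derive1_cos : (@cos R)^`() = fun t => - sin t.
Proof. by apply/funext => t; rewrite derive1E; exact: derive_val. Qed.

Lemma bint_cos G : (forall x, `|x| <= 1 -> {for x, continuous G}) ->
  bint (-1) 1 G = bint 0 pi (fun t => G (cos t) * sin t).
Proof.
move=> cG; have csin : continuous (fun t : R => - sin t).
  by move=> t; apply: cvgN; exact: continuous_sin.
have H := @integration_by_substitution_decreasing R (@cos R) G 0 pi (pi_ge0 R).
rewrite /bint /Rintegral -{1}cospi -{1}cos0 H.
- congr fine; apply: eq_integral => t _; congr EFin.
  by rewrite derive1_cos /=; congr (_ * _); rewrite /= opprK.
- by move=> x y hx hy xy; rewrite ltr_cos.
- by move=> t _; rewrite derive1_cos; exact: csin.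
- rewrite derive1_cos; apply/cvg_ex; exists (- sin 0).
  by apply: cvg_at_right_filter; exact: csin.
- rewrite derive1_cos; apply/cvg_ex; exists (- sin pi).
  by apply: cvg_at_left_filter; exact: csin.
- apply: is_derive_oo => t; exact: is_derive_cos.
- apply: continuous_in_subspaceT => x; rewrite cospi cos0 inE /= in_itv /= -ler_norml.
  exact: cG.
Qed.

End cosine_substitution.

Section on_the_interval.
Variables (R : realType) (q : R).
Hypothesis hq : 0 < q < 1.
Implicit Types (a b c d x t : R) (p : {poly R}).
Local Notation gk := (gker q).
Local Notation L := (awL q).

Let q_gt0 : 0 < q. Proof. by case/andP: hq. Qed.
Let q_lt1 : q < 1. Proof. by case/andP: hq. Qed.

Definition aw_density p a b c d x : R :=
  p.[x] * (4 * Num.sqrt (1 - x ^+ 2)) * gk a b c d x.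

Lemma continuous_semicircle p : continuous (fun x => p.[x] * (4 * Num.sqrt (1 - x ^+ 2))).
Proof.
move=> x; apply: cvgM; first exact: continuous_horner.
apply: cvgMl_tmp; apply: (@continuous_comp _ _ _ (fun y : R => 1 - y ^+ 2) (@Num.sqrt R)).
  by apply: cvgB; [exact: cvg_cst|exact: exprn_continuous].
exact: sqrt_continuous.
Qed.

(** The substitution [x = cos t] applies to the continuous truncations of the
    density, and both integrals pass to the limit. *)
Lemma aw_density_bint p a b c d : `|a| < 1 -> `|b| < 1 -> `|c| < 1 -> `|d| < 1 ->
  bmeas (-1) 1 (aw_density p a b c d) /\ bint (-1) 1 (aw_density p a b c d) = L a b c d p.
Proof.
move=> a1 b1 c1 d1; pose r := Num.max (Num.max `|a| `|b|) (Num.max `|c| `|d|).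
have r1 : r < 1 by rewrite !gt_max a1 b1 c1 d1.
have [C hC] := gfin_bounded hq r1.
have hr : [/\ `|a| <= r, `|b| <= r, `|c| <= r & `|d| <= r].
  by rewrite /r !le_max !lexx ?orbT.
have [ar br cr dr] := hr.
pose f N x := p.[x] * (4 * Num.sqrt (1 - x ^+ 2)) * gfin q a b c d x N.
have cf N x : `|x| <= 1 -> {for x, continuous (f N)}.
  by move=> x1; apply: cvgM; [exact: continuous_semicircle|exact: continuous_gfin].
have [mp [B hB]] := @bmeas_continuous R (-1) 1 _ (@continuous_semicircle p).
have [] := @bint_cvg R (-1) 1 f (aw_density p a b c d) (B * C).
- move=> N; apply: subspace_continuous_measurable_fun; first exact: measurable_itv.
  apply: continuous_in_subspaceT => x; rewrite inE /= in_itv /= -ler_norml; exact: cf.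
- move=> N x Ix; rewrite /f normrM ler_pM ?hB ?hC //.
  by move: Ix; rewrite /= in_itv /= -ler_norml.
- move=> x; rewrite /= in_itv /= -ler_norml => x1.
  by apply: cvgMl_tmp; exact: gfin_cvg.
move=> bm H1; split; first exact: bm.
have [mp' [B' hB']] := bmeas_poly_sin2 p.
have [] := @bint_cvg R 0 pi
  (fun N t => p.[cos t] * (4 * sin t ^+ 2) * gfin q a b c d (cos t) N)
  (fun t => p.[cos t] * (4 * sin t ^+ 2) * gk a b c d (cos t)) (B' * C).
- move=> N; apply: measurable_realfun.measurable_funM => //.
  apply: measurable_funTS; apply: continuous_measurable_fun.
  exact: continuous_gfin_cos.
- by move=> N t It; rewrite normrM ler_pM ?hB' ?hC ?norm_cos_le1.
- by move=> t _; apply: cvgMl_tmp; apply: gfin_cvg; rewrite ?norm_cos_le1.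
move=> _ H2; apply: (cvg_unique (@Rhausdorff R) H1).
rewrite (_ : (fun N => bint (-1) 1 (f N)) = fun N => bint 0 pi
  (fun t => p.[cos t] * (4 * sin t ^+ 2) * gfin q a b c d (cos t) N)); first exact: H2.
apply/funext => N; rewrite bint_cos; last exact: cf.
apply: eq_bint => t; rewrite inE /= in_itv /= => It.
rewrite /f -sin2cos2 sqrtr_sqr ger0_norm ?sin_ge0_pi //; ring.
Qed.

Definition aw_norm n a b c d : R :=
  2 * pi * qpochinf q (a * b * c * d * q ^+ (n + n)) * qpoch q (awC q n a b c d) n /
  (qpochinf q (q * q ^+ n) * qpochinf q (a * b * q ^+ n) * qpochinf q (a * c * q ^+ n) *
   qpochinf q (a * d * q ^+ n) * qpochinf q (b * c * q ^+ n) * qpochinf q (b * d * q ^+ n) *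
   qpochinf q (c * d * q ^+ n)).

(** The finite products of [awpol_ortho] combine with the infinite ones of
    [awL_one], by [(e; q)_oo = (e; q)_n (e q^n; q)_oo]. *)
Lemma awL_awpol_norm m n a b c d : `|a| < 1 -> `|b| < 1 -> `|c| < 1 -> `|d| < 1 ->
  L a b c d (awpol q m a b c d * awpol q n a b c d) = (m == n)%:R * aw_norm n a b c d.
Proof.
move=> a1 b1 c1 d1; have := awpol_ortho hq m n a1 b1 c1 d1.
have nq : `|q| < 1 by rewrite gtr0_norm.
have A1 : `|a * b * c * d| < 1 by rewrite !normM_lt1.
have P := normM_lt1; have := (P R _ _ a1 b1, P R _ _ a1 c1, P R _ _ a1 d1).
move=> [[ab ac] ad]; have bc := P R _ _ b1 c1; have bd := P R _ _ b1 d1; have cd := P R _ _ c1 d1.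
rewrite awL_one // /aw_norm (qpochinf_split hq (n + n) (ltW A1)) (qpochinf_split hq n (ltW nq)).
rewrite (qpochinf_split hq n (ltW ab)) (qpochinf_split hq n (ltW ac)) (qpochinf_split hq n (ltW ad)).
rewrite (qpochinf_split hq n (ltW bc)) (qpochinf_split hq n (ltW bd)) (qpochinf_split hq n (ltW cd)).
have A0 := qpoch_small_neq0 hq (n + n) A1.
move=> E; apply: (mulfI A0); rewrite E.
have N e : `|e| < 1 -> qpoch q e n != 0 by move=> e1; exact: qpoch_small_neq0.
have I e : `|e| < 1 -> qpochinf q (e * q ^+ n) != 0.
  by move=> e1; apply: qpochinf_neq0 => //; exact: normMX_lt1.
move: (N _ nq) (N _ ab) (N _ ac) (N _ ad) (N _ bc) (N _ bd) (N _ cd).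
move: (I _ nq) (I _ ab) (I _ ac) (I _ ad) (I _ bc) (I _ bd) (I _ cd).
move: (qpochinf q (q * q ^+ n)) (qpochinf q (a * b * q ^+ n)) (qpochinf q (a * c * q ^+ n)).
move: (qpochinf q (a * d * q ^+ n)) (qpochinf q (b * c * q ^+ n)) (qpochinf q (b * d * q ^+ n)).
move: (qpochinf q (c * d * q ^+ n)) (qpoch q q n) (qpoch q (a * b) n) (qpoch q (a * c) n).
move: (qpoch q (a * d) n) (qpoch q (b * c) n) (qpoch q (b * d) n) (qpoch q (c * d) n).
move=> x1 x2 x3 x4 x5 x6 x7 y1 y2 y3 y4 y5 y6 y7.
move=> h1 h2 h3 h4 h5 h6 h7 h8 h9 h10 h11 h12 h13 h14.
by field; rewrite ?h1 ?h2 ?h3 ?h4 ?h5 ?h6 ?h7 ?h8 ?h9 ?h10 ?h11 ?h12 ?h13 ?h14.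
Qed.

(** The first factors of [h q x 1] and [h q x (-1)] have product [4 (1 - x^2)]. At
    the end points, where the square root is zero, both sides are zero. *)
Lemma weight_semicircle x : `|x| <= 1 ->
  h q x 1 * h q x (Num.sqrt q) * h q x (-1) * h q x (- Num.sqrt q) / Num.sqrt (1 - x ^+ 2) =
  4 * Num.sqrt (1 - x ^+ 2) *
  (h q x q * h q x (- q) * h q x (Num.sqrt q) * h q x (- Num.sqrt q)).
Proof.
move=> x1; rewrite (@h_shift _ _ hq x 1) ?normr1 // (@h_shift _ _ hq x (-1)) ?normrN1 //.
rewrite mul1r mulN1r; have x2 : 0 <= 1 - x ^+ 2.
  by rewrite subr_ge0 -real_normK ?num_real // exprn_ile1.
have s2 : 1 - x ^+ 2 = Num.sqrt (1 - x ^+ 2) ^+ 2 by rewrite sqr_sqrtr.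
set s := Num.sqrt (1 - x ^+ 2) in s2 *.
transitivity (4 * (1 - x ^+ 2) / s *
  (h q x q * h q x (- q) * h q x (Num.sqrt q) * h q x (- Num.sqrt q))); first by ring.
congr (_ * _); rewrite s2; have [->|s0] := eqVneq s 0; first by rewrite expr0n !mulr0 mul0r.
by field.
Qed.

End on_the_interval.

(** * Two variables *)

Section square.
Local Open Scope classical_set_scope.
Variable R : realType.
Implicit Types (f g : R -> R) (F : R -> R -> R).
Let I : set R := `[(-1), 1].
Local Notation mu := (@lebesgue_measure R).

Lemma square_integral_prod F f g : bmeas (-1) 1 f -> bmeas (-1) 1 g ->
  (forall x y, I x -> I y -> F x y = f x * g y) ->
  is_square_integral F (bint (-1) 1 f * bint (-1) 1 g).
Proof.
move=> bf bg FE; have [mf [B hB]] := bf; have [mg [C hC]] := bg.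
have mI : measurable I by exact: measurable_itv.
have mII : measurable (I `*` I) by exact: measurableX.
split.
  have iG : (mu \x mu)%E.-integrable (I `*` I) (EFin \o (fun z => f z.1 * g z.2)).
    apply: measurable_bounded_integrable => //.
    - have E : (mu \x mu)%E (I `*` I) = (mu I * mu I)%E by exact: product_measure1E.
      rewrite [ltLHS]E; have -> : mu I = 2%:E.
        by rewrite /I lebesgue_measure_itv /= lte_fin gtrN // -EFinB opprK.
      by rewrite -EFinM ltry.
    - apply: measurable_realfun.measurable_funM.
        apply: (@measurable_comp _ _ _ _ _ _ I f) => //.
        + by move=> _ [z [z1 z2] <-].
        + exact: measurable_funTS.
      apply: (@measurable_comp _ _ _ _ _ _ I g) => //.
      + by move=> _ [z [z1 z2] <-].
      + exact: measurable_funTS.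
    - exists (B * C); split; first exact: num_real.
      move=> M BM z [z1 z2] /=; rewrite (le_trans _ (ltW BM)) // normrM ler_pM //.
        exact: hB.
      exact: hC.
  apply: eq_integrable iG => // z; rewrite inE => -[z1 z2] /=.
  by rewrite FE.
have If := bmeas_integrable bf; have Ig := bmeas_integrable bg.
have ff : (\int[mu]_(x in I) (f x)%:E)%E = (bint (-1) 1 f)%:E.
  by rewrite /bint /Rintegral fineK //; exact: integrable_fin_num.
have fg : (\int[mu]_(x in I) (g x)%:E)%E = (bint (-1) 1 g)%:E.
  by rewrite /bint /Rintegral fineK //; exact: integrable_fin_num.
transitivity (\int[mu]_(y in I) ((bint (-1) 1 f)%:E * (g y)%:E))%E.
  apply: eq_integral => y; rewrite inE => Iy.
  rewrite -ff -[RHS]muleC -(integralZl _ If) //; apply: eq_integral => x; rewrite inE => Ix.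
  by rewrite FE // EFinM muleC.
by rewrite (integralZl _ Ig) // fg EFinM.
Qed.

End square.

Section real_powers.
Variables (R : realType) (q : R).
Hypothesis hq : 0 < q < 1.
Implicit Types (a b c d e x : R).

Let q_gt0 : 0 < q. Proof. by case/andP: hq. Qed.

Lemma norm_powR_lt1 a e : `|a| < 1 -> 0 <= e -> `|a * q `^ e| < 1.
Proof.
move=> a1 e0; rewrite normrM (le_lt_trans _ a1) // ler_piMr // ger0_norm ?powR_ge0 //.
have /andP[_ q1] := hq.
by rewrite -(powRr0 q); apply: ger_powR => //; rewrite q_gt0 ltW.
Qed.

End real_powers.

Section weights.
Variables (R : realType) (q : R).
Hypothesis hq : 0 < q < 1.
Implicit Types (a b c d e x : R).
Local Notation small a := (`|a| < 1).

Lemma integrand_density p r a b c d x : `|x| <= 1 ->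
  small a -> small b -> small c -> small d ->
  p * r / h q x d *
  (h q x 1 * h q x (Num.sqrt q) * h q x (-1) * h q x (- Num.sqrt q) /
   (h q x a * h q x b * h q x c * Num.sqrt (1 - x ^+ 2))) =
  p * r * (4 * Num.sqrt (1 - x ^+ 2)) * gker q a b c d x.
Proof.
move=> x1 a1 b1 c1 d1; have ha := lt0r_neq0 (h_gt0 hq x1 a1); have hb := lt0r_neq0 (h_gt0 hq x1 b1).
have hc := lt0r_neq0 (h_gt0 hq x1 c1); have hd := lt0r_neq0 (h_gt0 hq x1 d1).
rewrite invfM (mulrA _ (_ * _)^-1) [_ * (_ * _)^-1]mulrC -(mulrA (_ * _)^-1).
rewrite weight_semicircle // /gker; move: (Num.sqrt (1 - x ^+ 2)) => s.
by field; rewrite ha hb hc hd.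
Qed.

End weights.

Section norms.
Variables (R : realType) (q : R).
Hypothesis hq : 0 < q < 1.
Implicit Types (a b c d e x : R).

Let q_gt0 : 0 < q. Proof. by case/andP: hq. Qed.

Lemma Knorm_aw_norm k a b c d : Knorm q a b c d k = aw_norm q k a b c d.
Proof.
by rewrite /Knorm /aw_norm /qpochsinf !big_cons !big_nil mulr1 mul2n -addnn exprS !mulrA.
Qed.

Lemma aw_norm_powR n a b c d e f :
  aw_norm q n a b (c * q `^ e) (d * q `^ f) =
  2 * pi * qpochinf q (a * b * c * d * q `^ (2 * n%:R + (e + f))) *
  qpoch q (a * b * c * d * q `^ (n%:R + (e + f) - 1)) n /
  qpochsinf q [:: q ^+ n.+1; a * b * q ^+ n; a * c * q `^ (n%:R + e);
    a * d * q `^ (n%:R + f); b * c * q `^ (n%:R + e); b * d * q `^ (n%:R + f);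
    c * d * q `^ (n%:R + (e + f))].
Proof.
have P u v : q `^ (u + v) = q `^ u * q `^ v by rewrite powRD // lt0r_neq0 // implybT.
have N (m : nat) : q `^ m%:R = q ^+ m by rewrite powR_mulrn // ltW.
rewrite /aw_norm /qpochsinf !big_cons big_nil mulr1.
have E2 : q `^ (2 * n%:R + (e + f)) = q ^+ (n + n) * (q `^ e * q `^ f).
  by rewrite !P -natrM mul2n -addnn N.
have C : awC q n a b (c * q `^ e) (d * q `^ f) = a * b * c * d * q `^ (n%:R + (e + f) - 1).
  rewrite /awC.
  have -> : n%:R + (e + f) - 1 = (n%:Z - 1)%:~R + (e + f) by rewrite intrB; ring.
  by rewrite !P powR_intmul ?ltW //; ring.
rewrite C E2 !P !N exprS !mulrA.
congr (_ * _ / _); first by congr (_ * qpochinf q _); ring.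
by congr (_ * _ * _ * _ * _ * _ * _); congr (qpochinf q _); ring.
Qed.

End norms.

Section two_variables.
Variables (R : realType) (q : R).
Hypothesis hq : 0 < q < 1.
Local Notation small a := (`|a| < 1).
Local Open Scope classical_set_scope.

(** Here [C] and [D] give the dependence of the parameters in [x] on the degree in
    [y]. If [k != n] the factor in [y] integrates to zero, whatever the factor in
    [x]; otherwise the two polynomials in [x] have the same parameters. *)
Lemma square_integral_aw (F : R -> R -> R) (a1 b1 : R) (C D : nat -> R) (a2 b2 c2 d2 : R)
    (j k m n : nat) :
  small a1 -> small b1 -> (forall i, small (C i)) -> (forall i, small (D i)) ->
  small a2 -> small b2 -> small c2 -> small d2 ->
  (forall x y, `|x| <= 1 -> `|y| <= 1 -> F x y =
    (aw q j a1 b1 (C k) (D k) x * aw q m a1 b1 (C n) (D n) x / h q x (D n) *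
     (h q x 1 * h q x (Num.sqrt q) * h q x (-1) * h q x (- Num.sqrt q) /
      (h q x a1 * h q x b1 * h q x (C k) * Num.sqrt (1 - x ^+ 2)))) *
    (aw q k a2 b2 c2 d2 y * aw q n a2 b2 c2 d2 y / h q y d2 *
     (h q y 1 * h q y (Num.sqrt q) * h q y (-1) * h q y (- Num.sqrt q) /
      (h q y a2 * h q y b2 * h q y c2 * Num.sqrt (1 - y ^+ 2))))) ->
  is_square_integral F (Knorm q a2 b2 c2 d2 k *
    ((j == m)%:R * (k == n)%:R * aw_norm q j a1 b1 (C k) (D k))).
Proof.
move=> ha1 hb1 hC hD ha2 hb2 hc2 hd2 FE.
pose p1 := awpol q j a1 b1 (C k) (D k) * awpol q m a1 b1 (C n) (D n).
pose p2 := awpol q k a2 b2 c2 d2 * awpol q n a2 b2 c2 d2.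
have [B1 V1] := aw_density_bint hq p1 ha1 hb1 (hC k) (hD n).
have [B2 V2] := aw_density_bint hq p2 ha2 hb2 hc2 hd2.
have -> : Knorm q a2 b2 c2 d2 k * ((j == m)%:R * (k == n)%:R * aw_norm q j a1 b1 (C k) (D k)) =
   bint (-1) 1 (aw_density q p1 a1 b1 (C k) (D n)) * bint (-1) 1 (aw_density q p2 a2 b2 c2 d2).
  rewrite V1 V2 /p1 /p2 awL_awpol_norm //; have [<-|kn] := eqVneq k n; last first.
    by rewrite /= !(mulr0n, mulr0, mul0r).
  rewrite awL_awpol_norm // Knorm_aw_norm mulr1n !mul1r mulr1 mulrC; congr (_ * _).
  by have [->|_] := eqVneq j m; rewrite ?mulr0n ?mul0r.
apply: square_integral_prod => // x y; rewrite /= !in_itv /= -!ler_norml => x1 y1.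
rewrite FE // !integrand_density // /aw_density /p1 /p2 !hornerM.
by rewrite !(aw_awpol hq).
Qed.

End two_variables.

Local Close Scope classical_set_scope.
Unset Implicit Arguments.

Theorem theorem8p2 (R : realType) (q : R)
    (a1 b1 c1 d1 a2 b2 c2 d2 alpha beta gamma delta : R) (j k m n : nat)
    (hq : 0 < q < 1)
    (ha1 : -1 < a1 < 1) (hb1 : -1 < b1 < 1)
    (hc1 : -1 < c1 < 1) (hd1 : -1 < d1 < 1)
    (ha2 : -1 < a2 < 1) (hb2 : -1 < b2 < 1)
    (hc2 : -1 < c2 < 1) (hd2 : -1 < d2 < 1)
    (halpha : 0 <= alpha) (hbeta : 0 <= beta)
    (hgamma : 0 <= gamma) (hdelta : 0 <= delta) :
  is_square_integral
    (fun x y => awu q a1 b1 c1 d1 a2 b2 c2 d2 gamma delta j k x y *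
                awv q a1 b1 c1 d1 a2 b2 c2 d2 gamma delta m n x y *
                W1 q a1 b1 c1 a2 b2 c2 d2 x y)
    (Knorm q a2 b2 c2 d2 k *
     (2 * pi *
      qpochinf q (a1 * b1 * c1 * d1
                  * q `^ (2 * j%:R + gamma * k%:R + delta)) *
      qpoch q (a1 * b1 * c1 * d1
               * q `^ (j%:R + gamma * k%:R + delta - 1)) j *
      (j == m)%:R * (k == n)%:R /
      qpochsinf q
        [:: q ^+ j.+1; a1 * b1 * q ^+ j; a1 * c1 * q ^+ j;
            a1 * d1 * q `^ (j%:R + gamma * k%:R + delta);
            b1 * c1 * q ^+ j;
            b1 * d1 * q `^ (j%:R + gamma * k%:R + delta);
            c1 * d1 * q `^ (j%:R + gamma * k%:R + delta)]))
  /\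
  is_square_integral
    (fun x y => awp q a1 b1 c1 d1 a2 b2 c2 d2 alpha beta gamma delta j k x y *
                awq q a1 b1 c1 d1 a2 b2 c2 d2 alpha beta gamma delta m n x y *
                W2 q a1 b1 c1 a2 b2 c2 d2 x y)
    (Knorm q a2 b2 c2 d2 k *
     (2 * pi *
      qpochinf q (a1 * b1 * c1 * d1
                  * q `^ (2 * j%:R + (alpha + gamma) * k%:R + beta + delta)) *
      qpoch q (a1 * b1 * c1 * d1
               * q `^ (j%:R + (alpha + gamma) * k%:R + beta + delta - 1)) j *
      (j == m)%:R * (k == n)%:R /
      qpochsinf q
        [:: q ^+ j.+1; a1 * b1 * q ^+ j;
            a1 * c1 * q `^ (j%:R + alpha * k%:R + beta);
            a1 * d1 * q `^ (j%:R + gamma * k%:R + delta);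
            b1 * c1 * q `^ (j%:R + alpha * k%:R + beta);
            b1 * d1 * q `^ (j%:R + gamma * k%:R + delta);
            c1 * d1 * q `^ (j%:R + (alpha + gamma) * k%:R + beta + delta)])).
Proof.
rewrite -!ltr_norml in ha1 hb1 hc1 hd1 ha2 hb2 hc2 hd2.
pose C (i : nat) := c1 * q `^ (alpha * i%:R + beta).
pose D (i : nat) := d1 * q `^ (gamma * i%:R + delta).
have hC i : `|C i| < 1 by apply: norm_powR_lt1 => //; rewrite addr_ge0 ?mulr_ge0.
have hD i : `|D i| < 1 by apply: norm_powR_lt1 => //; rewrite addr_ge0 ?mulr_ge0.
split.
- have := @square_integral_aw R q hq (fun x y => awu q a1 b1 c1 d1 a2 b2 c2 d2 gamma delta j k x y *
                awv q a1 b1 c1 d1 a2 b2 c2 d2 gamma delta m n x y *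
                W1 q a1 b1 c1 a2 b2 c2 d2 x y) a1 b1 (fun=> c1) D a2 b2 c2 d2 j k m n
      ha1 hb1 (fun=> hc1) hD ha2 hb2 hc2 hd2.
  have := aw_norm_powR hq j a1 b1 c1 d1 0 (gamma * k%:R + delta).
  rewrite powRr0 mulr1 add0r addr0 !addrA powR_mulrn; last by apply: ltW; case/andP: hq.
  rewrite -/(D k) => -> H.
  set V := (X in is_square_integral _ X); set V' := (X in is_square_integral _ X) in H.
  have -> : V = V' by (rewrite /V /V'; ring).
  apply: H => x y x1 y1; rewrite /awu /awv /W1 /awu /D !invfM; ring.
- have := @square_integral_aw R q hq (fun x y => awp q a1 b1 c1 d1 a2 b2 c2 d2 alpha beta gamma delta j k x y *
                awq q a1 b1 c1 d1 a2 b2 c2 d2 alpha beta gamma delta m n x y *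
                W2 q a1 b1 c1 a2 b2 c2 d2 x y) a1 b1 C D a2 b2 c2 d2 j k m n
      ha1 hb1 hC hD ha2 hb2 hc2 hd2.
  rewrite /C /D aw_norm_powR //.
  have -> : alpha * k%:R + beta + (gamma * k%:R + delta) = (alpha + gamma) * k%:R + beta + delta by ring.
  rewrite !addrA => H.
  set V := (X in is_square_integral _ X); set V' := (X in is_square_integral _ X) in H.
  have -> : V = V' by (rewrite /V /V'; ring).
  apply: H => x y x1 y1.
  (* The factor [h q x c1] of [W2] cancels the one in [W1], and the denominator of
     [awp] puts the shifted parameter in its place. *)
  have hc0 : h q x c1 != 0 by rewrite gt_eqF // h_gt0.
  rewrite /awp /awq /W2 /W1 -/(C k) -/(C n) -/(D k) -/(D n) !invfM -[RHS]mulr1.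
  by rewrite -[X in _ = _ * X](mulfV hc0); ring.
Qed.
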